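(* Let $F_k:{\bf D}_{f,rad}^m(\mathcal H)\to B(\mathcal E)\otimes_{min}B(\mathcal H)$, $k\in\mathbb N$, be a sequence of free pluriharmonic functions such that, for any $r\in[0,1)$, the sequence $\{F_k(rW)\}_{k=1}^\infty$ is convergent in the operator norm topology. Then there is a free pluriharmonic function $F:{\bf D}_{f,rad}^m(\mathcal H)\to B(\mathcal E)\otimes_{min}B(\mathcal H)$ such that $F_k(rW)$ converges to $F(rW)$ in the operator norm, as $k\to\infty$, for any $r\in[0,1)$. In particular, $F_k$ converges to $F$ uniformly on any domain $r{\bf D}_f^m(\mathcal H)$, $r\in[0,1)$.
   Context: Fix integers $n,m\ge1$ and a separable Hilbert space $\mathcal E$; $\mathcal H$ is an infinite-dimensional separable Hilbert space. $\mathbb F_n^+$ is the free monoid on generators $g_1,\dots,g_n$ with identity $g_0$; $|\alpha|$ is the word length ($|g_0|=0$). For operators (or indeterminates) and $\alpha=g_{i_1}\cdots g_{i_k}$ put $X_\alpha:=X_{i_1}\cdots X_{i_k}$, $X_{g_0}:=I$. $f=\sum_{\alpha}a_\alpha Z_\alpha$ is a fixed positive regular free holomorphic function: a formal power series in noncommuting indeterminates with $a_\alpha\ge0$, $a_{g_0}=0$, $a_{g_i}>0$ for $1\le i\le n$, and $\limsup_{k}\big(\sum_{|\alpha|=k}|a_\alpha|^2\big)^{1/2k}<\infty$. Put $b^{(m)}_{g_0}:=1$ and, for $|\alpha|\ge1$, $b^{(m)}_\alpha:=\sum_{j=1}^{|\alpha|}\sum_{\gamma_1\cdots\gamma_j=\alpha,\,|\gamma_i|\ge1}a_{\gamma_1}\cdots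 a_{\gamma_j}\binom{j+m-1}{m-1}$. Domain: for a Hilbert space $\mathcal K$ and $X\in B(\mathcal K)^n$, $\Phi_{f,X}(Y):=\sum_{|\alpha|\ge1}a_\alpha X_\alpha YX_\alpha^*$ (WOT convergence); ${\bf D}_f^m(\mathcal K):=\{X\in B(\mathcal K)^n:(id-\Phi_{f,X})^k(I)\ge0,\ 1\le k\le m\}$; ${\bf D}_{f,rad}^m(\mathcal K):=\bigcup_{0\le t<1}t{\bf D}_f^m(\mathcal K)$. $F^2(H_n)$ is the Hilbert space with orthonormal basis $\{e_\alpha\}_{\alpha\in\mathbb F_n^+}$; $W=(W_1,\dots,W_n)\in{\bf D}_f^m(F^2(H_n))$ is given by $W_ie_\alpha=\sqrt{b^{(m)}_\alpha/b^{(m)}_{g_i\alpha}}\,e_{g_i\alpha}$. $\otimes_{min}$ is the spatial tensor product. A formal power series $F=\sum_\alpha A_{(\alpha)}\otimes Z_\alpha$, $A_{(\alpha)}\in B(\mathcal E)$, is free holomorphic on ${\bf D}^m_{f,rad}$ if $F(X)=\sum_{k=0}^\infty\sum_{|\alpha|=k}A_{(\alpha)}\otimes X_\alpha$ converges in operator norm for every Hilbert space $\mathcal K$ and $X\in{\bf D}_{f,rad}^m(\mathcal K)$. A map $G:{\bf D}_{f,rad}^m(\mathcal H)\to B(\mathcal E)\otimes_{min}B(\mathcal H)$ is self-adjoint free pluriharmonic if $G=\Re F=\frac12(F+F^* )$ for a free holomorphic $F$; a free pluriharmonic function is a linear combination of self-adjoint ones. It has a unique norm-convergent representation $G(X)=\sum_{k\ge1}\sum_{|\alpha|=k}B_{(\alpha)}\otimes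 X_\alpha^*+\sum_{k\ge0}\sum_{|\alpha|=k}A_{(\alpha)}\otimes X_\alpha$, by which it is evaluated on ${\bf D}_{f,rad}^m(\mathcal K)$ for any $\mathcal K$; $G(rW)$ is its value at $rW$, $r\in[0,1)$. *)

(* Defs.v *)
From HB Require Import structures.
From mathcomp Require Import all_boot all_order all_algebra.
From mathcomp Require Import complex.
From mathcomp Require Import all_classical all_reals all_analysis.

Set Implicit Arguments.
Unset Strict Implicit.
Unset Printing Implicit Defensive.

Import Order.TTheory GRing.Theory Num.Theory.
Import numFieldNormedType.Exports.
Local Open Scope classical_set_scope.
Local Open Scope complex_scope.
Local Open Scope ring_scope.

(* The inner product is linear in its first argument.  Positive definiteness
   follows from [inner_norm]. *)
HB.mixin Record CompleteNormedModule_isHilbert (R : realType) H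
    & CompleteNormedModule R[i] H := {
  inner : H -> H -> R[i];
  inner_linear : forall (c : R[i]) (x y z : H),
    inner (c *: x + y) z = c * inner x z + inner y z;
  inner_conj : forall x y : H, inner y x = (inner x y)^*;
  inner_norm : forall x : H, inner x x = `|x| ^+ 2
}.

#[short(type="hilbertType")]
HB.structure Definition Hilbert (R : realType) :=
  {H of CompleteNormedModule R[i] H & CompleteNormedModule_isHilbert R H}.

Definition separable_space (T : topologicalType) : Prop :=
  exists2 D : set T, countable D & dense D.

Definition infinite_dimensional (R : realType) (H : hilbertType R) : Prop :=
  forall (N : nat) (s : 'I_N -> H),
    exists x : H, forall c : 'I_N -> R[i], x <> \sum_(j < N) c j *: s j.

Definition span_of (R : realType) (H : hilbertType R) (S : set H) : set H :=
  [set x | exists (N : nat) (c : 'I_N -> R[i]) (s : 'I_N -> H),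
    (forall j, S (s j)) /\ x = \sum_(j < N) c j *: s j].

Definition orthonormal_basis (R : realType) (H : hilbertType R) (I : eqType)
    (e : I -> H) : Prop :=
  (forall i j, inner (e i) (e j) = (i == j)%:R) /\
  closure (span_of (range e)) = setT.

Definition bounded_linear (R : realType) (H : hilbertType R) : {pred H -> H} :=
  fun f => `[< (forall (c : R[i]) x y, f (c *: x + y) = c *: f x + f y) /\
               (exists M : R, forall x, `|f x| <= M%:C * `|x|) >].

Record bop (R : realType) (H : hilbertType R) := Bop {
  op_fun :> H -> H;
  op_funP : op_fun \in @bounded_linear R H
}.

Notation "''B' ( H )" := (bop H) (at level 8, format "''B' ( H )").

Section BoundedOperators.
Context (R : realType) (H : hilbertType R).
Implicit Types f g : 'B(H).

HB.instance Definition _ := [isSub of 'B(H) for @op_fun R H].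
HB.instance Definition _ := [Choice of 'B(H) by <:].

Lemma bounded_linear_submod : GRing.submod_closed (@bounded_linear R H).
Proof.
split.
  apply/asboolP; split; first by move=> c x y; rewrite scaler0 addr0.
  by exists 0 => x; rewrite normr0 mul0r.
move=> c f g /asboolP[fl [M fM]] /asboolP[gl [N gN]]; apply/asboolP; split.
  move=> d x y; rewrite !fctE/= fl gl !scalerDr !scalerA (mulrC c d).
  by rewrite -!addrA; congr (_ + _); rewrite addrCA.
have [r rc] : exists r : R, `|c| = r%:C by rewrite normc_def; eexists.
exists (r * M + N) => x; rewrite !fctE/= (le_trans (ler_normD _ _))//.
rewrite rmorphD rmorphM/= mulrDl lerD// normrZ -rc -mulrA.
exact: ler_wpM2l.
Qed.

HB.instance Definition _ :=
  GRing.isSubmodClosed.Build R[i] (H -> H) (@bounded_linear R H)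
    bounded_linear_submod.
HB.instance Definition _ := [SubChoice_isSubLmodule of 'B(H) by <:].

Lemma op_ext f g : (forall x, f x = g x) -> f = g.
Proof. by move=> fg; apply: val_inj; apply/funext. Qed.

Lemma op_linear f (c : R[i]) x y : f (c *: x + y) = c *: f x + f y.
Proof. by have /asboolP[+ _] := op_funP f; apply. Qed.

Lemma op_bounded f : exists M : R, forall x, `|f x| <= M%:C * `|x|.
Proof. by have /asboolP[_] := op_funP f. Qed.

Lemma op0 f : f 0 = 0.
Proof.
have := op_linear f (-1) 0 0.
by rewrite scaler0 addr0 scaleN1r addNr.
Qed.

Lemma op_addE f g x : (f + g) x = f x + g x. Proof. by []. Qed.
Lemma op_scaleE (c : R[i]) f x : (c *: f) x = c *: f x. Proof. by []. Qed.
Lemma op_zeroE x : (0 : 'B(H)) x = 0. Proof. by []. Qed.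

Fact id_op_subproof : (fun x : H => x) \in @bounded_linear R H.
Proof. by apply/asboolP; split=> //; exists 1 => x; rewrite mul1r. Qed.
Definition id_op : 'B(H) := Bop id_op_subproof.

Fact comp_op_subproof f g : (fun x => f (g x)) \in @bounded_linear R H.
Proof.
apply/asboolP; split; first by move=> c x y; rewrite !op_linear.
have [M fM] := op_bounded f; have [N gN] := op_bounded g.
exists (`|M| * N) => x; rewrite (le_trans (fM _))// rmorphM/= -mulrA.
apply: (@le_trans _ _ (`|M|%:C * `|g x|)).
  by rewrite ler_wpM2r// lecR ler_norm.
by rewrite ler_wpM2l// ler0c.
Qed.
Definition comp_op f g : 'B(H) := Bop (comp_op_subproof f g).

Fact comp_opA : associative comp_op.
Proof. by move=> f g h; exact: op_ext. Qed.
Fact comp_1op : left_id id_op comp_op.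
Proof. by move=> f; exact: op_ext. Qed.
Fact comp_op1 : right_id id_op comp_op.
Proof. by move=> f; exact: op_ext. Qed.
Fact comp_opDl : left_distributive comp_op +%R.
Proof. by move=> f g h; exact: op_ext. Qed.
Fact comp_opDr : right_distributive comp_op +%R.
Proof.
move=> f g h; apply: op_ext => x; change (f (g x + h x) = f (g x) + f (h x)).
by have := op_linear f 1 (g x) (h x); rewrite !scale1r.
Qed.

(* Multiplication is composition; a possibly-zero ring since H may be 0. *)
HB.instance Definition _ := GRing.Zmodule_isPzRing.Build 'B(H)
  comp_opA comp_1op comp_op1 comp_opDl comp_opDr.

Lemma op_mulE f g x : (f * g) x = f (g x). Proof. by []. Qed.
Lemma op_oneE x : (1 : 'B(H)) x = x. Proof. by []. Qed.

Definition unit_ball_values f : set R :=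
  [set r | exists2 x : H, `|x| <= 1 & `|f x| = r%:C].

Definition opnorm f : R := sup (unit_ball_values f).

Lemma unit_ball_values_has_sup f : has_sup (unit_ball_values f).
Proof.
split; first by exists 0, 0; rewrite ?normr0 ?ler01// op0 normr0.
have [M fM] := op_bounded f; exists `|M| => r [x x1 fxr].
rewrite -lecR -fxr (le_trans (fM x))// (@le_trans _ _ (`|M|%:C * `|x|))//.
  by rewrite ler_wpM2r// lecR ler_norm.
by rewrite -[leRHS]mulr1 ler_wpM2l// ler0c.
Qed.

Lemma norm_real (V : normedModType R[i]) (x : V) :
  exists2 r : R, 0 <= r & `|x| = r%:C.
Proof.
have := normr_ge0 x; case: (`|x|) => a b; rewrite lecE/= => /andP[/eqP -> a0].
by exists a.
Qed.

Lemma opnorm_ub f x : `|f x| <= (opnorm f)%:C * `|x|.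
Proof.
have [->|x0] := eqVneq x 0; first by rewrite op0 !normr0 mulr0.
have nx0 : 0 < `|x| by rewrite normr_gt0.
rewrite -ler_pdivrMr//.
have fZ : f (`|x|^-1 *: x) = `|x|^-1 *: f x.
  by rewrite -[_ *: x]addr0 op_linear op0 addr0.
have fxE : `|f (`|x|^-1 *: x)| = `|f x| / `|x|.
  by rewrite fZ normrZ normfV normr_id mulrC.
rewrite -fxE; have [r r0 rE] := norm_real (f (`|x|^-1 *: x)).
rewrite rE lecR; apply: ub_le_sup.
  by case: (unit_ball_values_has_sup f).
exists (`|x|^-1 *: x) => //.
by rewrite normrZ normfV normr_id mulVf// gt_eqF.
Qed.

Lemma opnorm_le f (M : R) : 0 <= M ->
  (forall x, `|f x| <= M%:C * `|x|) -> opnorm f <= M.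
Proof.
move=> M0 fM; apply: ge_sup; first by case: (unit_ball_values_has_sup f).
move=> r [x x1 fxr]; rewrite -lecR -fxr (le_trans (fM x))//.
by rewrite -[leRHS]mulr1 ler_wpM2l// ler0c.
Qed.

Lemma opnorm_ge0 f : 0 <= opnorm f.
Proof.
apply: ub_le_sup; first by case: (unit_ball_values_has_sup f).
by exists 0; rewrite ?normr0 ?ler01// op0 normr0.
Qed.

Fact ler_opnormD f g : (opnorm (f + g))%:C <= (opnorm f)%:C + (opnorm g)%:C.
Proof.
rewrite -rmorphD/= lecR; apply: opnorm_le => [|x].
  by rewrite addr_ge0 ?opnorm_ge0.
rewrite op_addE (le_trans (ler_normD _ _))// rmorphD mulrDl.
by rewrite lerD// opnorm_ub.
Qed.

Fact opnormZ (c : R[i]) f : (opnorm (c *: f))%:C = `|c| * (opnorm f)%:C.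
Proof.
have le_Z d g : (opnorm (d *: g))%:C <= `|d| * (opnorm g)%:C.
  have [r r0 rE] : exists2 r : R, 0 <= r & `|d| = r%:C.
    exact: (norm_real (d : R[i]^o)).
  rewrite rE -rmorphM/= lecR; apply: opnorm_le => [|x].
    by rewrite mulr_ge0 ?opnorm_ge0.
  rewrite op_scaleE normrZ rE rmorphM/= -mulrA ler_wpM2l ?ler0c//.
  exact: opnorm_ub.
apply/eqP; rewrite eq_le le_Z/=.
have [->|c0] := eqVneq c 0; first by rewrite normr0 mul0r ler0c opnorm_ge0.
have := le_Z c^-1 (c *: f); rewrite scalerA mulVf// scale1r normfV.
by rewrite ler_pdivlMl ?normr_gt0.
Qed.

Fact opnorm0_eq0 f : (opnorm f)%:C = 0 -> f = 0.
Proof.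
move=> f0; apply: op_ext => x; apply/eqP.
by rewrite op_zeroE -normr_le0 (le_trans (opnorm_ub f x))// f0 mul0r.
Qed.

(* The norm of a normed module over R[i] is R[i]-valued. *)
HB.instance Definition _ := Lmodule_isNormed.Build R[i] 'B(H)
  ler_opnormD opnormZ opnorm0_eq0.

Definition psd f : Prop := forall x, 0 <= inner (f x) x.

(* The adjoint exists by the Riesz representation theorem and is unique. *)
Definition adjoint f : 'B(H) :=
  get [set g : 'B(H) | forall x y, inner (f x) y = inner x (g y)].

Definition wot_cvg (S : nat -> 'B(H)) (Z : 'B(H)) : Prop :=
  forall x y, (fun N => inner (S N x) y : R[i]^o) @ \oo --> (inner (Z x) y : R[i]^o).

End BoundedOperators.

Notation "f ^~*" := (adjoint f) (at level 2, format "f ^~*").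

(* A Hilbert tensor product is determined by these axioms up to a unitary
   compatible with the elementary tensors. *)
Record hilbert_tensor (R : realType) (E K : hilbertType R) := HilbertTensor {
  tspace :> hilbertType R;
  tens : E -> K -> tspace;
  tens_linearl : forall (c : R[i]) x x' y,
    tens (c *: x + x') y = c *: tens x y + tens x' y;
  tens_linearr : forall (c : R[i]) x y y',
    tens x (c *: y + y') = c *: tens x y + tens x y';
  inner_tens : forall x x' y y',
    inner (tens x y) (tens x' y') = inner x x' * inner y y';
  tens_total : closure (span_of [set v | exists x y, v = tens x y]) = setT
}.

(* The bounded operator [A (x) X] on [E (x) K]: it exists and is unique. *)
Definition tens_op (R : realType) (E K : hilbertType R)
    (T : hilbert_tensor E K) (A : 'B(E)) (X : 'B(K)) : 'B(T) :=
  get [set S : 'B(T) | forall x y, S (tens T x y) = tens T (A x) (X y)].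

(* The spatial tensor product [B(E) (x)_min B(K)]: the operator-norm closure of
   the algebraic tensor product inside [B(E (x) K)]. *)
Definition min_tensor (R : realType) (E K : hilbertType R)
    (T : hilbert_tensor E K) : set 'B(T) :=
  closure [set V | exists (N : nat) (A : 'I_N -> 'B(E)) (X : 'I_N -> 'B(K)),
    V = \sum_(j < N) tens_op T (A j) (X j)].

(* The free monoid on n generators is [seq 'I_n], with [++] and [[::]]. *)
Definition word_op (n : nat) (A : pzRingType) (X : 'I_n -> A) (w : seq 'I_n) :
  A := \prod_(i <- w) X i.

Definition scale_tuple (R : realType) (K : hilbertType R) (n : nat) (t : R)
  (X : 'I_n -> 'B(K)) : 'I_n -> 'B(K) := fun i => t%:C *: X i.

Definition positive_regular (R : realType) (n : nat) (a : seq 'I_n -> R) :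
    Prop :=
  [/\ forall w, 0 <= a w, a [::] = 0, forall i, 0 < a [:: i] &
      (limn_esup (fun k =>
         ((\sum_(w : k.-tuple 'I_n) `|a w| ^+ 2) `^ ((2 * k)%:R)^-1)%:E)
       < +oo)%E].

(* The inner sum runs over the j-tuples of nonempty words whose concatenation
   is w; such words have length at most [size w]. *)
Definition bcoef (R : realType) (n m : nat) (a : seq 'I_n -> R)
    (w : seq 'I_n) : R :=
  if w is [::] then 1 else
  \sum_(1 <= j < (size w).+1)
    \sum_(g : j.-tuple ((size w).-bseq 'I_n) |
          (flatten [seq bseqval v | v <- g] == w)
          && all (fun v : (size w).-bseq 'I_n => 0 < size v)%N g)
      (\prod_(v <- g) a (bseqval v)) * 'C(j + m - 1, m - 1)%:R.

Section Domains.
Context (R : realType) (n m : nat) (a : seq 'I_n -> R).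

Section OneSpace.
Context (K : hilbertType R).
Implicit Types (X : 'I_n -> 'B(K)) (Y : 'B(K)).

Definition Phi_partial X Y : nat -> 'B(K) :=
  series (fun k => \sum_(w : k.+1.-tuple 'I_n)
    (a w)%:C *: (word_op X w * Y * (word_op X w)^~*)).

Definition Phi_defined X : Prop :=
  forall Y, exists Z, wot_cvg (Phi_partial X Y) Z.

Definition Phi X Y : 'B(K) := get [set Z | wot_cvg (Phi_partial X Y) Z].

Definition ncdom : set ('I_n -> 'B(K)) :=
  [set X | Phi_defined X /\ forall k, (1 <= k <= m)%N ->
             psd (iter k (fun Y => Y - Phi X Y) 1)].

Definition scaled_ncdom (r : R) : set ('I_n -> 'B(K)) :=
  scale_tuple r @` ncdom.

Definition ncdom_rad : set ('I_n -> 'B(K)) :=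
  [set X | exists t : R, 0 <= t < 1 /\ scaled_ncdom t X].

End OneSpace.

Definition is_universal_model (F2 : hilbertType R) (e : seq 'I_n -> F2)
    (W : 'I_n -> 'B(F2)) : Prop :=
  forall i w, W i (e w) =
    (Num.sqrt (bcoef m a w / bcoef m a (i :: w)))%:C *: e (i :: w).

(* [T K] is the tensor product of the coefficient space E with K. *)
Context (E : hilbertType R) (T : forall K : hilbertType R, hilbert_tensor E K).

Definition holo_term (A : seq 'I_n -> 'B(E)) (K : hilbertType R)
    (X : 'I_n -> 'B(K)) (k : nat) : 'B(T K) :=
  \sum_(w : k.-tuple 'I_n) tens_op (T K) (A w) (word_op X w).

Definition antiholo_term (B : seq 'I_n -> 'B(E)) (K : hilbertType R)
    (X : 'I_n -> 'B(K)) (k : nat) : 'B(T K) :=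
  \sum_(w : k.-tuple 'I_n) tens_op (T K) (B w) (word_op X w)^~*.

Definition free_holomorphic (A : seq 'I_n -> 'B(E)) : Prop :=
  forall (K : hilbertType R) (X : 'I_n -> 'B(K)), ncdom_rad X ->
    cvgn (series (holo_term A X)).

Definition holo_eval (A : seq 'I_n -> 'B(E)) (K : hilbertType R)
    (X : 'I_n -> 'B(K)) : 'B(T K) := limn (series (holo_term A X)).

(* Functions on [ncdom_rad] are represented by total functions, of which only
   the values on [ncdom_rad] matter. *)
Section PluriharmonicOn.
Context (H : hilbertType R).
Implicit Types G : ('I_n -> 'B(H)) -> 'B(T H).

Definition maps_to_min_tensor G : Prop :=
  forall X, ncdom_rad X -> min_tensor (G X).

Definition sa_pluriharmonic G : Prop :=
  maps_to_min_tensor G /\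
  exists2 A, free_holomorphic A &
    forall X, ncdom_rad X ->
      G X = (2^-1 : R[i]) *: (holo_eval A X + (holo_eval A X)^~*).

Definition pluriharmonic G : Prop :=
  maps_to_min_tensor G /\
  exists (N : nat) (c : 'I_N -> R[i]) (S : 'I_N -> ('I_n -> 'B(H)) -> 'B(T H)),
    (forall j, sa_pluriharmonic (S j)) /\
    forall X, ncdom_rad X -> G X = \sum_(j < N) c j *: S j X.

Definition ph_cvg (AB : (seq 'I_n -> 'B(E)) * (seq 'I_n -> 'B(E)))
    (K : hilbertType R) (X : 'I_n -> 'B(K)) : Prop :=
  cvgn (series (fun k => antiholo_term AB.2 X k.+1)) /\
  cvgn (series (holo_term AB.1 X)).

Definition ph_sum (AB : (seq 'I_n -> 'B(E)) * (seq 'I_n -> 'B(E)))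
    (K : hilbertType R) (X : 'I_n -> 'B(K)) : 'B(T K) :=
  limn (series (fun k => antiholo_term AB.2 X k.+1)) +
  limn (series (holo_term AB.1 X)).

Definition ph_coefs G (AB : (seq 'I_n -> 'B(E)) * (seq 'I_n -> 'B(E))) : Prop :=
  (* [AB.2 [::]] is not used; it is normalized to make AB unique *)
  AB.2 [::] = 0 /\
  forall X, ncdom_rad X -> ph_cvg AB X /\ G X = ph_sum AB X.

(* Evaluation of the free pluriharmonic function G on [ncdom_rad] over any
   Hilbert space K, through its unique representing coefficients. *)
Definition ph_eval G (K : hilbertType R) (X : 'I_n -> 'B(K)) : 'B(T K) :=
  ph_sum (get (ph_coefs G)) X.

End PluriharmonicOn.
End Domains.

(* Main.v *)
(** Let [f = sum_w a_w Z_w] and let [b] be the weights of the universal model [W].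
    On the domain only [Phi_{f,X}(I) <= I] is needed: it gives
    [sum_{|w| = k} (f^j)_w X_w X_w^* <= I] for every [j], hence
    [sum_{|w| = k} b_w X_w X_w^* <= C(k+m, m) I] and
    [|sum_{|w| = k} A_w (x) X_w| <= C(k+m, m) |sum_{|w| = k} A_w^* A_w / b_w|^(1/2)].
    Conversely, testing [G(rW)] and [G(rW)^*] on the vectors [x (x) e_{g_0}] gives the
    Cauchy estimates [r^k |sum_{|w| = k} A_w^* A_w / b_w|^(1/2) <= |G(rW)|].
    Therefore convergence of [F_k(rW)] for all [r < 1] forces the coefficients of
    [F_k] to converge, with geometric rates that beat the polynomial factor
    [C(k+m, m)]; the limit coefficients define [G], and the convergence is uniform
    on [t D] for [t < r], over any Hilbert space.
    The coefficients of a function on [H] are unique because the domain contains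
    nilpotent tuples whose only long path from a vacuum vector is a given word. *)

(* The points rW act on F2, whereas each F_k is given only on H. The two spaces meet only in the
   coefficients, which [ph_eval] selects by [get]; hence uniqueness has to be proved with tuples
   acting on H itself, built from arbitrarily long finite orthonormal families. The Cauchy estimates
   rest on two facts: every adjoint of W_i kills e_{g_0}, so the antiholomorphic terms vanish there,
   and the vectors W_w e_{g_0} are mutually orthogonal of norm b_w^(-1/2), so pairing with those of
   degree k isolates degree k. That W lies in the domain is a computation with diagonal operators:
   with b^(p) the coefficients of (1 - f)^-p, the k-th iterate of id - Phi at I has eigenvalues
   b^(m-k)_w / b^(m)_w. The constants in the final bounds come from sum_k C(k+m, m) q^k = (1 -
   q)^-(m+1) at q = t/r. *)
Require Import Defs.
From HB Require Import structures.
From mathcomp Require Import all_boot all_order all_algebra.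
From mathcomp Require Import complex.
From mathcomp Require Import all_classical all_reals all_analysis.
From mathcomp Require Import ring lra.
Import Order.TTheory GRing.Theory Num.Theory.
Import numFieldNormedType.Exports.
Local Open Scope classical_set_scope.
Local Open Scope complex_scope.
Local Open Scope ring_scope.
Set Implicit Arguments.
Unset Strict Implicit.
Unset Printing Implicit Defensive.

(** * Norms and inner products over [R[i]] *)

(* Norms over [R[i]] take values in [R[i]]; [rnorm] is their real value, so that
   estimates can be carried out in [R]. *)
Section RealNorm.
Variable R : realType.

Section Normed.
Variable V : normedZmodType R[i].
Implicit Types x y : V.

Definition rnorm x : R := complex.Re `|x|.

Lemma normE x : `|x| = (rnorm x)%:C.
Proof.
rewrite /rnorm; have := normr_ge0 x; case: (`|x|) => a b.
by rewrite lecE/= => /andP[/eqP -> _].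
Qed.

Lemma rnorm_ge0 x : 0 <= rnorm x.
Proof. by rewrite -lecR -normE normr_ge0. Qed.

Lemma rnorm0 : rnorm (0 : V) = 0.
Proof. by rewrite /rnorm normr0. Qed.

Lemma rnorm_eq0 x : (rnorm x == 0) = (x == 0).
Proof.
by rewrite -(inj_eq (@complexI R)) -normE normr_eq0.
Qed.

Lemma rnormN x : rnorm (- x) = rnorm x.
Proof. by rewrite /rnorm normrN. Qed.

Lemma rdistC x y : rnorm (x - y) = rnorm (y - x).
Proof. by rewrite /rnorm distrC. Qed.

Lemma ler_rnormD x y : rnorm (x + y) <= rnorm x + rnorm y.
Proof. by rewrite -lecR rmorphD/= -!normE ler_normD. Qed.

Lemma ler_rnormB x y : rnorm (x - y) <= rnorm x + rnorm y.
Proof. by rewrite -(rnormN y) ler_rnormD. Qed.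

Lemma ler_rdist_add z x y : rnorm (x - y) <= rnorm (x - z) + rnorm (z - y).
Proof. by rewrite (le_trans _ (ler_rnormD _ _))// addrA subrK. Qed.

Lemma ler_rnorm_sum (I : Type) (r : seq I) (P : pred I) (F : I -> V) :
  rnorm (\sum_(i <- r | P i) F i) <= \sum_(i <- r | P i) rnorm (F i).
Proof.
elim/big_ind2 : _ => //; first by rewrite rnorm0.
by move=> x r1 y r2 h1 h2; rewrite (le_trans (ler_rnormD _ _))// lerD.
Qed.

Lemma ler_rdist_dist x y : `|rnorm x - rnorm y| <= rnorm (x - y).
Proof.
rewrite ler_norml; apply/andP; split.
  by rewrite lerNl opprB lerBlDl rdistC -{1}(subrK x y) addrC ler_rnormD.
by rewrite lerBlDl -{1}(subrK y x) addrC ler_rnormD.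
Qed.

End Normed.

Lemma rnormC (z : R[i]) : rnorm z^* = rnorm z.
Proof. by case: z => a b; rewrite /rnorm !normc_def/= sqrrN. Qed.

Lemma rnormR (t : R) : rnorm (t%:C) = `|t|.
Proof. by rewrite /rnorm normc_def/= expr0n addr0 sqrtr_sqr. Qed.

Lemma rnormM (z w : R[i]) : rnorm (z * w) = rnorm z * rnorm w.
Proof. by apply: (@complexI R); rewrite rmorphM/= -!normE normrM. Qed.

Lemma rnorm_sqr (z : R[i]) : (rnorm z ^+ 2)%:C = z * z^*.
Proof.
rewrite rmorphXn/= -normE normCK; congr (_ * _).
Qed.

Lemma Re_le_rnorm (z : R[i]) : `|complex.Re z| <= rnorm z.
Proof.
case: z => a b; rewrite /rnorm normc_def/= -sqrtr_sqr ler_wsqrtr//.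
by rewrite lerDl sqr_ge0.
Qed.

Section NormedModule.
Variable V : normedModType R[i].
Implicit Types (x y : V) (u : nat -> V).

Lemma rnormZ (c : R[i]) x : rnorm (c *: x) = rnorm c * rnorm x.
Proof. by apply: (@complexI R); rewrite rmorphM/= -!normE normrZ. Qed.

Lemma rnormZr (t : R) x : rnorm (t%:C *: x) = `|t| * rnorm x.
Proof. by rewrite rnormZ rnormR. Qed.

Lemma cvg_rnormP u l : u @ \oo --> l <->
  forall eps : R, 0 < eps -> exists N, forall k, (N <= k)%N ->
    rnorm (l - u k) < eps.
Proof.
split=> [/cvgrPdist_lt ul eps eps0|ul].
  have [|N _ HN] := ul eps%:C; first by rewrite ltcR.
  by exists N => k /HN/=; rewrite normE ltcR.
apply/cvgrPdist_lt => eps eps0.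
have epsE : eps = (complex.Re eps)%:C.
  by move: eps0; case: eps => a b; rewrite ltcE/= => /andP[/eqP -> _].
have [|N HN] := ul (complex.Re eps); first by rewrite -ltcR -epsE.
by exists N => // k /HN/=; rewrite epsE normE ltcR.
Qed.

Lemma rnorm_continuous : continuous (@rnorm V : V -> R^o).
Proof.
move=> x; apply/(@cvgrPdist_lt _ R^o) => eps eps0.
have := @cvgr_dist_lt _ V _ _ _ id x (@cvg_id _ (nbhs x)) eps%:C.
rewrite ltcR => /(_ _ eps0); apply: filterS => y /=.
rewrite normE ltcR; apply: le_lt_trans; exact: ler_rdist_dist.
Qed.

Lemma cvg_rnorm u l : u @ \oo --> l -> (rnorm (u k) : R^o) @[k --> \oo] --> rnorm l.
Proof. by move=> ul; apply: continuous_cvg => //; exact: rnorm_continuous. Qed.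

Lemma cvg_rnorm_le u l (b : R) : u @ \oo --> l -> (forall k, rnorm (u k) <= b) ->
  rnorm l <= b.
Proof.
move=> ul ub; have := cvg_rnorm ul => ul'.
apply: (@closed_cvg _ _ \oo _ (fun k => rnorm (u k)) [set x | x <= b]).
- exact: closed_le.
- by apply: nearW => k /=; exact: ub.
- exact: ul'.
Qed.

Lemma closure_rnormP (A : set V) x : closure A x <->
  forall eps : R, 0 < eps -> exists2 y, A y & rnorm (x - y) < eps.
Proof.
split=> [Ax eps eps0|Ax].
  have eC : 0 < eps%:C by rewrite ltcR.
  have [y [Ay xy]] := Ax _ (nbhsx_ballx x _ eC).
  by exists y => //; move: xy; rewrite -ball_normE/= normE ltcR.
move=> B /nbhs_ballP[e /= e0 eB].
have eE : e = (complex.Re e)%:C.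
  by move: e0; case: e {eB} => a b; rewrite ltcE/= => /andP[/eqP -> _].
have [|y Ay xy] := Ax (complex.Re e); first by rewrite -ltcR -eE.
by exists y; split => //; apply: eB; rewrite -ball_normE/= normE eE ltcR.
Qed.

End NormedModule.

Lemma cauchy_rnorm_cvg (V : completeNormedModType R[i]) (u : nat -> V) :
  (forall eps : R, 0 < eps -> exists N, forall k l, (N <= k)%N -> (N <= l)%N ->
    rnorm (u k - u l) < eps) -> cvgn u.
Proof.
move=> uc; apply: cauchy_cvg; apply/cauchy_ballP => e e0.
have eE : e = (complex.Re e)%:C.
  by move: e0; case: e => a b; rewrite ltcE/= => /andP[/eqP -> _].
have [|N HN] := uc (complex.Re e); first by rewrite -ltcR -eE.
pose B := [set u k | k in [set k | (N <= k)%N]].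
exists (B, B) => /=.
  by split; exists N => // k Nk /=; exists k.
move=> [x y] /= [[k Nk <-] [l Nl <-]].
by rewrite -ball_normE/= normE eE ltcR HN.
Qed.

End RealNorm.

Section InnerProduct.
Variables (R : realType) (H : hilbertType R).
Implicit Types (x y z : H) (c : R[i]) (u : nat -> H).

Lemma innerDl x y z : inner (x + y) z = inner x z + inner y z.
Proof. by rewrite -{1}[x]scale1r inner_linear mul1r. Qed.

Lemma inner0l z : inner 0 z = 0.
Proof. by apply: (addrI (inner 0 z)); rewrite -innerDl !addr0. Qed.

Lemma innerZl c x z : inner (c *: x) z = c * inner x z.
Proof. by rewrite -[c *: x]addr0 inner_linear inner0l addr0. Qed.

Lemma innerNl x z : inner (- x) z = - inner x z.
Proof. by rewrite -scaleN1r innerZl mulN1r. Qed.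

Lemma innerBl x y z : inner (x - y) z = inner x z - inner y z.
Proof. by rewrite innerDl innerNl. Qed.

Lemma inner_suml (I : Type) (r : seq I) (P : pred I) (F : I -> H) z :
  inner (\sum_(i <- r | P i) F i) z = \sum_(i <- r | P i) inner (F i) z.
Proof.
by apply: (big_morph (fun x => inner x z)) => [x y|]; rewrite ?innerDl ?inner0l.
Qed.

Lemma innerDr x y z : inner z (x + y) = inner z x + inner z y.
Proof. by rewrite inner_conj innerDl rmorphD/= -!inner_conj. Qed.

Lemma inner0r z : inner z 0 = 0.
Proof. by rewrite inner_conj inner0l rmorph0. Qed.

Lemma innerZr c x z : inner z (c *: x) = c^* * inner z x.
Proof. by rewrite inner_conj innerZl rmorphM/= -inner_conj. Qed.

Lemma innerNr x z : inner z (- x) = - inner z x.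
Proof. by rewrite inner_conj innerNl rmorphN/= -inner_conj. Qed.

Lemma innerBr x y z : inner z (x - y) = inner z x - inner z y.
Proof. by rewrite innerDr innerNr. Qed.

Lemma inner_sumr (I : Type) (r : seq I) (P : pred I) (F : I -> H) z :
  inner z (\sum_(i <- r | P i) F i) = \sum_(i <- r | P i) inner z (F i).
Proof.
by apply: (big_morph (fun x => inner z x)) => [x y|]; rewrite ?innerDr ?inner0r.
Qed.

Lemma inner_rnorm x : inner x x = (rnorm x ^+ 2)%:C.
Proof. by rewrite inner_norm normE rmorphXn. Qed.

Lemma conjR (t : R) : (t%:C)^* = t%:C :> R[i].
Proof. exact: conjc_real. Qed.

Lemma rnorm_innerC x y : rnorm (inner x y) = rnorm (inner y x).
Proof. by rewrite (inner_conj y x) rnormC. Qed.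

Lemma Re_innerC x y : complex.Re (inner x y) = complex.Re (inner y x).
Proof. by rewrite (inner_conj y x); case: (inner y x). Qed.

Lemma real_complexD (a b : R) : (a + b)%:C = a%:C + b%:C.
Proof. by rewrite rmorphD. Qed.

Lemma real_complexM (a b : R) : (a * b)%:C = a%:C * b%:C.
Proof. by rewrite rmorphM. Qed.

Lemma real_complex_sum (I : Type) (r : seq I) (P : pred I) (F : I -> R) :
  (\sum_(i <- r | P i) F i)%:C = \sum_(i <- r | P i) (F i)%:C.
Proof. by rewrite rmorph_sum. Qed.

Lemma ReB (z w : R[i]) : complex.Re (z - w) = complex.Re z - complex.Re w.
Proof. by case: z => a b; case: w. Qed.

Lemma add_conj (z : R[i]) : z + z^* = (2 * complex.Re z)%:C.
Proof.
by case: z => a b; apply/eqP; rewrite eq_complex/= addrN eqxx andbT mulrDl mul1r.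
Qed.

Lemma rnorm2D x y :
  rnorm (x + y) ^+ 2 = rnorm x ^+ 2 + rnorm y ^+ 2 + 2 * complex.Re (inner x y).
Proof.
apply: (@complexI R); rewrite -inner_rnorm innerDl !innerDr !inner_rnorm.
rewrite !real_complexD -add_conj [inner y x]inner_conj.
by set I := inner x y; set J := I^*; ring.
Qed.

(** The squared norm of |y| x - |x| y equals 2 |x| |y| (|x| |y| - Re <x,y>), and it is
    nonnegative. *)
Lemma Re_inner_le x y : complex.Re (inner x y) <= rnorm x * rnorm y.
Proof.
have [->|x0] := eqVneq x 0; first by rewrite inner0l rnorm0 mul0r.
have [->|y0] := eqVneq y 0; first by rewrite inner0r rnorm0 mulr0.
have nx : 0 < rnorm x by rewrite lt_def rnorm_eq0 x0 rnorm_ge0.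
have ny : 0 < rnorm y by rewrite lt_def rnorm_eq0 y0 rnorm_ge0.
have := sqr_ge0 (rnorm ((rnorm y)%:C *: x - (rnorm x)%:C *: y)).
rewrite rnorm2D !rnormN !rnormZr innerNr innerZl innerZr conjR.
rewrite !ger0_norm ?rnorm_ge0//.
set I := inner x y.
have -> : complex.Re (- ((rnorm y)%:C * ((rnorm x)%:C * I))) =
    - (rnorm y * (rnorm x * complex.Re I)).
  by case: I => a b /=; rewrite !mul0r !subr0.
move=> h; rewrite -(ler_pM2l (mulr_gt0 nx ny)); nra.
Qed.

(** Multiplying x by the conjugate of <x,y> makes the inner product real and equal to |<x,y>|^2,
    which reduces the claim to [Re_inner_le]. *)
Lemma CauchySchwarz x y : rnorm (inner x y) <= rnorm x * rnorm y.
Proof.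
have [->|i0] := eqVneq (inner x y) 0.
  by rewrite rnorm0 mulr_ge0 ?rnorm_ge0.
have ni : 0 < rnorm (inner x y) by rewrite lt_def rnorm_eq0 i0 rnorm_ge0.
have := Re_inner_le ((inner x y)^* *: x) y.
rewrite innerZl mulrC -rnorm_sqr/= rnormZ rnormC expr2 -mulrA ler_pM2l//.
Qed.

Lemma inner_eq0 x : (forall y, inner x y = 0) -> x = 0.
Proof.
move=> /(_ x)/eqP; rewrite inner_rnorm -[0]/((0 : R)%:C).
by rewrite (inj_eq (@complexI R)) sqrf_eq0 rnorm_eq0 => /eqP.
Qed.

Lemma inner_ext x x' : (forall y, inner x y = inner x' y) -> x = x'.
Proof.
move=> xx'; apply/eqP; rewrite -subr_eq0; apply/eqP/inner_eq0 => y.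
by rewrite innerBl xx' subrr.
Qed.

Lemma inner_extr x x' : (forall y, inner y x = inner y x') -> x = x'.
Proof.
by move=> xx'; apply: inner_ext => y; rewrite inner_conj xx' -inner_conj.
Qed.

Lemma rnorm_le_inner x (C : R) : 0 <= C ->
  (forall y, rnorm (inner x y) <= C * rnorm y) -> rnorm x <= C.
Proof.
move=> C0 /(_ x); have [->|x0] := eqVneq x 0; first by rewrite rnorm0.
rewrite inner_rnorm rnormR ger0_norm ?sqr_ge0// expr2 ler_pM2r//.
by rewrite lt_def rnorm_eq0 x0 rnorm_ge0.
Qed.

Lemma cvg_innerl u x y : u @ \oo --> x ->
  (fun k => inner (u k) y : R[i]^o) @ \oo --> (inner x y : R[i]^o).
Proof.
move=> /cvg_rnormP ux; apply/cvg_rnormP => eps eps0.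
have y0 : 0 < rnorm y + 1 by rewrite ltr_wpDl ?rnorm_ge0.
have [|N HN] := ux (eps / (rnorm y + 1)); first by rewrite divr_gt0.
exists N => k /HN h; rewrite -innerBl (le_lt_trans (CauchySchwarz _ _))//.
rewrite (@le_lt_trans _ _ (rnorm (x - u k) * (rnorm y + 1)))//.
  by rewrite ler_wpM2l ?rnorm_ge0// lerDl.
by rewrite -ltr_pdivlMr.
Qed.

End InnerProduct.

Lemma eps_le0 (R : realType) (s : R) :
  (forall eps, 0 < eps -> s <= eps) -> s <= 0.
Proof. by move=> h; apply/ler_addgt0Pr => e e0; rewrite add0r h. Qed.

Lemma invn_lt (R : realType) (eps : R) : 0 < eps ->
  exists N : nat, forall k, (N <= k)%N -> k.+1%:R^-1 < eps.
Proof.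
move=> e0; exists (Num.truncn eps^-1) => k Nk.
rewrite invf_plt ?posrE ?ltr0n//.
rewrite (lt_le_trans (truncnS_gt _))// ler_nat; exact: Nk.
Qed.

(** * Riesz representation theorem *)

Section Riesz.
Variables (R : realType) (H : hilbertType R) (phi : H -> R[i]).
Hypothesis phi_lin : forall (c : R[i]) x y, phi (c *: x + y) = c * phi x + phi y.
Variable M : R.
Hypothesis phi_bd : forall x, rnorm (phi x) <= M * rnorm x.

Let J (x : H) : R := rnorm x ^+ 2 - 2 * complex.Re (phi x).

Let phiD x y : phi (x + y) = phi x + phi y.
Proof. by rewrite -{1}[x]scale1r phi_lin mul1r. Qed.

Let phi0 : phi 0 = 0.
Proof. by apply: (addrI (phi 0)); rewrite -phiD !addr0. Qed.

Let phiZ c x : phi (c *: x) = c * phi x.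
Proof. by rewrite -[c *: x]addr0 phi_lin phi0 addr0. Qed.

Let ReM (t : R) (z : R[i]) : complex.Re (t%:C * z) = t * complex.Re z.
Proof. by case: z => a b /=; rewrite mul0r subr0. Qed.

Let ReD (z w : R[i]) : complex.Re (z + w) = complex.Re z + complex.Re w.
Proof. by case: z => a b; case: w. Qed.

Let J_lb x : - M ^+ 2 <= J x.
Proof.
have := le_trans (le_trans (ler_norm _) (Re_le_rnorm (phi x))) (phi_bd x).
by move=> h; have := sqr_ge0 (rnorm x - M); rewrite /J; nra.
Qed.

Let J_var x v (t : R) : J (x + t%:C *: v) =
  J x + t ^+ 2 * rnorm v ^+ 2
  + 2 * t * (complex.Re (inner x v) - complex.Re (phi v)).
Proof.
rewrite /J rnorm2D rnormZr innerZr conjR phiD phiZ ReD !ReM exprMn real_normK ?num_real//.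
ring.
Qed.

Let J_mid x y : rnorm (x - y) ^+ 2 = 
  2 * (J x + J y - 2 * J (2^-1%:C *: (x + y))).
Proof.
rewrite /J phiZ ReM phiD ReD rnormZr exprMn !rnorm2D innerNr rnormN real_normK ?num_real//.
have -> : complex.Re (- inner x y) = - complex.Re (inner x y).
  by case: (inner x y).
by field.
Qed.

(* The representing vector minimizes [J x = |x|^2 - 2 Re (phi x)]: minimizing
   sequences are Cauchy by the parallelogram law [J_mid]. *)
Lemma riesz : exists u : H, forall x, phi x = inner x u.
Proof.
pose mu := inf [set J x | x in setT].
have has : has_inf [set J x | x in setT].
  split; first by exists (J 0), 0.
  by exists (- M ^+ 2) => _ [x _ <-]; exact: J_lb.
have mu_le x : mu <= J x by apply: ge_inf; [case: has|exists x].
have /choice[u uP] (k : nat) : exists x, J x < mu + k.+1%:R^-1.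
  have [|_ [x _ <-] xJ] := @inf_adherent _ _ k.+1%:R^-1 _ has; last by exists x.
  by rewrite invr_gt0.
have u_close k l : rnorm (u k - u l) ^+ 2 <= 2 * (k.+1%:R^-1 + l.+1%:R^-1).
  rewrite J_mid ler_pM2l//; have := uP k; have := uP l.
  have := mu_le (2^-1%:C *: (u k + u l)).
  move: (J (u k)) (J (u l)) (J (_ *: _)) (k.+1%:R^-1) (l.+1%:R^-1) (mu).
  by move=> a b c d e f; lra.
have /cvg_ex[v uv] : cvgn u.
  apply: cauchy_rnorm_cvg => eps eps0.
  have [|N HN] := @invn_lt R (eps ^+ 2 / 4); first by rewrite divr_gt0 ?exprn_gt0.
  exists N => k l /HN hk /HN hl.
  rewrite -(@ltr_pXn2r _ 2) ?nnegrE ?rnorm_ge0 ?(ltW eps0)//.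
  rewrite (le_lt_trans (u_close _ _))//; move: hk hl.
  by move: (k.+1%:R^-1) (l.+1%:R^-1) (eps ^+ 2) => c d E; lra.
have Re_eq x : complex.Re (inner v x) = complex.Re (phi x).
  apply/eqP; rewrite -subr_eq0 -normr_le0; apply: eps_le0 => eps eps0.
  have n0 : 0 < rnorm x + 1 by rewrite ltr_wpDl ?rnorm_ge0.
  pose d := eps / (2 * (rnorm x + 1)).
  have d0 : 0 < d by rewrite divr_gt0// mulr_gt0.
  have dE : d * (rnorm x + 1) = eps / 2.
    by rewrite /d; field; rewrite gt_eqF.
  have dn0 : 0 <= d * (rnorm x + 1) by rewrite mulr_ge0 ?(ltW n0)// ltW.
  have [N1 HN1] := invn_lt (exprn_gt0 2 d0).
  have /cvg_rnormP/(_ _ d0)[N2 HN2] := uv.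
  pose k := maxn N1 N2.
  have {HN1}h1 := HN1 k (leq_maxl _ _); have {HN2}h2 := HN2 k (leq_maxr _ _).
  set s := complex.Re (inner (u k) x) - complex.Re (phi x).
  have hs : `|s| <= d * (rnorm x + 1).
    rewrite -(@ler_pXn2r _ 2) ?nnegrE ?normr_ge0//.
    rewrite real_normK ?num_real//.
    (* This multiple of x nearly minimizes the quadratic polynomial in [J_var]. The denominator uses
       |x| + 1 so as to be positive also for x = 0. Since J (u k) is within 1/(k+1) of the infimum,
       s^2 <= (|x| + 1)^2 / (k+1). *)
    have := mu_le (u k + (- s / (rnorm x + 1) ^+ 2)%:C *: x).
    rewrite J_var -/s => hmu; have hk := uP k.
    set q := (rnorm x + 1) ^+ 2 in hmu *.
    have q0 : 0 < q by rewrite exprn_gt0.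
    have xq : rnorm x ^+ 2 <= q.
      by rewrite /q ler_pXn2r ?nnegrE ?rnorm_ge0 ?(ltW n0)// lerDl.
    rewrite exprMn -/q.
    have h : - k.+1%:R^-1 <= (- s / q) ^+ 2 * q + 2 * (- s / q) * s.
      have : (- s / q) ^+ 2 * rnorm x ^+ 2 <= (- s / q) ^+ 2 * q.
        by rewrite ler_wpM2l ?sqr_ge0.
      move: hmu hk; move: (- s / q) => t.
      by move: (k.+1%:R^-1) (J (u k)) (mu) => a b c; lra.
    have e : (- s / q) ^+ 2 * q + 2 * (- s / q) * s = - (s ^+ 2 / q).
      by field; rewrite gt_eqF.
    rewrite -ler_pdivrMr//; move: h; rewrite e lerN2 => h.
    by rewrite (le_trans h)// ltW.
  have hr : `|complex.Re (inner v x) - complex.Re (inner (u k) x)| <= d * (rnorm x + 1).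
    have -> : complex.Re (inner v x) - complex.Re (inner (u k) x) =
              complex.Re (inner (v - u k) x).
      by rewrite innerBl; case: (inner v x) (inner (u k) x) => a b [].
    rewrite (le_trans (Re_le_rnorm _))// (le_trans (CauchySchwarz _ _))//.
    by rewrite ler_pM ?rnorm_ge0 ?(ltW h2)// lerDl.
  have -> : complex.Re (inner v x) - complex.Re (phi x) =
    (complex.Re (inner v x) - complex.Re (inner (u k) x)) + s by rewrite /s; ring.
  rewrite (le_trans (ler_normD _ _))//; move: hr hs; rewrite dE; lra.
exists v => x; apply/eqP; rewrite eq_complex; apply/andP; split; apply/eqP.
  by rewrite -Re_eq Re_innerC.
(* The equality of real parts at i x is the equality of imaginary parts at x. *)
have := Re_eq ('i%C *: x); rewrite phiZ innerZr.
rewrite [inner x v]inner_conj.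
case: (phi x) (inner v x) => a b [c d] /=.
by rewrite !(mul0r, mul1r, sub0r, subr0, add0r, mulN1r, oppr0, opprK) => ->; rewrite opprK.
Qed.

End Riesz.

(** * Adjoints and completeness of the algebra of bounded operators *)

Section OperatorAlgebra.
Variables (R : realType) (H : hilbertType R).
Implicit Types (f g h : 'B(H)) (x y : H).

Lemma opD f x y : f (x + y) = f x + f y.
Proof. by rewrite -{1}[x]scale1r op_linear scale1r. Qed.

Lemma opZ f c x : f (c *: x) = c *: f x.
Proof. by rewrite -[c *: x]addr0 op_linear op0 addr0. Qed.

Lemma opN f x : f (- x) = - f x.
Proof. by rewrite -scaleN1r opZ scaleN1r. Qed.

Lemma opB f x y : f (x - y) = f x - f y.
Proof. by rewrite opD opN. Qed.

Lemma op_sum f (I : Type) (r : seq I) (P : pred I) (F : I -> H) :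
  f (\sum_(i <- r | P i) F i) = \sum_(i <- r | P i) f (F i).
Proof. by apply: (big_morph f) => [x y|]; rewrite ?opD ?op0. Qed.

Lemma sum_opE (I : Type) (r : seq I) (P : pred I) (F : I -> 'B(H)) x :
  (\sum_(i <- r | P i) F i) x = \sum_(i <- r | P i) F i x.
Proof. exact: (big_morph (fun f : 'B(H) => f x)). Qed.

Lemma opNE f x : (- f) x = - f x.
Proof. by []. Qed.

Lemma opBE f g x : (f - g) x = f x - g x.
Proof. by []. Qed.

Lemma rnorm_op f : rnorm f = opnorm f.
Proof. by []. Qed.

Lemma rnorm_app f x : rnorm (f x) <= rnorm f * rnorm x.
Proof. by rewrite -lecR rmorphM/= -!normE opnorm_ub. Qed.

Lemma rnorm_op_le f (M : R) : 0 <= M ->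
  (forall x, rnorm (f x) <= M * rnorm x) -> rnorm f <= M.
Proof.
move=> M0 h; rewrite rnorm_op opnorm_le// => x.
by rewrite !normE -rmorphM/= lecR.
Qed.

Lemma rnorm_op_le_inner f (M : R) : 0 <= M ->
  (forall x y, rnorm (inner (f x) y) <= M * rnorm x * rnorm y) -> rnorm f <= M.
Proof.
move=> M0 h; apply: rnorm_op_le => // x; apply: rnorm_le_inner => //.
by rewrite mulr_ge0 ?rnorm_ge0.
Qed.

Lemma rnorm_mul f g : rnorm (f * g) <= rnorm f * rnorm g.
Proof.
apply: rnorm_op_le => [|x]; first by rewrite mulr_ge0 ?rnorm_ge0.
by rewrite op_mulE (le_trans (rnorm_app _ _))// -mulrA ler_wpM2l ?rnorm_ge0 ?rnorm_app.
Qed.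

Lemma op_scaleAl (c : R[i]) f g : (c *: f) * g = c *: (f * g).
Proof. exact: op_ext. Qed.

Lemma op_scaleAr (c : R[i]) f g : f * (c *: g) = c *: (f * g).
Proof. by apply: op_ext => x; rewrite op_mulE !op_scaleE opZ. Qed.

Lemma mk_op (F : H -> H) (M : R) :
  (forall (c : R[i]) x y, F (c *: x + y) = c *: F x + F y) ->
  (forall x, rnorm (F x) <= M * rnorm x) -> exists f : 'B(H), forall x, f x = F x.
Proof.
move=> Fl Fb; have Fop : F \in @bounded_linear R H.
  by apply/asboolP; split => //; exists M => x; rewrite !normE -rmorphM/= lecR.
by exists (Bop Fop).
Qed.

(** As [adjoint] is a [get], existence is what has to be shown: Riesz gives a representing vector
    for each y, and these vectors depend linearly and boundedly on y. *)
Lemma adjointP f x y : inner (f x) y = inner x (f^~* y).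
Proof.
suff : exists g : 'B(H), forall x y, inner (f x) y = inner x (g y).
  by move=> /(@getPex _ [set g : 'B(H) | forall x y, inner (f x) y = inner x (g y)]).
have /choice[G GP] z : exists u, forall w, inner (f w) z = inner w u.
  apply: (@riesz _ _ (fun w => inner (f w) z) _ (rnorm f * rnorm z)) => [c w w'|w].
    by rewrite opD opZ innerDl innerZl.
  rewrite (le_trans (CauchySchwarz _ _))// mulrAC ler_wpM2r ?rnorm_ge0//.
  exact: rnorm_app.
have [|z|g gG] := @mk_op G (rnorm f).
- move=> c z z'; apply: inner_extr => w.
  by rewrite -GP !innerDr !innerZr !GP.
- apply: rnorm_le_inner => [|w]; first by rewrite mulr_ge0 ?rnorm_ge0.
  rewrite rnorm_innerC -GP (le_trans (CauchySchwarz _ _))// mulrAC ler_wpM2r ?rnorm_ge0//.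
  exact: rnorm_app.
by exists g => z w; rewrite gG GP.
Qed.

Lemma adjointPl f x y : inner (f^~* x) y = inner x (f y).
Proof. by rewrite inner_conj -adjointP -inner_conj. Qed.

Lemma adjoint_unique f g : (forall x y, inner (f x) y = inner x (g y)) -> f^~* = g.
Proof.
move=> fg; apply: op_ext => x; apply: inner_ext => y.
by rewrite adjointPl inner_conj fg -inner_conj.
Qed.

Lemma adjointK f : f^~*^~* = f.
Proof. by apply: adjoint_unique => x y; rewrite adjointPl. Qed.

Lemma adjointD f g : (f + g)^~* = f^~* + g^~*.
Proof.
apply: adjoint_unique => x y.
by rewrite !op_addE innerDl innerDr !adjointP.
Qed.

Lemma adjointZ c f : (c *: f)^~* = c^* *: f^~*.
Proof.
apply: adjoint_unique => x y.
by rewrite !op_scaleE innerZl innerZr conjCK !adjointP.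
Qed.

Lemma adjoint0 : (0 : 'B(H))^~* = 0.
Proof.
by apply: adjoint_unique => x y; rewrite !op_zeroE inner0l inner0r.
Qed.

Lemma adjointN f : (- f)^~* = - f^~*.
Proof. by apply: adjoint_unique => x y; rewrite !opNE innerNl innerNr adjointP. Qed.

Lemma adjointB f g : (f - g)^~* = f^~* - g^~*.
Proof. by rewrite adjointD adjointN. Qed.

Lemma adjoint_sum (I : Type) (r : seq I) (P : pred I) (F : I -> 'B(H)) :
  (\sum_(i <- r | P i) F i)^~* = \sum_(i <- r | P i) (F i)^~*.
Proof. by apply: (big_morph (@adjoint R H)); [exact: adjointD|exact: adjoint0]. Qed.

Lemma adjointM f g : (f * g)^~* = g^~* * f^~*.
Proof. by apply: adjoint_unique => x y; rewrite !op_mulE !adjointP. Qed.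

Lemma adjoint1 : (1 : 'B(H))^~* = 1.
Proof. exact: adjoint_unique. Qed.

Lemma rnorm_adjoint f : rnorm f^~* = rnorm f.
Proof.
have le g : rnorm g^~* <= rnorm g.
  apply: rnorm_op_le_inner; first exact: rnorm_ge0.
  move=> x y; rewrite adjointPl (le_trans (CauchySchwarz _ _))//.
  by rewrite [leRHS]mulrAC [leLHS]mulrC ler_wpM2r ?rnorm_ge0// rnorm_app.
by apply/eqP; rewrite eq_le le -{1}[f]adjointK le.
Qed.

Lemma cvg_adjoint (u : nat -> 'B(H)) (l : 'B(H)) :
  u @ \oo --> l -> (fun k => (u k)^~*) @ \oo --> l^~*.
Proof.
move=> /cvg_rnormP ul; apply/cvg_rnormP => eps /ul[N HN].
by exists N => k /HN; rewrite -adjointB rnorm_adjoint.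
Qed.

Lemma cvg_app (u : nat -> 'B(H)) (l : 'B(H)) x :
  u @ \oo --> l -> (fun k => u k x) @ \oo --> l x.
Proof.
move=> /cvg_rnormP ul; apply/cvg_rnormP => eps e0.
have n0 : 0 < rnorm x + 1 by rewrite ltr_wpDl ?rnorm_ge0.
have [|N HN] := ul (eps / (rnorm x + 1)); first by rewrite divr_gt0.
exists N => k /HN; rewrite ltr_pdivlMr// => h.
rewrite -opBE (le_lt_trans (rnorm_app _ _))// (le_lt_trans _ h)//.
by rewrite ler_wpM2l ?rnorm_ge0// lerDl.
Qed.

(** Pointwise limits exist because H is complete. The Cauchy bound is uniform on the unit ball, so
    it survives in the limit and makes the limit bounded and the convergence one in norm. *)
Lemma cauchy_op_cvg (u : nat -> 'B(H)) :
  (forall eps : R, 0 < eps -> exists N, forall k l, (N <= k)%N -> (N <= l)%N ->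
    rnorm (u k - u l) < eps) -> cvgn u.
Proof.
move=> uc.
have ucx x : cvgn (fun k => u k x).
  apply: cauchy_rnorm_cvg => eps e0.
  have n0 : 0 < rnorm x + 1 by rewrite ltr_wpDl ?rnorm_ge0.
  have [|N HN] := uc (eps / (rnorm x + 1)); first by rewrite divr_gt0.
  exists N => k l Nk Nl; have := HN k l Nk Nl; rewrite ltr_pdivlMr// => h.
  rewrite -opBE (le_lt_trans (rnorm_app _ _))// (le_lt_trans _ h)//.
  by rewrite ler_wpM2l ?rnorm_ge0// lerDl.
pose L x := limn (fun k => u k x).
have near_L eps : 0 < eps -> exists N, forall k, (N <= k)%N -> forall x,
    rnorm (L x - u k x) <= eps * rnorm x.
  move=> /uc[N HN]; exists N => k Nk x.
  have uL := ucx x.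
  (* The shift by N makes the bound hold at every index, which is the form [cvg_rnorm_le] takes. *)
  have c2 : (fun l => u (N + l)%N x - u k x) @ \oo --> L x - u k x.
    apply: cvgB; last exact: cvg_cst.
    have := uL; rewrite -(cvg_shiftn N (fun l => u l x)).
    by apply: cvg_trans; apply: near_eq_cvg; apply: nearW => l; rewrite addnC.
  apply: (cvg_rnorm_le c2) => l; rewrite -opBE (le_trans (rnorm_app _ _))//.
  by rewrite ler_wpM2r ?rnorm_ge0// ltW// HN// leq_addr.
have [c x y|x|f fL] := @mk_op L (1 + rnorm (u (projT1 (cid (near_L 1 ltr01))))).
- apply/cvg_lim => //; under eq_fun do rewrite op_linear.
  by apply: cvgD; [apply: cvgZr; exact: ucx|exact: ucx].
- case: cid => N /= HN; rewrite -(subrK (u N x) (L x)) (le_trans (ler_rnormD _ _))//.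
  by rewrite mulrDl lerD ?HN ?rnorm_app.
apply/cvg_ex; exists f; apply/cvg_rnormP => eps e0.
have e20 : 0 < eps / 2 by rewrite divr_gt0.
have [N HN] := near_L _ e20; exists N => k Nk.
rewrite (@le_lt_trans _ _ (eps / 2)) ?ltr_pdivrMr ?ltr_pMr ?ltr1n//.
by apply: rnorm_op_le => [|x]; rewrite ?(ltW e20)// opBE fL HN.
Qed.

End OperatorAlgebra.

(** * Gram-Schmidt and operators on tensor products *)

Section Extension.
Variables (R : realType) (H : hilbertType R) (G : H -> H -> Prop) (C : R).
Hypothesis C_ge0 : 0 <= C.
Hypothesis G_dense : forall v eps, 0 < eps ->
  exists u w, G u w /\ rnorm (v - u) < eps.
Hypothesis G_lin : forall c u w u' w',
  G u w -> G u' w' -> G (c *: u + u') (c *: w + w').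
Hypothesis G_bd : forall u w, G u w -> rnorm w <= C * rnorm u.

(** The closure of the graph [G]. A relation is used because a vector can be written in many ways as
    a sum of elementary tensors; that [P] is single-valued follows from the bound. *)
Let P v w := forall eps : R, 0 < eps ->
  exists u w', [/\ G u w', rnorm (v - u) < eps & rnorm (w - w') < eps].

Let G_lip u w u' w' : G u w -> G u' w' -> rnorm (w - w') <= C * rnorm (u - u').
Proof.
move=> g g'; have := G_bd (G_lin (-1) g' g).
by rewrite !scaleN1r ![- _ + _]addrC.
Qed.

Let P_lip v w v' w' : P v w -> P v' w' -> rnorm (w - w') <= C * rnorm (v - v').
Proof.
move=> p p'; rewrite -subr_le0; apply: eps_le0 => eps e0.
(* Two errors of size d in the values and two in the arguments, the latter multiplied by C, add up
   to 2 (C + 1) d = eps. *)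
have d0 : 0 < eps / (2 * (C + 1)).
  by rewrite divr_gt0 ?mulr_gt0 ?ltr_wpDl.
have [u [z [g vu wz]]] := p _ d0; have [u' [z' [g' vu' wz']]] := p' _ d0.
have dE : 2 * (C + 1) * (eps / (2 * (C + 1))) = eps.
  by rewrite mulrC divfK// gt_eqF// mulr_gt0 ?ltr_wpDl.
move: (eps / _) dE d0 vu wz vu' wz' => d dE d0 vu wz vu' wz'.
have := G_lip g g'.
have h1 : rnorm (w - w') <= rnorm (w - z) + rnorm (z - z') + rnorm (z' - w').
  rewrite -[w - w'](subrKA z') (le_trans (ler_rnormD _ _))// lerD2r.
  exact: ler_rdist_add.
have h2 : rnorm (u - u') <= rnorm (u - v) + rnorm (v - v') + rnorm (v' - u').
  rewrite -[u - u'](subrKA v') (le_trans (ler_rnormD _ _))// lerD2r.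
  exact: ler_rdist_add.
move: h1 h2 wz' vu; rewrite [rnorm (z' - _)]rdistC [rnorm (u - v)]rdistC.
move: (rnorm _) (rnorm (w - z)) (rnorm (z - z')) (rnorm (w' - z')) wz vu' => X Y Z W.
move: (rnorm (u - u')) (rnorm (v - u)) (rnorm (v - v')) (rnorm (v' - u')).
move=> A B D F hY hF h1 h2 hW hB h3.
have : C * A <= C * (B + D + X) by rewrite ler_wpM2l.
have : C * B <= C * d by rewrite ler_wpM2l// ltW.
have : C * X <= C * d by rewrite ler_wpM2l// ltW.
by rewrite -dE; lra.
Qed.

Let P_ex v : exists w, P v w.
Proof.
have /choice[a aP] (k : nat) : exists uw : H * H, G uw.1 uw.2 /\ rnorm (v - uw.1) < k.+1%:R^-1.
  have [|u [w [g uw]]] := @G_dense v k.+1%:R^-1; first by rewrite invr_gt0.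
  by exists (u, w).
have C1 : 0 < C + 1 by rewrite ltr_wpDl.
have /cvg_ex[w aw] : cvgn (fun k => (a k).2).
  apply: cauchy_rnorm_cvg => eps e0.
  have d0 : 0 < eps / (2 * (C + 1)) by rewrite divr_gt0 ?mulr_gt0.
  have [N HN] := invn_lt d0; exists N => k l /HN hk /HN hl.
  rewrite (le_lt_trans (G_lip (aP k).1 (aP l).1))//.
  rewrite (@le_lt_trans _ _ (C * (k.+1%:R^-1 + l.+1%:R^-1)))//.
    rewrite ler_wpM2l// (le_trans (ler_rdist_add v _ _))// lerD//.
      by rewrite rdistC ltW// (aP k).2.
    by rewrite ltW// (aP l).2.
  rewrite (@le_lt_trans _ _ (C * (2 * (eps / (2 * (C + 1))))))//.
    by rewrite ler_wpM2l// mulr2n mulrDl mul1r lerD// ltW.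
  have qE : 2 * (C + 1) * (eps / (2 * (C + 1))) = eps.
    by rewrite mulrC divfK// gt_eqF// mulr_gt0.
  by move: (eps / _) qE d0 => q qE q0; lra.
exists w => eps e0; have /cvg_rnormP/(_ _ e0)[N1 HN1] := aw.
have [N2 HN2] := invn_lt e0; pose k := maxn N1 N2.
exists (a k).1, (a k).2; split; first exact: (aP k).1.
- by rewrite (lt_trans (aP k).2)// HN2// leq_maxr.
- by rewrite HN1// leq_maxl.
Qed.

Let P_lin c v w v' w' : P v w -> P v' w' -> P (c *: v + v') (c *: w + w').
Proof.
move=> p p' eps e0; have c1 : 0 < rnorm c + 1 by rewrite ltr_wpDl ?rnorm_ge0.
have d0 : 0 < eps / (rnorm c + 1) by rewrite divr_gt0.
have [u [z [g vu wz]]] := p _ d0; have [u' [z' [g' vu' wz']]] := p' _ d0.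
exists (c *: u + u'), (c *: z + z'); split; first exact: G_lin.
  rewrite opprD addrACA -scalerBr (le_lt_trans (ler_rnormD _ _))// rnormZ.
  rewrite -[ltRHS](@divfK _ (rnorm c + 1)) ?gt_eqF// mulrDr mulr1 ler_ltD//.
  by rewrite mulrC ler_wpM2r ?rnorm_ge0// ltW.
rewrite opprD addrACA -scalerBr (le_lt_trans (ler_rnormD _ _))// rnormZ.
rewrite -[ltRHS](@divfK _ (rnorm c + 1)) ?gt_eqF// mulrDr mulr1 ler_ltD//.
by rewrite mulrC ler_wpM2r ?rnorm_ge0// ltW.
Qed.

Let P_unique v w w' : P v w -> P v w' -> w = w'.
Proof.
move=> p p'; have := P_lip p p'; rewrite subrr rnorm0 mulr0 => h.
by apply/eqP; rewrite -subr_eq0 -rnorm_eq0 eq_le h rnorm_ge0.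
Qed.

Lemma bounded_extension : exists f : 'B(H), forall u w, G u w -> f u = w.
Proof.
have /choice[F FP] := P_ex.
have GP u w : G u w -> P u w.
  by move=> g eps e0; exists u, w; rewrite !subrr rnorm0.
have [c x y|x|f fF] := @mk_op _ _ F C.
- by apply: P_unique (FP _) _; apply: P_lin.
- have P00 : P 0 0.
    by have := P_lin (-1) (FP x) (FP x); rewrite !scaleN1r !addNr.
  by have := P_lip (FP x) P00; rewrite !subr0.
by exists f => u w /GP p; rewrite fF; apply: P_unique (FP u) p.
Qed.

End Extension.

Section Orthonormal.
Variables (R : realType) (H : hilbertType R).
Implicit Types (u : nat -> H).

(** Families are indexed by [nat] so that Gram-Schmidt can lengthen them without changing their
    type. *)
Definition orthonormal_upto (N : nat) u :=
  forall i j, (i < N)%N -> (j < N)%N -> inner (u i) (u j) = (i == j)%:R.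

Lemma orthonormal_upto_extend N u x : orthonormal_upto N u ->
  (forall c : nat -> R[i], x <> \sum_(k < N) c k *: u k) ->
  exists u' (c : nat -> R[i]), [/\ orthonormal_upto N.+1 u',
    forall k, (k < N)%N -> u' k = u k &
    x = \sum_(k < N.+1) c k *: u' k].
Proof.
move=> on xn; pose y := x - \sum_(k < N) inner x (u k) *: u k.
have y0 : y != 0.
  by rewrite subr_eq0; apply/eqP; exact: (xn (fun k => inner x (u k))).
have ny : rnorm y != 0 by rewrite rnorm_eq0.
have nyC : (rnorm y)%:C != 0 by rewrite (inj_eq (@complexI R) _ 0).
have yu i : (i < N)%N -> inner y (u i) = 0.
  move=> iN; rewrite innerBl inner_suml (bigD1 (Ordinal iN))//= innerZl on// eqxx.
  rewrite mulr1 big1 ?addr0 ?subrr// => k ki; rewrite innerZl on//.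
  by rewrite (negbTE (_ : _ != _)) ?mulr0//; apply: contra ki => /eqP ?; apply/eqP/val_inj.
exists (fun k => if (k < N)%N then u k else ((rnorm y)^-1)%:C *: y).
exists (fun k => if (k < N)%N then inner x (u k) else (rnorm y)%:C).
split.
- move=> i j; rewrite ltnS leq_eqVlt => /orP[/eqP->|iN];
    rewrite ltnS leq_eqVlt => /orP[/eqP->|jN].
  + rewrite ltnn eqxx innerZl innerZr conjR inner_rnorm -!rmorphM/=.
    by rewrite expr2 mulKf// mulVf.
  + by rewrite ltnn jN innerZl yu// mulr0 gtn_eqF.
  + by rewrite ltnn iN innerZr inner_conj yu// conjC0 mulr0 ltn_eqF.
  + by rewrite iN jN on.
- by move=> k ->.
rewrite big_ord_recr/= ltnn scalerA -rmorphM/= divff// scale1r.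
under eq_bigr => k _ do rewrite ltn_ord.
by rewrite addrC subrK.
Qed.

Lemma gram_schmidt_step N u x : orthonormal_upto N u ->
  exists M u' (c : nat -> R[i]), [/\ (N <= M)%N, orthonormal_upto M u',
    forall k, (k < N)%N -> u' k = u k & x = \sum_(k < M) c k *: u' k].
Proof.
move=> on; have [[c xc]|xn] := pselect (exists c : nat -> R[i], x = \sum_(k < N) c k *: u k).
  by exists N, u, c.
have [|u' [c [on' uu' xc]]] := orthonormal_upto_extend on (x := x).
  by move=> c xc; apply: xn; exists c.
by exists N.+1, u', c.
Qed.

Lemma infinite_orthonormal : infinite_dimensional H ->
  forall N, exists u, orthonormal_upto N u.
Proof.
move=> Hinf; elim=> [|N [u on]]; first by exists (fun=> 0).
have [x xn] := Hinf N (fun k => u k).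
have [|u' [c [on' _ _]]] := orthonormal_upto_extend on (x := x).
  by move=> c; exact: xn.
by exists u'.
Qed.

End Orthonormal.

Section DenseSpan.
Variables (R : realType) (H : hilbertType R) (S : set H).
Hypothesis S_total : closure (span_of S) = setT.

Lemma total_op_eq (f g : 'B(H)) : (forall x, S x -> f x = g x) -> f = g.
Proof.
move=> fg; apply: op_ext => x; apply/eqP; rewrite -subr_eq0 -opBE -rnorm_eq0.
rewrite eq_le rnorm_ge0 andbT; apply: eps_le0 => eps e0.
have n0 : 0 < rnorm (f - g) + 1 by rewrite ltr_wpDl ?rnorm_ge0.
have : closure (span_of S) x by rewrite S_total.
move=> /closure_rnormP/(_ (eps / (rnorm (f - g) + 1))) [|y]; first by rewrite divr_gt0.
move=> [N [c [s [Ss ->]]]]; set z := \sum_(j < N) _ => h.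
have z0 : (f - g) z = 0.
  by rewrite op_sum big1// => j _; rewrite opZ opBE fg// subrr scaler0.
rewrite -[x](subrK z) opD z0 addr0 (le_trans (rnorm_app _ _))//.
move: h; rewrite ltr_pdivlMr// => /ltW; apply: le_trans.
by rewrite mulrC ler_wpM2l ?rnorm_ge0// lerDl.
Qed.

Lemma total_inner_eq0 (x : H) : (forall y, S y -> inner x y = 0) -> x = 0.
Proof.
move=> xS; apply/eqP; rewrite -rnorm_eq0 eq_le rnorm_ge0 andbT.
apply: eps_le0 => eps e0.
have : closure (span_of S) x by rewrite S_total.
move=> /closure_rnormP/(_ _ e0)[y [N [c [s [Ss ->]]]]].
set z := \sum_(j < N) _ => h.
have z0 : inner x z = 0.
  by rewrite inner_sumr big1// => j _; rewrite innerZr xS// mulr0.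
have := ltW h; apply: le_trans.
have := CauchySchwarz x (x - z); rewrite innerBr z0 subr0 inner_rnorm rnormR.
rewrite ger0_norm ?sqr_ge0// expr2.
have [->|x0] := eqVneq (rnorm x) 0; first by rewrite rnorm_ge0.
by rewrite ler_pM2l// lt_def x0 rnorm_ge0.
Qed.

Lemma total_continuous_ge0 (phi : H -> R) : continuous (phi : H -> R^o) ->
  (forall x, span_of S x -> 0 <= phi x) -> forall x, 0 <= phi x.
Proof.
move=> phic phi0 x.
have : closure (span_of S) x by rewrite S_total.
move=> cx; rewrite leNgt; apply/negP => xlt.
have : nbhs x [set y | phi y < 0].
  by apply: (cvgr_lt (phi x)); [exact: phic|exact: xlt].
by move=> /cx[y [/phi0 y0 /=]]; rewrite ltNge y0.
Qed.

End DenseSpan.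

Lemma op_continuous (R : realType) (H : hilbertType R) (f : 'B(H)) : continuous f.
Proof.
move=> x; apply/cvgrPdist_lt => eps e0.
have eE : eps = (complex.Re eps)%:C.
  by move: e0; case: eps => a b; rewrite ltcE/= => /andP[/eqP -> _].
have n0 : 0 < rnorm f + 1 by rewrite ltr_wpDl ?rnorm_ge0.
have d0 : 0 < (complex.Re eps / (rnorm f + 1))%:C :> R[i].
  by rewrite ltcR divr_gt0// -ltcR -eE.
have /cvgrPdist_lt/(_ _ d0) := (@cvg_id _ (nbhs x) : id @ nbhs x --> x).
apply: filterS => y /=; rewrite normE ltcR ltr_pdivlMr// => h.
rewrite -opB normE eE ltcR (le_lt_trans (rnorm_app _ _))// (le_lt_trans _ h)//.
by rewrite mulrC ler_wpM2l ?rnorm_ge0// lerDl.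
Qed.

Lemma sum_rnorm2_continuous (R : realType) (H : hilbertType R) (I : Type)
    (r : seq I) (f : I -> 'B(H)) :
  continuous ((fun x => \sum_(i <- r) rnorm (f i x) ^+ 2) : H -> R^o).
Proof.
elim: r => [|i r IH].
  by under eq_fun do rewrite big_nil; move=> x; exact: cvg_cst.
under eq_fun do rewrite big_cons.
move=> x; apply: cvgD; last exact: IH.
have h : {for x, continuous ((fun y => rnorm (f i y)) : H -> R^o)}.
  apply: (@continuous_comp _ _ R^o (f i) (@rnorm R H)); first exact: op_continuous.
  exact: rnorm_continuous.
exact: (cvgM h h).
Qed.

Section Tensor.
Variables (R : realType) (E K : hilbertType R) (T : hilbert_tensor E K).
Implicit Types (A B : 'B(E)) (X Y : 'B(K)).

Lemma tens0l y : tens T 0 y = 0.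
Proof.
apply: (addrI (tens T 0 y)); rewrite -{1}[tens T 0 y]scale1r -tens_linearl.
by rewrite scaler0 !addr0.
Qed.

Lemma tensDl x x' y : tens T (x + x') y = tens T x y + tens T x' y.
Proof. by rewrite -{1}[x]scale1r tens_linearl scale1r. Qed.

Lemma tensZl c x y : tens T (c *: x) y = c *: tens T x y.
Proof. by rewrite -[c *: x]addr0 tens_linearl tens0l addr0. Qed.

Lemma tens0r x : tens T x 0 = 0.
Proof.
apply: (addrI (tens T x 0)); rewrite -{1}[tens T x 0]scale1r -tens_linearr.
by rewrite scaler0 !addr0.
Qed.

Lemma tensDr x y y' : tens T x (y + y') = tens T x y + tens T x y'.
Proof. by rewrite -{1}[y]scale1r tens_linearr scale1r. Qed.

Lemma tensZr c x y : tens T x (c *: y) = c *: tens T x y.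
Proof. by rewrite -[c *: y]addr0 tens_linearr tens0r addr0. Qed.

Lemma tens_sumr (I : Type) (r : seq I) (P : pred I) (F : I -> K) x :
  tens T x (\sum_(i <- r | P i) F i) = \sum_(i <- r | P i) tens T x (F i).
Proof.
by apply: (big_morph (fun y => tens T x y)) => [y y'|]; rewrite ?tensDr ?tens0r.
Qed.

Lemma rnorm_tens x y : rnorm (tens T x y) = rnorm x * rnorm y.
Proof.
apply/eqP; rewrite -(@eqrXn2 _ 2) ?mulr_ge0 ?rnorm_ge0//.
rewrite -(inj_eq (@complexI R)) -inner_rnorm inner_tens !inner_rnorm.
by rewrite -real_complexM -exprMn.
Qed.

Lemma rnorm2_sum_orthonormal N (x : nat -> E) (u : nat -> K) :
  orthonormal_upto N u ->
  rnorm (\sum_(k < N) tens T (x k) (u k)) ^+ 2 = \sum_(k < N) rnorm (x k) ^+ 2.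
Proof.
move=> on; apply: (@complexI R); rewrite -inner_rnorm inner_suml rmorph_sum/=.
apply: eq_bigr => k _; rewrite inner_sumr (bigD1 k)//= inner_tens on// eqxx mulr1.
rewrite big1 ?addr0 ?inner_rnorm// => l lk.
by rewrite inner_tens on// (negbTE (_ : _ != _)) ?mulr0// eq_sym.
Qed.

(** Gram-Schmidt on the right legs, with the coefficients moved to the left legs. The point is that
    x' is chosen before A: one rewriting serves all operators of a column at once, and at A = 1 it
    rewrites the vector itself. *)
Lemma orthonormal_rewriting N (x : nat -> E) (y : nat -> K) :
  exists M u (x' : nat -> E), orthonormal_upto M u /\ forall A,
    \sum_(k < N) tens T (A (x k)) (y k) = \sum_(k < M) tens T (A (x' k)) (u k).
Proof.
elim: N => [|N [M [u [x' [on IH]]]]].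
  by exists 0, (fun=> 0), (fun=> 0); split=> // A; rewrite !big_ord0.
have [M' [u' [c [MM' on' uu' yc]]]] := gram_schmidt_step (y N) on.
exists M', u', (fun k => (if (k < M)%N then x' k else 0) + c k *: x N).
split=> // A; rewrite big_ord_recr/= IH yc tens_sumr.
under [RHS]eq_bigr => k _ do rewrite opD opZ tensDl.
rewrite big_split/=; congr (_ + _); last first.
  by apply: eq_bigr => k _; rewrite tensZl tensZr.
rewrite (big_ord_widen M' (fun k => tens T (A (x' k)) (u k)))// big_mkcond/=.
by apply: eq_bigr => k _; case: ifPn => [/uu' ->//|_]; rewrite op0 tens0l.
Qed.

Lemma tens_spanP v : span_of [set v | exists x y, v = tens T x y] v ->
  exists N (x : nat -> E) (y : nat -> K), v = \sum_(k < N) tens T (x k) (y k).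
Proof.
move=> [N [c [s [sP ->]]]].
have /choice[x /choice[y xy]] j : exists x y, s j = tens T x y by exact: sP.
exists N, (fun k => if insub k is Some j then c j *: x j else 0).
exists (fun k => if insub k is Some j then y j else 0).
by apply: eq_bigr => k _; rewrite valK tensZl xy.
Qed.

(** Once the right legs are orthonormal, Pythagoras splits both sides over k, and the hypothesis
    applies to each x'_k. *)
Lemma tens_column_bound (I : Type) (r : seq I) (A : I -> 'B(E)) (M : R) :
  (forall x, \sum_(i <- r) rnorm (A i x) ^+ 2 <= M * rnorm x ^+ 2) ->
  forall N (x : nat -> E) (y : nat -> K),
    \sum_(i <- r) rnorm (\sum_(k < N) tens T (A i (x k)) (y k)) ^+ 2 <=
    M * rnorm (\sum_(k < N) tens T (x k) (y k)) ^+ 2.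
Proof.
move=> AM N x y; have [L [u [x' [on e]]]] := orthonormal_rewriting N x y.
under eq_bigr => i _ do rewrite e (rnorm2_sum_orthonormal (fun k => A i (x' k)) on).
have -> : \sum_(k < N) tens T (x k) (y k) = \sum_(k < L) tens T (x' k) (u k) := e 1.
rewrite rnorm2_sum_orthonormal// exchange_big/= mulr_sumr.
by apply: ler_sum => k _; exact: AM.
Qed.

(** The rule sum x_k (x) y_k -> sum A x_k (x) y_k is a linear relation with dense domain. Its bound
    is [tens_column_bound] for the column with the single entry A, and [bounded_extension] does the
    rest. *)
Lemma tens_opl_exists A :
  exists S : 'B(T), forall x y, S (tens T x y) = tens T (A x) y.
Proof.
pose G (v w : T) := exists N (x : nat -> E) (y : nat -> K),
  v = \sum_(k < N) tens T (x k) (y k) /\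
  w = \sum_(k < N) tens T (A (x k)) (y k).
have [||c u w u' w'|u w|S SP] := @bounded_extension _ _ G (rnorm A).
- exact: rnorm_ge0.
- move=> v eps e0.
  have : closure (span_of [set v | exists x y, v = tens T x y]) v by rewrite tens_total.
  move=> /closure_rnormP/(_ _ e0)[u /tens_spanP[N [x [y ->]]] h].
  exists (\sum_(k < N) tens T (x k) (y k)), (\sum_(k < N) tens T (A (x k)) (y k)).
  by split=> //; exists N, x, y.
- move=> [N [x [y [-> ->]]]] [N' [x' [y' [-> ->]]]].
  exists (N + N')%N, (fun k => if (k < N)%N then c *: x k else x' (k - N)%N).
  exists (fun k => if (k < N)%N then y k else y' (k - N)%N).
  rewrite !big_split_ord/= !scaler_sumr; split; congr (_ + _); apply: eq_bigr => k _.
  + by rewrite ltn_ord tensZl.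
  + by rewrite ltnNge leq_addr/= addKn.
  + by rewrite ltn_ord opZ tensZl.
  + by rewrite ltnNge leq_addr/= addKn.
- move=> [N [x [y [-> ->]]]].
  rewrite -(@ler_pXn2r _ 2) ?nnegrE ?mulr_ge0 ?rnorm_ge0// exprMn.
  have := @tens_column_bound _ [:: tt] (fun=> A) (rnorm A ^+ 2) _ N x y.
  rewrite big_seq1; apply => z; rewrite big_seq1 -exprMn.
  by rewrite ler_pXn2r ?nnegrE ?mulr_ge0 ?rnorm_ge0// rnorm_app.
exists S => x y; apply: SP; exists 1%N, (fun=> x), (fun=> y).
by rewrite !big_ord1.
Qed.

End Tensor.

Lemma tens_flip_total (R : realType) (E K : hilbertType R) (T : hilbert_tensor E K) :
  closure (span_of [set v | exists y x, v = tens T x y]) = setT.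
Proof.
rewrite -(tens_total T); congr (closure (span_of _)).
by apply/seteqP; split=> v [x [y ->]]; exists y, x.
Qed.

(** The same Hilbert space with its legs exchanged, so that statements about 1 (x) X are instances
    of those about A (x) 1. *)
Definition tens_flip (R : realType) (E K : hilbertType R) (T : hilbert_tensor E K) :
    hilbert_tensor K E :=
  @HilbertTensor R K E T (fun y x => tens T x y)
    (fun c y y' x => tens_linearr T c x y y') (fun c y x x' => tens_linearl T c x x' y)
    (fun y y' x x' => etrans (inner_tens T x x' y y') (mulrC _ _))
    (tens_flip_total T).

Section TensorOperators.
Variables (R : realType) (E K : hilbertType R) (T : hilbert_tensor E K).
Implicit Types (A B : 'B(E)) (X Y : 'B(K)).

Lemma tens_opE A X x y : tens_op T A X (tens T x y) = tens T (A x) (X y).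
Proof.
suff : exists S : 'B(T), forall x y, S (tens T x y) = tens T (A x) (X y).
  by move=> /(@getPex _ [set S : 'B(T) | forall x y, S (tens T x y) = tens T (A x) (X y)]).
(* A (x) X is the product of A (x) 1 and 1 (x) X, the second factor coming from the flipped
   product. *)
have [S SP] := tens_opl_exists T A; have [S' SP'] := tens_opl_exists (tens_flip T) X.
by exists (S * S') => z w; rewrite op_mulE (SP' w z) SP.
Qed.

Lemma tens_op_ext (S S' : 'B(T)) :
  (forall x y, S (tens T x y) = S' (tens T x y)) -> S = S'.
Proof. by move=> h; apply: (total_op_eq (tens_total T)) => _ [x [y ->]]. Qed.

Lemma tens_opDl A B X : tens_op T (A + B) X = tens_op T A X + tens_op T B X.
Proof. by apply: tens_op_ext => x y; rewrite op_addE !tens_opE op_addE tensDl. Qed.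

Lemma tens_opZl c A X : tens_op T (c *: A) X = c *: tens_op T A X.
Proof. by apply: tens_op_ext => x y; rewrite op_scaleE !tens_opE op_scaleE tensZl. Qed.

Lemma tens_op0l X : tens_op T 0 X = 0.
Proof. by rewrite -(scale0r (0 : 'B(E))) tens_opZl scale0r. Qed.

Lemma tens_opZr c A X : tens_op T A (c *: X) = c *: tens_op T A X.
Proof. by apply: tens_op_ext => x y; rewrite op_scaleE !tens_opE op_scaleE tensZr. Qed.

Lemma tens_opM A B X Y : tens_op T (A * B) (X * Y) = tens_op T A X * tens_op T B Y.
Proof. by apply: tens_op_ext => x y; rewrite !op_mulE !tens_opE !op_mulE. Qed.

Lemma tens_op_adjoint A X : (tens_op T A X)^~* = tens_op T A^~* X^~*.
Proof.
apply: tens_op_ext => x y; apply/eqP; rewrite -subr_eq0; apply/eqP.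
apply: (total_inner_eq0 (tens_total T)) => _ [x' [y' ->]].
by rewrite innerBl adjointPl !tens_opE !inner_tens !adjointPl subrr.
Qed.

(** The defect of the inequality is continuous in v and nonnegative on finite sums of elementary
    tensors, which are dense. *)
Lemma tens_opl_column_bound (I : Type) (r : seq I) (A : I -> 'B(E)) (M : R) :
  (forall x, \sum_(i <- r) rnorm (A i x) ^+ 2 <= M * rnorm x ^+ 2) ->
  forall v : T, \sum_(i <- r) rnorm (tens_op T (A i) 1 v) ^+ 2 <= M * rnorm v ^+ 2.
Proof.
move=> AM v; rewrite -subr_ge0.
pose phi (v : T) := M * rnorm v ^+ 2 - \sum_(i <- r) rnorm (tens_op T (A i) 1 v) ^+ 2.
rewrite -[_ - _]/(phi v); move: v.
apply: (total_continuous_ge0 (tens_total T)) => [v|v /tens_spanP[N [x [y ->]]]].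
  apply: (@cvgB _ R^o); last exact: (sum_rnorm2_continuous (f := fun i => tens_op T (A i) 1)).
  have h1 : {for v, continuous ((fun=> M) : T -> R^o)} by exact: cvg_cst.
  have h2 : {for v, continuous ((fun x : T => rnorm x ^+ 2) : T -> R^o)}.
    have h : {for v, continuous (@rnorm R T : T -> R^o)} by exact: rnorm_continuous.
    exact: (cvgM h h).
  exact: (cvgM h1 h2).
rewrite /phi subr_ge0; apply: le_trans (tens_column_bound T AM N x y).
apply: ler_sum => i _; rewrite op_sum.
by under eq_bigr do rewrite tens_opE op_oneE.
Qed.

End TensorOperators.

Lemma tens_op_flip (R : realType) (E K : hilbertType R) (T : hilbert_tensor E K)
  (A : 'B(E)) (X : 'B(K)) : tens_op (tens_flip T) X A = tens_op T A X.
Proof.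
by apply: (@tens_op_ext _ _ _ T) => x y; rewrite tens_opE (tens_opE (tens_flip T) X A y x).
Qed.

Lemma tens_opr_column_bound (R : realType) (E K : hilbertType R) (T : hilbert_tensor E K)
    (I : Type) (r : seq I) (X : I -> 'B(K)) (M : R) :
  (forall x, \sum_(i <- r) rnorm (X i x) ^+ 2 <= M * rnorm x ^+ 2) ->
  forall v : T, \sum_(i <- r) rnorm (tens_op T 1 (X i) v) ^+ 2 <= M * rnorm v ^+ 2.
Proof.
move=> XM v; have := @tens_opl_column_bound _ _ _ (tens_flip T) _ r X M XM v.
by under eq_bigr do rewrite tens_op_flip.
Qed.

(** * Convolution powers of the symbol *)

Section TupleSums.
Variables (V : nmodType).

Lemma big_tuple_cons (T : finType) (j : nat) (P : pred (seq T)) (F : seq T -> V) :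
  \sum_(t : j.+1.-tuple T | P t) F t =
  \sum_(x : T) \sum_(t : j.-tuple T | P (x :: t)) F (x :: t).
Proof.
rewrite (pair_big_dep xpredT (fun x (t : j.-tuple T) => P (x :: t))
  (fun x (t : j.-tuple T) => F (x :: t)))/=.
rewrite (reindex (fun p : T * j.-tuple T => [tuple of p.1 :: p.2]))//=.
exists (fun t : j.+1.-tuple T => (thead t, [tuple of behead t])) => [[x t] _|t _].
  by congr (_, _); apply/val_inj.
by apply/val_inj; rewrite [in RHS](tuple_eta t).
Qed.

Lemma big_tuple0 (T : finType) (P : pred (seq T)) (F : seq T -> V) :
  \sum_(t : 0.-tuple T | P t) F t = if P [::] then F [::] else 0.
Proof.
rewrite (eq_bigl (fun t => (t == [tuple]) && P [::])); last first.
  by move=> t; rewrite tuple0 eqxx.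
case: ifP => P0; last by rewrite big_pred0// => t; rewrite andbF.
rewrite (eq_bigl (pred1 [tuple])) ?big_pred1_eq// => t.
by rewrite andbT.
Qed.

Lemma big_tuple_cat (T : finType) (i j : nat) (F : seq T -> V) :
  \sum_(t : (i + j).-tuple T) F t =
  \sum_(u : i.-tuple T) \sum_(v : j.-tuple T) F (u ++ v).
Proof.
elim: i F => [|i IH] F.
  by rewrite (big_tuple0 xpredT (fun u => \sum_(v : j.-tuple T) F (u ++ v))).
rewrite (big_tuple_cons _ xpredT F).
rewrite (big_tuple_cons _ xpredT (fun u => \sum_(v : j.-tuple T) F (u ++ v))).
by apply: eq_bigr => x _; rewrite (IH (fun t => F (x :: t))).
Qed.

Lemma big_tuple_split (T : finType) (i k : nat) (F : seq T -> V) : (i <= k)%N ->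
  \sum_(t : k.-tuple T) F t =
  \sum_(u : i.-tuple T) \sum_(v : (k - i).-tuple T) F (u ++ v).
Proof. by move=> ik; rewrite -big_tuple_cat subnKC. Qed.

End TupleSums.

(* The coefficient of [z^j] in [(1 - z)^-p]. *)
Definition negbin (p j : nat) : nat := if p is q.+1 then 'C(j + q, q) else j == 0%N.

Arguments negbin : simpl never.

Section Weights.
Variables (R : realType) (n : nat) (a : seq 'I_n -> R).

Lemma negbin0 p : negbin p 0 = 1%N.
Proof. by case: p => [|p]//; rewrite /negbin add0n binn. Qed.

Lemma negbinS p j : negbin p.+1 j.+1 = (negbin p.+1 j + negbin p j.+1)%N.
Proof.
case: p => [|p]; first by rewrite /negbin !addn0 !bin0.
by rewrite /negbin addSn binS addSnnS.
Qed.

Lemma sum_negbin p k : (\sum_(j < k.+1) negbin p j)%N = negbin p.+1 k.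
Proof.
elim: k => [|k IH]; first by rewrite big_ord_recl big_ord0 !negbin0.
by rewrite negbinS -IH [LHS]big_ord_recr.
Qed.

(** The coefficient at w of the product of f with the series of coefficients u. The left factor has
    length at least 1 because f has no constant term. *)
Definition conv (u : seq 'I_n -> R) (w : seq 'I_n) : R :=
  \sum_(i < size w) a (take i.+1 w) * u (drop i.+1 w).

Fixpoint fpow (j : nat) (w : seq 'I_n) : R :=
  if j is j'.+1 then conv (fpow j') w else (w == [::])%:R.

Lemma fpow_eq0 j w : (size w < j)%N -> fpow j w = 0.
Proof.
elim: j w => [|j IH] w //= wj; rewrite /conv big1// => i _.
rewrite IH ?mulr0// size_drop.
apply: (@leq_trans (size w)); last by [].
by rewrite ltn_subrL (leq_ltn_trans _ (ltn_ord i)).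
Qed.

(** The coefficient at w of (1 - f)^-p, that is of the sum of [negbin p j] times f^j. The sum stops
    at [size w] since f^j begins in degree j. *)
Definition bweight (p : nat) (w : seq 'I_n) : R :=
  \sum_(j < (size w).+1) (negbin p j)%:R * fpow j w.

Lemma bweight_widen p N w : (size w < N)%N ->
  bweight p w = \sum_(j < N) (negbin p j)%:R * fpow j w.
Proof.
move=> wN; rewrite /bweight (big_ord_widen N (fun j => (negbin p j)%:R * fpow j w))//.
rewrite big_mkcond/=; apply: eq_bigr => j _; case: ltnP => //.
by move=> /fpow_eq0 ->; rewrite mulr0.
Qed.

(* [b^(p+1) = (1 - f)^-1 * b^(p)] in the convolution algebra of words. *)
Lemma bweightS p w : bweight p.+1 w - conv (bweight p.+1) w = bweight p w.
Proof.
have -> : conv (bweight p.+1) w =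
    \sum_(j < (size w).+1) (negbin p.+1 j)%:R * fpow j.+1 w.
  under [RHS]eq_bigr do rewrite /= /conv mulr_sumr.
  rewrite exchange_big/=; apply: eq_bigr => i _.
  rewrite (@bweight_widen _ (size w).+1) ?size_drop ?ltnS ?leq_subr// mulr_sumr.
  by apply: eq_bigr => j _; rewrite mulrCA.
rewrite !(@bweight_widen _ (size w).+2)// !(big_ord_recl (size w).+1)/=.
rewrite !negbin0 -addrA; congr (_ + _); rewrite -sumrB; apply: eq_bigr => j _.
rewrite /bump/= add1n negbinS natrD.
by rewrite mulrDl addrC addrA addNr add0r.
Qed.

Hypothesis a_ge0 : forall w, 0 <= a w.

Lemma conv_ge0 u w : (forall w, 0 <= u w) -> 0 <= conv u w.
Proof. by move=> u0; apply: sumr_ge0 => i _; rewrite mulr_ge0. Qed.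

Lemma fpow_ge0 j w : 0 <= fpow j w.
Proof. by elim: j w => [|j IH] w /=; [rewrite ler0n|exact: conv_ge0]. Qed.

Lemma bweight_ge0 p w : 0 <= bweight p w.
Proof. by apply: sumr_ge0 => j _; rewrite mulr_ge0 ?ler0n ?fpow_ge0. Qed.

(** The power j = [size w] contains the factorization of w into letters, whose coefficients are
    positive; all other contributions are nonnegative. *)
Lemma bweight_gt0 p w : (forall i, 0 < a [:: i]) -> 0 < bweight p.+1 w.
Proof.
move=> a_gt0; have h v : 0 < fpow (size v) v.
  elim: v => [|x v IH]; first by rewrite /= ltr01.
  rewrite /= /conv big_ord_recl/= take0 drop0 ltr_wpDr ?mulr_gt0//.
  by apply: sumr_ge0 => i _; rewrite mulr_ge0 ?fpow_ge0.
rewrite /bweight big_ord_recr/= ltr_wpDl ?mulr_gt0//; last first.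
  by rewrite ltr0n /negbin bin_gt0 leq_addl.
by apply: sumr_ge0 => j _; rewrite mulr_ge0 ?ler0n ?fpow_ge0.
Qed.

End Weights.

(** Induction on the number of factors by splitting off the first one. The bound N on the lengths
    stays fixed while the word gets shorter, hence the inequality [size w <= N] in place of an
    equality. *)
Lemma sum_factorizations (R : realType) (n : nat) (a : seq 'I_n -> R) N j (w : seq 'I_n) :
  (size w <= N)%N ->
  \sum_(g : j.-tuple (N.-bseq 'I_n) |
         (flatten [seq bseqval v | v <- g] == w)
         && all (fun v : N.-bseq 'I_n => 0 < size v)%N g)
     \prod_(v <- g) a (bseqval v) = fpow a j w.
Proof.
elim: j w => [|j IH] w wN.
  rewrite (big_tuple0 (fun g : seq (N.-bseq 'I_n) => (flatten [seq bseqval v | v <- g] == w)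
         && all (fun v : N.-bseq 'I_n => 0 < size v)%N g)
    (fun g => \prod_(v <- g) a (bseqval v)))/= andbT big_nil eq_sym.
  by case: eqP.
rewrite (big_tuple_cons _ (fun g : seq (N.-bseq 'I_n) =>
         (flatten [seq bseqval v | v <- g] == w)
         && all (fun v : N.-bseq 'I_n => 0 < size v)%N g)
    (fun g => \prod_(v <- g) a (bseqval v)))/= /conv.
pose G (v : seq 'I_n) := if (take (size v) w == v) && (0 < size v)%N
  then a v * fpow a j (drop (size v) w) else 0.
transitivity (\sum_(v : N.-bseq 'I_n) G v).
  apply: eq_bigr => v _; rewrite /G.
  have catE (s : seq 'I_n) : (v ++ s == w) = (take (size v) w == v) && (s == drop (size v) w).
    apply/eqP/andP => [<-|[/eqP tv /eqP ->]]; first by rewrite take_size_cat// drop_size_cat.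
    by rewrite -[X in X ++ _]tv cat_take_drop.
  case: ifP => [/andP[tv v0]|tv].
    rewrite -IH; last by rewrite size_drop (leq_trans (leq_subr _ _)).
    rewrite mulr_sumr; apply: eq_big => [g|g _]; first by rewrite catE tv v0.
    by rewrite big_cons.
  rewrite big_pred0// => g; rewrite catE.
  by move: tv; case: (_ == _ :> seq _); case: (0 < _)%N; rewrite //= ?andbF.
rewrite [RHS](eq_bigr (fun i : 'I_(size w) => G (take i.+1 w))); last first.
  by move=> i _; rewrite /G size_takel// eqxx.
have tN (i : 'I_(size w)) : (size (take i.+1 w) <= N)%N.
  by rewrite (leq_trans _ wN)// size_take_min geq_minr.
(* A first factor contributes only if it is a nonempty prefix of w. The injection h lists these
   prefixes, which turns the sum over all words of length at most N into the sum over the cuts in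
   [conv]. *)
pose h (i : 'I_(size w)) : N.-bseq 'I_n := Bseq (tN i).
have hinj : injective h.
  move=> i i' /(congr1 (fun v : N.-bseq 'I_n => size v))/=.
  by rewrite !size_takel// => -[ii']; apply/val_inj.
rewrite (bigID (mem (codom h)))/= addrC big1 ?add0r; last first.
  move=> v; rewrite /G; case: ifP => // /andP[/eqP tv v0].
  have vw : ((size v).-1 < size w)%N.
    by rewrite prednK// -tv size_take_min geq_minr.
  suff <- : h (Ordinal vw) = v by rewrite codom_f.
  by apply/val_inj; rewrite /= prednK.
transitivity (\sum_(v <- codom h) G v); last by rewrite big_image.
by rewrite big_uniq//; exact/injectiveP.
Qed.

Lemma bcoefE (R : realType) (n m : nat) (a : seq 'I_n -> R) (w : seq 'I_n) :
  (1 <= m)%N -> bcoef m a w = bweight a m w.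
Proof.
case: m => // m _; rewrite /bcoef /bweight; case: w => [|x w].
  by rewrite big_ord_recl big_ord0/= negbin0 mul1r addr0.
set N := size (x :: w); rewrite big_ord_recl [fpow _ _ _]/= mulr0 add0r.
rewrite big_add1 big_mkord; apply: eq_bigr => j _.
by rewrite -mulr_suml sum_factorizations// mulrC lift0 /negbin addnS !subn1.
Qed.

Lemma bcoef_gt0 (R : realType) (n m : nat) (a : seq 'I_n -> R) (w : seq 'I_n) :
  (1 <= m)%N -> positive_regular a -> 0 < bcoef m a w.
Proof.
move=> m1 [a0 _ a1 _]; rewrite bcoefE//; case: m m1 => // m _.
exact: bweight_gt0.
Qed.

Section WordOperators.
Variables (R : realType) (n : nat) (K : hilbertType R).
Implicit Types (X : 'I_n -> 'B(K)) (u v w : seq 'I_n).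

Lemma word_op_nil X : word_op X [::] = 1.
Proof. exact: big_nil. Qed.

Lemma word_op_cons X i w : word_op X (i :: w) = X i * word_op X w.
Proof. exact: big_cons. Qed.

Lemma word_op_cat X u v : word_op X (u ++ v) = word_op X u * word_op X v.
Proof. exact: big_cat. Qed.

Lemma word_op_scale (t : R) X w :
  word_op (scale_tuple t X) w = (t ^+ size w)%:C *: word_op X w.
Proof.
elim: w => [|i w IH]; first by rewrite !word_op_nil expr0 scale1r.
rewrite !word_op_cons IH op_scaleAr op_scaleAl scalerA exprS.
by rewrite real_complexM mulrC.
Qed.

Variables (a : seq 'I_n -> R) (X : 'I_n -> 'B(K)).
Hypothesis a_ge0 : forall w, 0 <= a w.
Hypothesis X_row : forall N x,
  \sum_(k < N) \sum_(w : k.+1.-tuple 'I_n) a w * rnorm ((word_op X w)^~* x) ^+ 2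
    <= rnorm x ^+ 2.

(* Peeling off the first factor of each factorization reduces [f^(j+1)] to [f^j]
   at the vectors [X_u^* x], so that [Phi(I) <= I] suffices. *)
Lemma fpow_row_bound j k x :
  \sum_(w : k.-tuple 'I_n) fpow a j w * rnorm ((word_op X w)^~* x) ^+ 2
    <= rnorm x ^+ 2.
Proof.
elim: j k x => [|j IH] k x /=.
  case: k => [|k].
    rewrite (big_tuple0 xpredT (fun w => (w == [::])%:R * rnorm ((word_op X w)^~* x) ^+ 2)).
    by rewrite eqxx mul1r word_op_nil adjoint1.
  rewrite big1 ?sqr_ge0// => w _.
  by rewrite -size_eq0 size_tuple mul0r.
apply: le_trans (X_row k x).
under eq_bigr => w _ do rewrite /conv mulr_suml size_tuple.
rewrite exchange_big/=; apply: ler_sum => i _.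
pose F w := a (take i.+1 w) * fpow a j (drop i.+1 w) * rnorm ((word_op X w)^~* x) ^+ 2.
rewrite -[leLHS]/(\sum_(w : k.-tuple 'I_n) F w).
rewrite (big_tuple_split _ (ltn_ord i)); apply: ler_sum => u _.
under eq_bigr => v _.
  rewrite /F take_size_cat ?size_tuple// drop_size_cat ?size_tuple//.
  rewrite word_op_cat adjointM op_mulE -mulrA; over.
by rewrite -mulr_sumr ler_wpM2l.
Qed.

(** Only the powers f^j with j <= k reach words of length k. Each contributes at most [negbin p j]
    by [fpow_row_bound], and these numbers add up to [negbin p.+1 k]. *)
Lemma bweight_row_bound p k x :
  \sum_(w : k.-tuple 'I_n) bweight a p w * rnorm ((word_op X w)^~* x) ^+ 2
    <= (negbin p.+1 k)%:R * rnorm x ^+ 2.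
Proof.
under eq_bigr => w _ do rewrite /bweight size_tuple mulr_suml.
rewrite exchange_big/= -sum_negbin natr_sum mulr_suml; apply: ler_sum => j _.
under eq_bigr do rewrite -mulrA.
by rewrite -mulr_sumr ler_wpM2l ?ler0n// fpow_row_bound.
Qed.

End WordOperators.

(** * Estimates on the domain *)

(** Weighted Cauchy-Schwarz, obtained termwise from the inequality of the means; the ratio Q / P
    balances the two sums. *)
Lemma weighted_sum_le (R : realType) (I : Type) (r : seq I) (b p q : I -> R) (P Q : R) :
  (forall i, 0 < b i) -> 0 < P -> 0 < Q ->
  \sum_(i <- r) p i ^+ 2 / b i <= P ^+ 2 -> \sum_(i <- r) b i * q i ^+ 2 <= Q ^+ 2 ->
  \sum_(i <- r) p i * q i <= P * Q.
Proof.
move=> b0 P0 Q0 hp hq.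
have amgm i : 2 * (p i * q i) <= Q / P * (p i ^+ 2 / b i) + P / Q * (b i * q i ^+ 2).
  rewrite -subr_ge0.
  have -> : Q / P * (p i ^+ 2 / b i) + P / Q * (b i * q i ^+ 2) - 2 * (p i * q i) =
    (Q * p i - P * b i * q i) ^+ 2 / (P * Q * b i).
    by field; rewrite !gt_eqF.
  by rewrite divr_ge0 ?sqr_ge0// !mulr_ge0// ltW.
rewrite -(ler_pM2l (@ltr0Sn R 1)) mulr_sumr (le_trans (ler_sum _ (fun i _ => amgm i)))//.
rewrite big_split/= -!mulr_sumr.
have -> : 2 * (P * Q) = Q / P * P ^+ 2 + P / Q * Q ^+ 2 by field; rewrite !gt_eqF.
by rewrite lerD// ler_wpM2l// divr_ge0// ltW.
Qed.

Lemma sum_negbin_geometric (R : realType) (p N : nat) (q : R) : 0 <= q < 1 ->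
  \sum_(k < N) (negbin p k)%:R * q ^+ k <= ((1 - q) ^+ p)^-1.
Proof.
move=> /andP[q0 q1]; have q1' : 0 < 1 - q by rewrite subr_gt0.
elim: p => [|p IH].
  rewrite expr0 invr1; case: N => [|N]; first by rewrite big_ord0.
  rewrite big_ord_recl big1 ?addr0 ?mul1r ?expr0// => i _.
  by rewrite /negbin/= mul0r.
case: N IH => [|N] IH; first by rewrite big_ord0 invr_ge0 exprn_ge0// ltW.
have e : (1 - q) * \sum_(k < N.+1) (negbin p.+1 k)%:R * q ^+ k =
    \sum_(k < N.+1) (negbin p k)%:R * q ^+ k - (negbin p.+1 N)%:R * q ^+ N.+1.
  elim: {IH} N => [|N IH]; first by rewrite !big_ord_recl !big_ord0 !negbin0; ring.
  rewrite big_ord_recr mulrDr IH [in RHS]big_ord_recr/= negbinS natrD [q ^+ N.+2]exprS.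
  by move: (\sum_(k < _) _) (q ^+ N.+1) => S Q; ring.
rewrite exprS invfM -(ler_pM2l q1') e mulrA mulfV ?gt_eqF// mul1r.
by rewrite (le_trans _ IH)// lerBlDr lerDl mulr_ge0 ?ler0n ?exprn_ge0.
Qed.

Lemma op_series_cvg (R : realType) (H : hilbertType R) (u : nat -> 'B(H))
    (c : nat -> R) (S : R) :
  (forall k, rnorm (u k) <= c k) -> (forall N, \sum_(k < N) c k <= S) ->
  cvgn (series u) /\ rnorm (limn (series u)) <= S.
Proof.
move=> uc cS.
have c0 k : 0 <= c k by rewrite (le_trans (rnorm_ge0 (u k))).
have ic : cvgn (series c).
  apply: nondecreasing_is_cvgn; first by apply: nondecreasing_series => k _ _; exact: c0.
  by exists S => _ [N _ <-]; rewrite /series/= big_mkord.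
have uN : cvgn (series u).
  apply: cauchy_op_cvg => eps e0.
  have e2 : 0 < eps / 2 by rewrite divr_gt0.
  have /cvgrPdist_lt/(_ _ e2)[N _ HN] := ic.
  have close k l : (N <= k)%N -> (k <= l)%N -> rnorm (series u l - series u k) < eps.
    move=> Nk kl; rewrite sub_series_geq// (le_lt_trans (ler_rnorm_sum _ _ _))//.
    rewrite (@le_lt_trans _ _ (\sum_(k <= i < l) c i)) ?ler_sum//.
    rewrite -(sub_series_geq c)//.
    have hk := HN k Nk; have hl := HN l (leq_trans Nk kl).
    move: hk hl => /=; rewrite !ltr_norml => /andP[h1 h2] /andP[h3 h4].
    by move: (limn _) (series c k) (series c l) h1 h2 h3 h4 => L A B; lra.
  exists N => k l Nk Nl; case: (leqP k l) => [kl|/ltnW lk]; last exact: close.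
  by rewrite rdistC; exact: close.
split=> //; apply: (cvg_rnorm_le uN) => N.
rewrite /series/= (le_trans (ler_rnorm_sum _ _ _))//.
by rewrite big_mkord (le_trans _ (cS N))// ler_sum.
Qed.

Section HomogeneousEstimate.
Variables (R : realType) (n m : nat) (a : seq 'I_n -> R).
Hypotheses (m1 : (1 <= m)%N) (ha : positive_regular a).
Variables (E K : hilbertType R) (T : hilbert_tensor E K).

Let a_ge0 : forall w, 0 <= a w. Proof. by case: ha. Qed.

(** Writing A_w (x) X_w as the product of 1 (x) X_w and A_w (x) 1 and moving the first factor to the
    other side leaves pairings of a column in A with a column in the adjoints of X. The weights 1/b
    and b are then distributed by [weighted_sum_le]. *)
Lemma rnorm_sum_tens_op_le (k : nat) (b : seq 'I_n -> R) (A : seq 'I_n -> 'B(E))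
    (X : seq 'I_n -> 'B(K)) (M D : R) :
  (forall w, 0 < b w) -> 0 < M -> 0 < D ->
  (forall x, \sum_(w : k.-tuple 'I_n) rnorm (A w x) ^+ 2 / b w <= M ^+ 2 * rnorm x ^+ 2) ->
  (forall y, \sum_(w : k.-tuple 'I_n) b w * rnorm ((X w)^~* y) ^+ 2
    <= D ^+ 2 * rnorm y ^+ 2) ->
  rnorm (\sum_(w : k.-tuple 'I_n) tens_op T (A w) (X w)) <= M * D.
Proof.
move=> b0 M0 D0 hA hX; apply: rnorm_op_le_inner; first by rewrite mulr_ge0 ?ltW.
move=> x y; rewrite sum_opE inner_suml (le_trans (ler_rnorm_sum _ _ _))//.
have [->|x0] := eqVneq x 0.
  by rewrite rnorm0 mulr0 mul0r big1// => w _; rewrite op0 inner0l rnorm0.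
have [->|y0] := eqVneq y 0.
  by rewrite rnorm0 mulr0 big1// => w _; rewrite inner0r rnorm0.
have x0' : 0 < rnorm x by rewrite lt_def rnorm_eq0 x0 rnorm_ge0.
have y0' : 0 < rnorm y by rewrite lt_def rnorm_eq0 y0 rnorm_ge0.
have -> : M * D * rnorm x * rnorm y = (M * rnorm x) * (D * rnorm y) by ring.
pose p (w : k.-tuple 'I_n) := rnorm (tens_op T (A w) 1 x).
pose q (w : k.-tuple 'I_n) := rnorm (tens_op T 1 (X w)^~* y).
have pq (w : k.-tuple 'I_n) : rnorm (inner (tens_op T (A w) (X w) x) y) <= p w * q w.
  have -> : tens_op T (A w) (X w) = tens_op T 1 (X w) * tens_op T (A w) 1.
    by rewrite -tens_opM mul1r mulr1.
  by rewrite op_mulE adjointP tens_op_adjoint adjoint1 CauchySchwarz.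
rewrite (le_trans (ler_sum _ (fun w _ => pq w)))//.
apply: (@weighted_sum_le _ _ _ (fun w : k.-tuple 'I_n => b w)); rewrite ?mulr_gt0//.
  (* The weight is absorbed into the operators by its square root, so that the unweighted column
     bound applies; [X'] below does the same for b. *)
  pose A' (w : k.-tuple 'I_n) := (Num.sqrt (b w)^-1)%:C *: A w.
  have A'E (w : k.-tuple 'I_n) z : rnorm (A' w z) ^+ 2 = rnorm (A w z) ^+ 2 / b w.
    rewrite /A' op_scaleE rnormZr ger0_norm ?sqrtr_ge0// exprMn sqr_sqrtr 1?mulrC//.
    by rewrite invr_ge0 ltW.
  rewrite exprMn; have := @tens_opl_column_bound _ _ _ T _ (index_enum _) A' (M ^+ 2) _ x.
  rewrite (eq_bigr (fun w => p w ^+ 2 / b w)); first apply.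
    by move=> z; under eq_bigr do rewrite A'E; exact: hA.
  move=> w _; rewrite /p /A' tens_opZl op_scaleE rnormZr ger0_norm ?sqrtr_ge0// exprMn.
  by rewrite sqr_sqrtr 1?mulrC// invr_ge0 ltW.
pose X' (w : k.-tuple 'I_n) := (Num.sqrt (b w))%:C *: (X w)^~*.
rewrite exprMn; have := @tens_opr_column_bound _ _ _ T _ (index_enum _) X' (D ^+ 2) _ y.
rewrite (eq_bigr (fun w : k.-tuple 'I_n => b w * q w ^+ 2)); first apply.
  move=> z; rewrite (le_trans _ (hX z))// ler_sum// => w _.
  by rewrite /X' op_scaleE rnormZr ger0_norm ?sqrtr_ge0// exprMn sqr_sqrtr// ltW.
move=> w _; rewrite /q /X' tens_opZr op_scaleE rnormZr ger0_norm ?sqrtr_ge0// exprMn.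
by rewrite sqr_sqrtr// ltW.
Qed.

Lemma Phi_wot (X : 'I_n -> 'B(K)) Y : Phi_defined a X ->
  wot_cvg (Phi_partial a X Y) (Phi a X Y).
Proof. by move=> /(_ Y)/(@getPex _ [set Z | wot_cvg (Phi_partial a X Y) Z]). Qed.

Lemma Phi_partial1_inner (X : 'I_n -> 'B(K)) N x :
  inner (Phi_partial a X 1 N x) x =
  (\sum_(k < N) \sum_(w : k.+1.-tuple 'I_n) a w * rnorm ((word_op X w)^~* x) ^+ 2)%:C.
Proof.
rewrite /Phi_partial /series/= big_mkord sum_opE inner_suml real_complex_sum.
apply: eq_bigr => k _; rewrite sum_opE inner_suml real_complex_sum.
apply: eq_bigr => w _; rewrite op_scaleE innerZl mulr1 op_mulE.
by rewrite adjointP inner_rnorm real_complexM.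
Qed.

(** The partial sums increase because a is nonnegative, so they stay below their weak limit <Phi(I)
    x, x>; the case k = 1 of positivity bounds that limit by |x|^2. *)
Lemma ncdom_row (X : 'I_n -> 'B(K)) : ncdom m a X -> forall N x,
  \sum_(k < N) \sum_(w : k.+1.-tuple 'I_n) a w * rnorm ((word_op X w)^~* x) ^+ 2
    <= rnorm x ^+ 2.
Proof.
move=> [Xd /(_ 1%N)]; rewrite m1/= => /(_ isT) psd1 N x.
have := psd1 x; rewrite opBE op_oneE innerBl inner_rnorm.
rewrite lecE ReB subr_ge0 => /andP[_].
set L := inner _ _ => hL; apply: le_trans hL; apply/ler_addgt0Pr => eps e0.
have /(@cvg_rnormP _ R[i]^o)/(_ _ e0)[N' HN'] := @Phi_wot X 1 Xd x x.
have := HN' (maxn N N') (leq_maxr _ _); rewrite Phi_partial1_inner -/L => h.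
pose S N := \sum_(k < N) \sum_(w : k.+1.-tuple 'I_n) a w * rnorm ((word_op X w)^~* x) ^+ 2.
have SS : S N <= S (maxn N N').
  rewrite /S (big_ord_widen (maxn N N') (fun k => \sum_(w : k.+1.-tuple 'I_n)
    a w * rnorm ((word_op X w)^~* x) ^+ 2)) ?leq_maxl//.
  rewrite big_mkcond/=; apply: ler_sum => k _; case: ifP => // _.
  by apply: sumr_ge0 => w _; rewrite mulr_ge0 ?sqr_ge0.
apply: le_trans SS _; have := le_lt_trans (Re_le_rnorm _) h.
rewrite -/(S _) ReB /= ltr_norml => /andP[h' _]; move: h'.
by move: (complex.Re L) (S _) => A B h'; lra.
Qed.

Lemma rnorm_holo_term_le (A : seq 'I_n -> 'B(E)) (X : 'I_n -> 'B(K)) (k : nat) (M : R) :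
  ncdom m a X -> 0 < M ->
  (forall x, \sum_(w : k.-tuple 'I_n) rnorm (A w x) ^+ 2 / bcoef m a w
    <= M ^+ 2 * rnorm x ^+ 2) ->
  rnorm (\sum_(w : k.-tuple 'I_n) tens_op T (A w) (word_op X w)) <= M * (negbin m.+1 k)%:R.
Proof.
move=> Xdom M0 hA.
have nb0 : 0 < (negbin m.+1 k)%:R :> R by rewrite ltr0n bin_gt0 leq_addl.
apply: (rnorm_sum_tens_op_le (b := bcoef m a)) => //.
  by move=> w; exact: bcoef_gt0.
move=> y; under eq_bigr do rewrite bcoefE//.
apply: le_trans (bweight_row_bound a_ge0 (ncdom_row Xdom) m k y) _.
(* The factor [negbin m.+1 k] is at least 1, hence at most its own square. This replaces its square
   root in the norm estimate by the number itself. *)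
rewrite ler_wpM2r ?sqr_ge0// -natrX ler_nat.
by rewrite expnS expn1 leq_pmulr// bin_gt0 leq_addl.
Qed.

End HomogeneousEstimate.

Section FreeSeries.
Variables (R : realType) (n m : nat) (a : seq 'I_n -> R).
Hypotheses (m1 : (1 <= m)%N) (ha : positive_regular a).
Variable (E : hilbertType R).
Implicit Types (A B : seq 'I_n -> 'B(E)) (r t M : R).

(* [r^k |sum_(|w| = k) A_w^* A_w / b_w|^(1/2) <= M] for all [k]: the Cauchy
   estimates for the coefficients of a function bounded by [M] at [r W]. *)
Definition cauchy_estimate A r M := forall k x,
  \sum_(w : k.-tuple 'I_n) rnorm (A w x) ^+ 2 / bcoef m a w * (r ^+ k) ^+ 2
    <= M ^+ 2 * rnorm x ^+ 2.

Lemma cauchy_estimate_le A r M M' : 0 <= M -> M <= M' ->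
  cauchy_estimate A r M -> cauchy_estimate A r M'.
Proof.
move=> M0 MM' h k x; apply: le_trans (h k x) _.
by rewrite ler_wpM2r ?sqr_ge0// ler_pXn2r ?nnegrE// (le_trans M0).
Qed.

Section OneSpace.
Variables (K : hilbertType R) (T : forall K : hilbertType R, hilbert_tensor E K).

Lemma holo_term_scale A (X : 'I_n -> 'B(K)) t k :
  holo_term T A (scale_tuple t X) k = (t ^+ k)%:C *: holo_term T A X k.
Proof.
rewrite /holo_term scaler_sumr; apply: eq_bigr => w _.
by rewrite word_op_scale size_tuple tens_opZr.
Qed.

Lemma rnorm_holo_term_scale_le A (X : 'I_n -> 'B(K)) r t M k :
  0 < r -> 0 <= t -> 0 < M -> cauchy_estimate A r M -> scaled_ncdom m a t X ->
  rnorm (holo_term T A X k) <= M * ((negbin m.+1 k)%:R * (t / r) ^+ k).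
Proof.
move=> r0 t0 M0 hA [Y Ydom <-]; rewrite holo_term_scale rnormZr.
have rk0 : 0 < r ^+ k by rewrite exprn_gt0.
rewrite ger0_norm ?exprn_ge0// expr_div_n.
have -> : M * ((negbin m.+1 k)%:R * (t ^+ k / r ^+ k)) =
  t ^+ k * (M / r ^+ k * (negbin m.+1 k)%:R) by field; rewrite gt_eqF.
rewrite ler_wpM2l ?exprn_ge0//.
apply: (rnorm_holo_term_le m1 ha) => // [|x]; first by rewrite divr_gt0.
have := hA k x; rewrite -mulr_suml expr_div_n -ler_pdivlMr ?exprn_gt0//.
by rewrite [M ^+ 2 / _ * _]mulrAC.
Qed.

Lemma holo_series_cvg A (X : 'I_n -> 'B(K)) r t M :
  0 < r -> 0 <= t < r -> 0 < M -> cauchy_estimate A r M -> scaled_ncdom m a t X ->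
  cvgn (series (holo_term T A X)) /\
  rnorm (limn (series (holo_term T A X))) <= M / (1 - t / r) ^+ m.+1.
Proof.
move=> r0 /andP[t0 tr] M0 hA Xdom.
have q01 : 0 <= t / r < 1.
  by rewrite divr_ge0 ?(ltW r0)//= ltr_pdivrMr// mul1r.
apply: (op_series_cvg (c := fun k => M * ((negbin m.+1 k)%:R * (t / r) ^+ k))).
  by move=> k; exact: rnorm_holo_term_scale_le Xdom.
by move=> N; rewrite -mulr_sumr ler_wpM2l ?(ltW M0)// sum_negbin_geometric.
Qed.

Lemma antiholo_termE B (X : 'I_n -> 'B(K)) k :
  antiholo_term T B X k = (holo_term T (fun w => (B w)^~*) X k)^~*.
Proof.
rewrite /holo_term adjoint_sum; apply: eq_bigr => w _.
by rewrite tens_op_adjoint adjointK.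
Qed.

Lemma antiholo_series_cvg B (X : 'I_n -> 'B(K)) r t M :
  0 < r -> 0 <= t < r -> 0 < M -> cauchy_estimate (fun w => (B w)^~*) r M ->
  scaled_ncdom m a t X ->
  cvgn (series (fun k => antiholo_term T B X k.+1)) /\
  rnorm (limn (series (fun k => antiholo_term T B X k.+1))) <= M / (1 - t / r) ^+ m.+1.
Proof.
move=> r0 /andP[t0 tr] M0 hA Xdom.
have q01 : 0 <= t / r < 1.
  by rewrite divr_ge0 ?(ltW r0)//= ltr_pdivrMr// mul1r.
apply: (op_series_cvg (c := fun k => M * ((negbin m.+1 k.+1)%:R * (t / r) ^+ k.+1))).
  move=> k; rewrite antiholo_termE rnorm_adjoint.
  exact: rnorm_holo_term_scale_le Xdom.
move=> N; rewrite -mulr_sumr ler_wpM2l ?(ltW M0)//.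
(* The sum from degree 1 is completed by its nonnegative term of degree 0. *)
apply: le_trans (@sum_negbin_geometric _ m.+1 N.+1 _ q01).
rewrite big_ord_recl/= lerDr mulr_ge0 ?ler0n// exprn_ge0//; by case/andP: q01.
Qed.

Definition coefB (AB AB' : (seq 'I_n -> 'B(E)) * (seq 'I_n -> 'B(E))) :=
  ((fun w => AB.1 w - AB'.1 w), (fun w => AB.2 w - AB'.2 w)).

Lemma ph_sum_cvg AB (X : 'I_n -> 'B(K)) r t M :
  0 < r -> 0 <= t < r -> 0 < M ->
  cauchy_estimate AB.1 r M -> cauchy_estimate (fun w => (AB.2 w)^~*) r M ->
  scaled_ncdom m a t X ->
  ph_cvg T AB X /\ rnorm (ph_sum T AB X) <= 2 * (M / (1 - t / r) ^+ m.+1).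
Proof.
move=> r0 tr M0 hA hB Xdom.
have [cA bA] := holo_series_cvg r0 tr M0 hA Xdom.
have [cB bB] := antiholo_series_cvg r0 tr M0 hB Xdom.
by split=> //; rewrite (le_trans (ler_rnormD _ _))// mulr2n mulrDl mul1r lerD.
Qed.

Lemma holo_term_lin A A' (c : R[i]) (X : 'I_n -> 'B(K)) k :
  holo_term T (fun w => c *: A w + A' w) X k =
  c *: holo_term T A X k + holo_term T A' X k.
Proof.
rewrite /holo_term scaler_sumr -big_split/=; apply: eq_bigr => w _.
by rewrite tens_opDl tens_opZl.
Qed.

Lemma antiholo_term_lin A A' (c : R[i]) (X : 'I_n -> 'B(K)) k :
  antiholo_term T (fun w => c *: A w + A' w) X k =
  c *: antiholo_term T A X k + antiholo_term T A' X k.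
Proof.
rewrite /antiholo_term scaler_sumr -big_split/=; apply: eq_bigr => w _.
by rewrite tens_opDl tens_opZl.
Qed.

Definition coef_lin (c : R[i]) (AB AB' : (seq 'I_n -> 'B(E)) * (seq 'I_n -> 'B(E))) :=
  ((fun w => c *: AB.1 w + AB'.1 w), (fun w => c *: AB.2 w + AB'.2 w)).

Lemma series_lin (u v : nat -> 'B(T K)) (c : R[i]) :
  cvgn (series u) -> cvgn (series v) ->
  series (fun k => c *: u k + v k) @ \oo --> c *: limn (series u) + limn (series v).
Proof.
move=> cu cv.
have -> : series (fun k => c *: u k + v k) = (fun N => c *: series u N + series v N).
  by apply/funext => N; rewrite /series/= scaler_sumr -big_split.
by apply: cvgD; [apply: cvgZr|].
Qed.

Lemma ph_cvg_lin c AB AB' (X : 'I_n -> 'B(K)) :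
  ph_cvg T AB X -> ph_cvg T AB' X ->
  ph_cvg T (coef_lin c AB AB') X /\
  ph_sum T (coef_lin c AB AB') X = c *: ph_sum T AB X + ph_sum T AB' X.
Proof.
move=> [cB cA] [cB' cA'].
have hA : series (holo_term T (coef_lin c AB AB').1 X) @ \oo -->
    c *: limn (series (holo_term T AB.1 X)) + limn (series (holo_term T AB'.1 X)).
  have -> : holo_term T (coef_lin c AB AB').1 X =
      fun k => c *: holo_term T AB.1 X k + holo_term T AB'.1 X k.
    by apply/funext => k; exact: holo_term_lin.
  exact: series_lin.
have hB : series (fun k => antiholo_term T (coef_lin c AB AB').2 X k.+1) @ \oo -->
    c *: limn (series (fun k => antiholo_term T AB.2 X k.+1)) +
    limn (series (fun k => antiholo_term T AB'.2 X k.+1)).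
  have -> : (fun k => antiholo_term T (coef_lin c AB AB').2 X k.+1) =
      fun k => c *: antiholo_term T AB.2 X k.+1 + antiholo_term T AB'.2 X k.+1.
    by apply/funext => k; exact: antiholo_term_lin.
  exact: series_lin.
split.
  by split; apply/cvg_ex; eexists; [exact: hB|exact: hA].
rewrite /ph_sum (cvg_lim _ hA)// (cvg_lim _ hB)//.
by rewrite scalerDr addrACA.
Qed.

Lemma ph_cvgB AB AB' (X : 'I_n -> 'B(K)) :
  ph_cvg T AB X -> ph_cvg T AB' X ->
  ph_cvg T (coefB AB AB') X /\
  ph_sum T (coefB AB AB') X = ph_sum T AB X - ph_sum T AB' X.
Proof.
move=> h h'; have := ph_cvg_lin (-1) h' h.
have -> : coef_lin (-1) AB' AB = coefB AB AB'.
  by rewrite /coef_lin /coefB; congr (_, _); apply/funext => w; rewrite scaleN1r addrC.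
by rewrite scaleN1r [- _ + _]addrC.
Qed.

End OneSpace.
End FreeSeries.

Lemma cvgn_eventually_const (R : realType) (V : normedModType R[i]) (u : nat -> V) l c N :
  u @ \oo --> l -> (forall k, (N <= k)%N -> u k = c) -> l = c.
Proof.
move=> /cvg_rnormP ul uc; apply/eqP; rewrite -subr_eq0 -rnorm_eq0 eq_le rnorm_ge0 andbT.
apply: eps_le0 => eps /ul[N' HN']; have := HN' (maxn N N') (leq_maxr _ _).
by rewrite uc ?leq_maxl// => /ltW.
Qed.

Lemma inner_lim_eventually_const (R : realType) (H : hilbertType R) (u : nat -> 'B(H))
    (l : 'B(H)) x y (c : R[i]) N :
  u @ \oo --> l -> (forall k, (N <= k)%N -> inner (u k x) y = c) -> inner (l x) y = c.
Proof.
move=> ul; apply: (@cvgn_eventually_const _ R[i]^o).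
exact: (cvg_innerl (cvg_app ul)).
Qed.

(** * Reading off one coefficient with a vacuum vector *)

Section Vacuum.
Variables (R : realType) (n : nat) (E K : hilbertType R).
Variable (T : forall K : hilbertType R, hilbert_tensor E K).
Variables (X : 'I_n -> 'B(K)) (v h : K) (w : seq 'I_n).
Hypothesis Xv : forall i, (X i)^~* v = 0.
Hypothesis Xh : forall u, u != w -> inner (word_op X u v) h = 0.
Implicit Types AB : (seq 'I_n -> 'B(E)) * (seq 'I_n -> 'B(E)).

Lemma adjoint_word_vacuum u : u != [::] -> (word_op X u)^~* v = 0.
Proof. by case: u => // i u _; rewrite word_op_cons adjointM op_mulE Xv op0. Qed.

Lemma sum_tuple_single (V : nmodType) (k : nat) (F : seq 'I_n -> V) :
  (forall u, u != w -> F u = 0) ->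
  \sum_(u : k.-tuple 'I_n) F u = if k == size w then F w else 0.
Proof.
move=> F0; case: eqP => [->|kw].
  rewrite (bigD1 (in_tuple w))//= big1 ?addr0// => u uw; apply: F0.
  by apply: contra uw => /eqP uw; apply/eqP/val_inj.
apply: big1 => u _; apply: F0; apply/eqP => uw; apply: kw.
by rewrite -uw size_tuple.
Qed.

(** The antiholomorphic terms have positive degree and kill v, and among the holomorphic ones only w
    connects v to h. The paired partial sums are therefore eventually constant. The lemma serves
    both the tuples on H of the uniqueness proof and rW. *)
Lemma vacuum_holo_coef AB (x y : E) : ph_cvg T AB X ->
  inner (ph_sum T AB X (tens (T K) x v)) (tens (T K) y h) =
  inner (AB.1 w x) y * inner (word_op X w v) h.
Proof.
move=> [cB cA]; rewrite /ph_sum op_addE innerDl.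
rewrite (@inner_lim_eventually_const _ _ _ _ _ _ 0 0 cB); last first.
  move=> N _; rewrite /series/= sum_opE inner_suml big1// => k _.
  rewrite sum_opE inner_suml big1// => u _.
  rewrite tens_opE adjoint_word_vacuum ?tens0r ?inner0l//.
  by rewrite -size_eq0 size_tuple.
rewrite add0r (@inner_lim_eventually_const _ _ _ _ _ _
  (inner (AB.1 w x) y * inner (word_op X w v) h) (size w).+1 cA)//.
move=> N wN; rewrite /series/= sum_opE inner_suml big_mkord.
rewrite (bigD1 (Ordinal wN))//= big1 ?addr0; last first.
  move=> k kw; rewrite sum_opE inner_suml big1// => u _.
  rewrite tens_opE inner_tens Xh ?mulr0//; apply: contra kw => /eqP uw.
  by apply/eqP/val_inj; rewrite /= -uw size_tuple.
rewrite sum_opE inner_suml.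
under eq_bigr do rewrite tens_opE inner_tens.
rewrite (sum_tuple_single _
  (F := fun u => inner (AB.1 u x) y * inner (word_op X u v) h)) ?eqxx//.
by move=> u uw; rewrite Xh ?mulr0.
Qed.

(** With v on the right the roles are exchanged: an antiholomorphic term pairs h with X_u v, while a
    holomorphic term of positive degree has its adjoint applied to v and vanishes. *)
Lemma vacuum_antiholo_coef AB (x y : E) : w != [::] -> ph_cvg T AB X ->
  inner (ph_sum T AB X (tens (T K) x h)) (tens (T K) y v) =
  inner (AB.2 w x) y * inner h (word_op X w v).
Proof.
move=> w0 [cB cA]; rewrite /ph_sum op_addE innerDl addrC.
(* The empty word differs from w, so [Xh] makes h orthogonal to v; this removes the constant
   holomorphic term. *)
have hv : inner h v = 0.
  by rewrite inner_conj -[v]op_oneE -(word_op_nil X) Xh ?conjC0// eq_sym.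
rewrite (@inner_lim_eventually_const _ _ _ _ _ _ 0 0 cA); last first.
  move=> N _; rewrite /series/= sum_opE inner_suml big1// => k _.
  rewrite sum_opE inner_suml big1// => u _.
  rewrite tens_opE inner_tens (adjointP (word_op X u)); have [->|u0] := eqVneq (tval u) [::].
    by rewrite word_op_nil adjoint1 op_oneE hv mulr0.
  by rewrite adjoint_word_vacuum// inner0r mulr0.
rewrite add0r (@inner_lim_eventually_const _ _ _ _ _ _
  (inner (AB.2 w x) y * inner h (word_op X w v)) (size w) cB)//.
have hX u : u != w -> inner h (word_op X u v) = 0.
  by move=> uw; rewrite inner_conj Xh// conjC0.
(* The antiholomorphic series starts in degree 1, so the words of length [size w] occur at index
   [(size w).-1]. *)
have wp : (size w).-1.+1 = size w by rewrite prednK// lt0n size_eq0.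
move=> N wN; rewrite /series/= sum_opE inner_suml big_mkord.
have wN' : ((size w).-1 < N)%N by rewrite wp.
rewrite (bigD1 (Ordinal wN'))//= big1 ?addr0; last first.
  move=> k kw; rewrite sum_opE inner_suml big1// => u _.
  rewrite tens_opE inner_tens adjointPl hX ?mulr0//; apply: contra kw => /eqP uw.
  by apply/eqP/val_inj; rewrite /= -uw size_tuple.
rewrite sum_opE inner_suml.
under eq_bigr do rewrite tens_opE inner_tens adjointPl.
rewrite (sum_tuple_single _
  (F := fun u => inner (AB.2 u x) y * inner h (word_op X u v))) ?wp ?eqxx//.
by move=> u uw; rewrite hX ?mulr0.
Qed.

End Vacuum.

(** * The universal model belongs to the domain *)

Section PhiDefined.
Variables (R : realType) (n : nat) (a : seq 'I_n -> R) (K : hilbertType R).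
Variable (X : 'I_n -> 'B(K)).
Hypothesis a_ge0 : forall w, 0 <= a w.

Let s (x : K) (k : nat) : R :=
  \sum_(w : k.+1.-tuple 'I_n) a w * rnorm ((word_op X w)^~* x) ^+ 2.

Hypothesis X_row : forall N x, \sum_(k < N) s x k <= rnorm x ^+ 2.

Let s_ge0 x k : 0 <= s x k.
Proof. by apply: sumr_ge0 => w _; rewrite mulr_ge0 ?sqr_ge0. Qed.

(** Each term paired with y is at most a_w |Y| times the norms of the adjoint of X_w at x and at y.
    Cauchy-Schwarz combines the small tail at x with the bound |y|^2 at y. *)
Let Phi_partial_close (Y : 'B(K)) (M N : nat) (x : K) (eps : R) : (M <= N)%N -> 0 < eps ->
  \sum_(M <= k < N) s x k <= eps ^+ 2 ->
  rnorm (Phi_partial a X Y N x - Phi_partial a X Y M x) <= rnorm Y * eps.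
Proof.
move=> MN e0 hx; apply: rnorm_le_inner => [|y]; first by rewrite mulr_ge0 ?rnorm_ge0 ?ltW.
have [->|y0] := eqVneq y 0; first by rewrite inner0r !rnorm0 mulr0.
have y0' : 0 < rnorm y by rewrite lt_def rnorm_eq0 y0 rnorm_ge0.
have hy : \sum_(M <= k < N) s y k <= rnorm y ^+ 2.
  apply: le_trans (X_row N y); rewrite -(big_mkord xpredT (s y)).
  by rewrite (@big_cat_nat _ _ _ M 0 N)//= lerDr sumr_ge0.
rewrite -opBE /Phi_partial sub_series_geq// sum_opE inner_suml.
rewrite (le_trans (ler_rnorm_sum _ _ _))//.
(* The choice of t makes t eps^2 and |y|^2 / t both equal to eps |y|. *)
pose t := rnorm y / eps; have t0 : 0 < t by rewrite divr_gt0.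
apply: (@le_trans _ _ (\sum_(M <= k < N) rnorm Y * ((t * s x k + s y k / t) / 2))).
  apply: ler_sum => k _; rewrite sum_opE inner_suml (le_trans (ler_rnorm_sum _ _ _))//.
  rewrite /s [t * _]mulr_sumr [X in _ + X]mulr_suml -big_split mulr_suml mulr_sumr.
  apply: ler_sum => w _; rewrite op_scaleE innerZl rnormM rnormR ger0_norm//.
  rewrite !op_mulE (adjointP (word_op X w)).
  set p := (word_op X w)^~* x; set q := (word_op X w)^~* y.
  have h1 : rnorm (inner (Y p) q) <= rnorm Y * (rnorm p * rnorm q).
    rewrite (le_trans (CauchySchwarz _ _))// mulrA ler_wpM2r ?rnorm_ge0//.
    exact: rnorm_app.
  have h2 : rnorm p * rnorm q <= (t * rnorm p ^+ 2 + rnorm q ^+ 2 / t) / 2.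
    rewrite -subr_ge0.
    have -> : (t * rnorm p ^+ 2 + rnorm q ^+ 2 / t) / 2 - rnorm p * rnorm q =
       (t * rnorm p - rnorm q) ^+ 2 / (2 * t) by field; rewrite gt_eqF.
    by rewrite divr_ge0 ?sqr_ge0// mulr_ge0// ltW.
  have -> : rnorm Y * ((t * (a w * rnorm p ^+ 2) + a w * rnorm q ^+ 2 / t) / 2) =
    a w * (rnorm Y * ((t * rnorm p ^+ 2 + rnorm q ^+ 2 / t) / 2)) by ring.
  by rewrite ler_wpM2l// (le_trans h1)// ler_wpM2l// rnorm_ge0.
rewrite -mulr_sumr -mulrA ler_wpM2l ?rnorm_ge0//.
rewrite -mulr_suml big_split/= -mulr_sumr -mulr_suml ler_pdivrMr//.
rewrite (@le_trans _ _ (t * eps ^+ 2 + rnorm y ^+ 2 / t))//.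
  by rewrite lerD// ?ler_wpM2l ?(ltW t0)// ler_wpM2r// invr_ge0 ltW.
rewrite le_eqVlt; apply/orP; left; apply/eqP; rewrite /t; field.
by rewrite !gt_eqF.
Qed.

(** The partial sums converge even strongly. Taking the tail from 0 with eps = |x| in
    [Phi_partial_close] bounds them all by |Y|, so the limit is a bounded operator. *)
Lemma row_Phi_defined : Phi_defined a X.
Proof.
move=> Y.
have ucx x : cvgn (fun N => Phi_partial a X Y N x).
  apply: cauchy_rnorm_cvg => eps e0.
  have Y0 : 0 < rnorm Y + 1 by rewrite ltr_wpDl ?rnorm_ge0.
  pose d := eps / (rnorm Y + 1); have d0 : 0 < d by rewrite divr_gt0.
  have ic : cvgn (series (s x)).
    apply: nondecreasing_is_cvgn; first by apply: nondecreasing_series => k _ _; exact: s_ge0.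
    by exists (rnorm x ^+ 2) => _ [N _ <-]; rewrite /series/= big_mkord.
  have d2 : 0 < d ^+ 2 / 2 by rewrite divr_gt0 ?exprn_gt0.
  have /cvgrPdist_lt/(_ _ d2)[N _ HN] := ic.
  have close k l : (N <= k)%N -> (k <= l)%N ->
      rnorm (Phi_partial a X Y l x - Phi_partial a X Y k x) < eps.
    move=> Nk kl; apply: (@le_lt_trans _ _ (rnorm Y * d)).
      apply: Phi_partial_close => //; rewrite -sub_series_geq//.
      have hk := HN k Nk; have hl := HN l (leq_trans Nk kl).
      move: hk hl => /=; rewrite !ltr_norml => /andP[h1 h2] /andP[h3 h4].
      by move: (limn _) (series _ k) (series _ l) (d ^+ 2) h1 h2 h3 h4 => L A B D; lra.
    by rewrite /d mulrCA gtr_pMr// ltr_pdivrMr// mul1r ltrDl.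
  exists N => k l Nk Nl; case: (leqP k l) => [kl|/ltnW lk]; last exact: close.
  by rewrite rdistC; exact: close.
have bd x N : rnorm (Phi_partial a X Y N x) <= rnorm Y * rnorm x.
  have [->|x0] := eqVneq x 0; first by rewrite op0 !rnorm0 mulr0.
  have x0' : 0 < rnorm x by rewrite lt_def rnorm_eq0 x0 rnorm_ge0.
  have := @Phi_partial_close Y 0 N x (rnorm x) (leq0n _) x0'.
  rewrite big_mkord X_row => /(_ isT).
  by rewrite [Phi_partial a X Y 0]big_geq// op_zeroE subr0.
have [c x y|x|Z ZE] := @mk_op _ _ (fun x => limn (fun N => Phi_partial a X Y N x)) (rnorm Y).
- apply/cvg_lim => //; under eq_fun do rewrite op_linear.
  by apply: cvgD; [apply: cvgZr; exact: ucx|exact: ucx].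
- exact: (cvg_rnorm_le (ucx x) (bd x)).
by exists Z => x y; rewrite ZE; apply: cvg_innerl; exact: ucx.
Qed.

End PhiDefined.

Section PositiveOperators.
Variables (R : realType) (H : hilbertType R).
Implicit Types (D : 'B(H)).

Lemma op_rnorm2_continuous D : continuous ((fun x => rnorm (D x) ^+ 2) : H -> R^o).
Proof.
have := @sum_rnorm2_continuous R H _ [:: tt] (fun=> D).
by under eq_fun do rewrite big_seq1.
Qed.

(** Polarization turns the quadratic form into squared norms of operators, whose continuity is
    already available. *)
Lemma Re_inner_op D x : complex.Re (inner (D x) x) =
  (rnorm ((D + 1) x) ^+ 2 - rnorm (D x) ^+ 2 - rnorm ((1 : 'B(H)) x) ^+ 2) / 2.
Proof. by rewrite op_addE op_oneE rnorm2D; field. Qed.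

Lemma Re_inner_op_continuous D :
  continuous ((fun x => complex.Re (inner (D x) x)) : H -> R^o).
Proof.
under eq_fun do rewrite Re_inner_op.
move=> x; have h0 : {for x, continuous ((fun=> 2^-1) : H -> R^o)} by exact: cvg_cst.
have h1 := @op_rnorm2_continuous (D + 1) x.
have h2 := @op_rnorm2_continuous D x.
have h3 := @op_rnorm2_continuous 1 x.
exact: (cvgM (cvgB (cvgB h1 h2) h3) h0).
Qed.

(** In [R[i]] the relation 0 <= z also asserts that z is real; self-adjointness supplies this
    half. *)
Lemma psd_selfadjoint D : D^~* = D ->
  (forall x, 0 <= complex.Re (inner (D x) x)) -> psd D.
Proof.
move=> DD D0 x; rewrite lecE /= D0 andbT.
have : inner (D x) x = (inner (D x) x)^*.
  by rewrite -inner_conj -{1}DD adjointPl.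
case: (inner (D x) x) => c d /eqP; rewrite eq_complex/= => /andP[_ /eqP h].
by apply/eqP; lra.
Qed.

End PositiveOperators.

Section OrthonormalBasis.
Variables (R : realType) (K : hilbertType R) (I : eqType) (e : I -> K).
Hypothesis he : orthonormal_basis e.

Lemma onb_inner i j : inner (e i) (e j) = (i == j)%:R.
Proof. by case: he. Qed.

Lemma onb_rnorm i : rnorm (e i) = 1.
Proof.
apply/eqP; rewrite -(@eqrXn2 _ 2) ?rnorm_ge0// expr1n -(inj_eq (@complexI R)).
by rewrite -inner_rnorm onb_inner eqxx.
Qed.

Lemma onb_total : closure (span_of (range e)) = setT.
Proof. by case: he. Qed.

Lemma onb_ext x y : (forall i, inner x (e i) = inner y (e i)) -> x = y.
Proof.
move=> xy; apply/eqP; rewrite -subr_eq0; apply/eqP.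
by apply: (total_inner_eq0 onb_total) => _ [i _ <-]; rewrite innerBl xy subrr.
Qed.

Lemma span_onbP x : span_of (range e) x ->
  exists s c, uniq s /\ x = \sum_(i <- s) c i *: e i.
Proof.
move=> [N [c [v [vP ->]]]].
have /choice[f fP] j : exists i, v j = e i by have [i _ <-] := vP j; exists i.
pose s := undup [seq f j | j <- enum 'I_N].
exists s, (fun i => \sum_(j < N | f j == i) c j); split; first exact: undup_uniq.
under [RHS]eq_bigr do rewrite scaler_suml big_mkcond/=.
rewrite exchange_big/=; apply: eq_bigr => j _; rewrite -big_mkcond/=.
under eq_bigl do rewrite eq_sym.
rewrite -big_filter filter_pred1_uniq ?undup_uniq ?big_seq1 ?fP//.
by rewrite mem_undup map_f// mem_enum.
Qed.

Definition diagonal (D : 'B(K)) (d : I -> R) := forall i, D (e i) = (d i)%:C *: e i.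

Lemma diagonal_adjoint D d : diagonal D d -> D^~* = D.
Proof.
move=> Dd; apply: (total_op_eq onb_total) => _ [i _ <-].
apply: onb_ext => j; rewrite adjointPl !Dd innerZr innerZl conjR !onb_inner.
by case: eqP => [->//|_]; rewrite !mulr0.
Qed.

Lemma diagonal_psd D d : diagonal D d -> (forall i, 0 <= d i) -> psd D.
Proof.
move=> Dd d0; apply: psd_selfadjoint; first exact: diagonal_adjoint Dd.
apply: (total_continuous_ge0 onb_total); first exact: Re_inner_op_continuous.
move=> x /span_onbP[s [c [us ->]]].
have -> : inner (D (\sum_(i <- s) c i *: e i)) (\sum_(i <- s) c i *: e i) =
    (\sum_(i <- s) d i * rnorm (c i) ^+ 2)%:C.
  rewrite real_complex_sum op_sum inner_suml [LHS]big_seq [RHS]big_seq; apply: eq_bigr => i si.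
  rewrite opZ Dd inner_sumr (bigD1_seq i)//= big1 => [|j ji].
    by rewrite addr0 !innerZl innerZr onb_inner eqxx mulr1 real_complexM rnorm_sqr mulrCA.
  by rewrite !innerZl innerZr onb_inner eq_sym (negbTE ji) !mulr0.
by apply: sumr_ge0 => i _; rewrite mulr_ge0 ?sqr_ge0.
Qed.

End OrthonormalBasis.

Section UniversalModel.
Variables (R : realType) (n m : nat) (a : seq 'I_n -> R).
Hypotheses (m1 : (1 <= m)%N) (ha : positive_regular a).
Variables (K : hilbertType R) (e : seq 'I_n -> K) (W : 'I_n -> 'B(K)).
Hypotheses (he : orthonormal_basis e) (hW : is_universal_model m a e W).

Let a_ge0 : forall w, 0 <= a w. Proof. by case: ha. Qed.
Let b := bcoef m a.
Let b_gt0 w : 0 < b w. Proof. exact: bcoef_gt0. Qed.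
Let bE w : b w = bweight a m w. Proof. exact: bcoefE. Qed.

Lemma word_model u w :
  word_op W u (e w) = (Num.sqrt (b w / b (u ++ w)))%:C *: e (u ++ w).
Proof.
elim: u => [|i u IH].
  by rewrite word_op_nil op_oneE /= divff ?gt_eqF// sqrtr1 scale1r.
rewrite word_op_cons op_mulE IH opZ hW scalerA -real_complexM -sqrtrM.
  by rewrite mulrA divfK// gt_eqF.
by rewrite divr_ge0// ltW.
Qed.

Lemma word_model_adjoint u w : (word_op W u)^~* (e w) =
  if take (size u) w == u
  then (Num.sqrt (b (drop (size u) w) / b w))%:C *: e (drop (size u) w) else 0.
Proof.
apply: (onb_ext he) => v; rewrite adjointPl word_model innerZr conjR (onb_inner he).
have -> : (w == u ++ v) = (take (size u) w == u) && (drop (size u) w == v).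
  apply/eqP/andP => [->|[/eqP tu /eqP dv]].
    by rewrite take_size_cat// drop_size_cat.
  by rewrite -dv -{1}tu cat_take_drop.
case: eqP => [tu|_]/=; last by rewrite mulr0 inner0l.
rewrite innerZl (onb_inner he); case: eqP => [<-|_]; last by rewrite !mulr0.
by rewrite -{2}tu cat_take_drop.
Qed.

Lemma vacuum_model i : (W i)^~* (e [::]) = 0.
Proof.
have := word_model_adjoint [:: i] [::].
by rewrite word_op_cons word_op_nil mulr1.
Qed.

Lemma word_model_diagonal D d u w : diagonal e D d ->
  (word_op W u * D * (word_op W u)^~*) (e w) =
  (if take (size u) w == u
   then b (drop (size u) w) / b w * d (drop (size u) w) else 0)%:C *: e w.
Proof.
move=> Dd; rewrite !op_mulE word_model_adjoint.
case: eqP => [tu|_]; last by rewrite !op0 scale0r.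
set v := drop (size u) w; have wE : u ++ v = w by rewrite -{1}tu cat_take_drop.
rewrite opZ Dd !opZ word_model wE !scalerA -!real_complexM; congr (_%:C *: _).
rewrite mulrAC -expr2 sqr_sqrtr//.
by rewrite divr_ge0// ltW.
Qed.

(** Among the words of length k + 1 only the prefix of w of that length acts nontrivially on e_w,
    and there is none when k + 1 exceeds the length of w. *)
Lemma Phi_partial_diagonal D d N w : diagonal e D d ->
  Phi_partial a W D N (e w) =
  (\sum_(k < N) if (k < size w)%N
     then a (take k.+1 w) * (b (drop k.+1 w) / b w * d (drop k.+1 w)) else 0)%:C *: e w.
Proof.
move=> Dd; rewrite /Phi_partial /series/= sum_opE big_mkord real_complex_sum scaler_suml.
apply: eq_bigr => k _; rewrite sum_opE.
under eq_bigr => u _ do rewrite op_scaleE (word_model_diagonal _ _ Dd) scalerA -real_complexM.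
rewrite -scaler_suml -real_complex_sum; congr (_%:C *: _).
under eq_bigr => u _ do rewrite size_tuple.
case: ltnP => kw; last first.
  apply: big1 => u _; case: eqP => [tu|_]; last by rewrite mulr0.
  have := size_tuple u; rewrite -tu size_take_min; move: kw.
  by rewrite leqNgt => /negbTE kw /eqP; rewrite eqn_leq leq_min kw andbF andbF.
have st : size (take k.+1 w) == k.+1 by rewrite size_takel.
rewrite (bigD1 (Tuple st))//= eqxx big1 ?addr0// => u uw.
rewrite ifN ?mulr0//; apply: contra uw => /eqP tu; apply/eqP/val_inj.
by rewrite /= tu.
Qed.

(** The identity minus a partial sum of Phi at I is diagonal. Its eigenvalue at w is at least 1 - (f
    b)_w / b_w = b^(m-1)_w / b_w, which is nonnegative. Working with partial sums allows this to
    precede the existence of Phi. *)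
Lemma model_row N x :
  \sum_(k < N) \sum_(w : k.+1.-tuple 'I_n) a w * rnorm ((word_op W w)^~* x) ^+ 2
    <= rnorm x ^+ 2.
Proof.
have D1 : diagonal e 1 (fun=> 1) by move=> w; rewrite op_oneE scale1r.
pose d w := 1 - \sum_(k < N) if (k < size w)%N
     then a (take k.+1 w) * (b (drop k.+1 w) / b w * 1) else 0.
have Dd : diagonal e (1 - Phi_partial a W 1 N) d.
  move=> w; rewrite opBE op_oneE (Phi_partial_diagonal _ _ D1).
  by rewrite -{1}[e w]scale1r -scalerBl /d rmorphB.
have d_ge0 w : 0 <= d w.
  rewrite subr_ge0.
  have cb : conv a b w <= b w.
    rewrite -subr_ge0 bE.
    have -> : conv a b w = conv a (bweight a m) w by apply: eq_bigr => i _; rewrite bE.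
    by case: m m1 => // p _; rewrite bweightS bweight_ge0.
  apply: (@le_trans _ _ (conv a b w / b w)); last by rewrite ler_pdivrMr// mul1r.
  rewrite /conv mulr_suml.
  pose G k := a (take k.+1 w) * b (drop k.+1 w) / b w.
  rewrite -[leRHS]/(\sum_(k < size w) G k).
  have G0 k : 0 <= G k by rewrite !mulr_ge0 ?invr_ge0// ltW.
  apply: (@le_trans _ _ (\sum_(k < N) if (k < size w)%N then G k else 0)).
    by apply: ler_sum => k _; case: ifP => // _; rewrite /G mulr1 mulrA.
  rewrite (big_ord_widen (maxn N (size w)) G) ?leq_maxr// [leRHS]big_mkcond/=.
  rewrite (big_ord_widen (maxn N (size w))
    (fun k => if (k < size w)%N then G k else 0)) ?leq_maxl//.
  rewrite [leLHS]big_mkcond/=; apply: ler_sum => k _.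
  by case: ifP => // _; case: ifP.
have := diagonal_psd he Dd d_ge0 x.
rewrite opBE op_oneE innerBl inner_rnorm (Phi_partial1_inner a).
by rewrite lecE ReB subr_ge0 => /andP[_].
Qed.

Lemma model_Phi_defined : Phi_defined a W.
Proof. exact: row_Phi_defined a_ge0 model_row. Qed.

(* On operators that are diagonal in the basis [e], [Phi] is convolution by [a],
   once the eigenvalues are multiplied by [b]. *)
Lemma Phi_diagonal D u : diagonal e D (fun w => u w / b w) ->
  diagonal e (Phi a W D) (fun w => conv a u w / b w).
Proof.
move=> Dd w; apply: inner_ext => y.
apply: (@cvgn_eventually_const _ R[i]^o _ _ _ (size w)
  (@Phi_wot _ _ _ _ _ D model_Phi_defined (e w) y)) => N wN.
rewrite (Phi_partial_diagonal _ _ Dd); congr (inner (_%:C *: _) _).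
rewrite /conv mulr_suml; pose G k := a (take k.+1 w) * u (drop k.+1 w) / b w.
rewrite -[RHS]/(\sum_(k < size w) G k) (big_ord_widen N G)// [RHS]big_mkcond/=.
apply: eq_bigr => k _; case: ifP => // _; rewrite /G; field.
by rewrite !gt_eqF.
Qed.

(** By [Phi_diagonal] each application of id - Phi multiplies the weights by 1 - f, and [bweightS]
    says that this lowers the exponent of (1 - f)^-m by one; k <= m keeps it nonnegative. *)
Lemma model_ncdom : ncdom m a W.
Proof.
split; first exact: model_Phi_defined.
have it k : (k <= m)%N ->
    diagonal e (iter k (fun Y => Y - Phi a W Y) 1) (fun w => bweight a (m - k) w / b w).
  elim: k => [_ w|k IH km].
    by rewrite subn0 -bE divff ?gt_eqF// op_oneE scale1r.
  move=> w; have Dk := IH (ltnW km).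
  rewrite iterS opBE Dk (Phi_diagonal Dk) -scalerBl -rmorphB/= -mulrBl.
  have -> : (m - k = (m - k.+1).+1)%N by rewrite subnSK.
  by rewrite bweightS.
move=> k /andP[_ km]; apply: (diagonal_psd he (it k km)) => w.
by rewrite divr_ge0 ?bweight_ge0// ltW.
Qed.

End UniversalModel.

(** * Uniqueness of the coefficients *)

Section SmallNilpotent.
Variables (R : realType) (n m : nat) (a : seq 'I_n -> R).
Hypotheses (m1 : (1 <= m)%N) (ha : positive_regular a).
Variables (K : hilbertType R).

Let a_ge0 : forall w, 0 <= a w. Proof. by case: ha. Qed.

Lemma Phi_eventually_const (X : 'I_n -> 'B(K)) N :
  (forall w, (N < size w)%N -> word_op X w = 0) ->
  Phi_defined a X /\ forall Y, Phi a X Y = Phi_partial a X Y N.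
Proof.
move=> nilX.
have PN Y M : (N <= M)%N -> Phi_partial a X Y M = Phi_partial a X Y N.
  move=> NM; apply/eqP; rewrite -subr_eq0 /Phi_partial sub_series_geq//.
  rewrite big_nat big1// => k /andP[Nk _].
  apply: big1 => w _; rewrite nilX ?mul0r ?scaler0//.
  by rewrite size_tuple ltnS.
have wN Y : wot_cvg (Phi_partial a X Y) (Phi_partial a X Y N).
  move=> x y; apply/(@cvg_rnormP _ R[i]^o) => eps e0; exists N => k Nk.
  by rewrite PN// subrr rnorm0.
have Pd : Phi_defined a X by move=> Y; exists (Phi_partial a X Y N).
split=> // Y; apply: op_ext => x; apply: inner_ext => y.
apply: (@cvgn_eventually_const _ R[i]^o _ _ _ N (@Phi_wot _ _ a _ X Y Pd x y)) => k Nk.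
by rewrite PN.
Qed.

(* For small [c] all the iterates of [id - Phi] at the identity stay within
   distance [1] of the identity. *)
Lemma small_nilpotent_ncdom (X : 'I_n -> 'B(K)) N :
  (forall w, (N < size w)%N -> word_op X w = 0) ->
  exists2 c : R, 0 < c & ncdom m a (scale_tuple c X).
Proof.
move=> nilX.
pose L := \sum_(k < N) \sum_(w : k.+1.-tuple 'I_n) a w * rnorm (word_op X w) ^+ 2.
have L0 : 0 <= L.
  by apply: sumr_ge0 => k _; apply: sumr_ge0 => w _; rewrite mulr_ge0 ?sqr_ge0.
have m0 : 0 < m%:R :> R by rewrite ltr0n.
have m1' : 1 <= m%:R :> R by rewrite ler1n.
(* With this c, Phi has norm at most 1/(2m). While an iterate stays within distance 1 of the
   identity its norm is at most 2, so one step moves it by at most 1/m, and m steps by at most 1. *)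
pose c := (2 * m%:R * (L + 1))^-1.
have L1 : 0 < L + 1 by rewrite ltr_wpDl.
have d0 : 0 < 2 * m%:R * (L + 1) by rewrite !mulr_gt0.
have c0 : 0 < c by rewrite invr_gt0.
have c1 : c <= 1 by rewrite invf_le1//; nra.
have cL : c ^+ 2 * L <= (2 * m%:R)^-1.
  apply: (@le_trans _ _ (c * (L + 1))).
    by rewrite expr2 -mulrA ler_pM2l// (le_trans (ler_wpM2r L0 c1))// mul1r lerDl.
  by rewrite /c invfM -mulrA mulVf ?gt_eqF// mulr1.
exists c => //; set Y := scale_tuple c X.
have nilY w : (N < size w)%N -> word_op Y w = 0.
  by move=> Nw; rewrite word_op_scale nilX// scaler0.
have [Yd PhiE] := Phi_eventually_const nilY.
have PhiN Z : rnorm (Phi a Y Z) <= (2 * m%:R)^-1 * rnorm Z.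
  apply: le_trans (ler_wpM2r (rnorm_ge0 Z) cL).
  rewrite PhiE /Phi_partial /series/= big_mkord (le_trans (ler_rnorm_sum _ _ _))//.
  rewrite -mulrA mulr_suml mulr_sumr; apply: ler_sum => k _.
  rewrite (le_trans (ler_rnorm_sum _ _ _))// mulr_suml mulr_sumr; apply: ler_sum => w _.
  rewrite rnormZr ger0_norm//.
  rewrite [leRHS](_ : _ = a w * (rnorm (word_op X w) ^+ 2 * (rnorm Z * c ^+ 2))); last by ring.
  rewrite ler_wpM2l//.
  rewrite (le_trans (rnorm_mul _ _))// rnorm_adjoint.
  have hw : rnorm (word_op Y w) <= c * rnorm (word_op X w).
    rewrite word_op_scale rnormZr size_tuple ger0_norm ?exprn_ge0 ?(ltW c0)//.
    rewrite ler_wpM2r ?rnorm_ge0// exprS ger_pMr// exprn_ile1 ?(ltW c0)//.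
  have hw0 := rnorm_ge0 (word_op Y w); have hZ := rnorm_ge0 Z.
  apply: (@le_trans _ _ (rnorm (word_op Y w) * rnorm Z * rnorm (word_op Y w))).
    by rewrite ler_wpM2r// rnorm_mul.
  have -> : rnorm (word_op X w) ^+ 2 * (rnorm Z * c ^+ 2) =
    c * rnorm (word_op X w) * rnorm Z * (c * rnorm (word_op X w)) by ring.
  by rewrite ler_pM ?mulr_ge0 ?ler_wpM2r.
have PhiA Z : Z^~* = Z -> (Phi a Y Z)^~* = Phi a Y Z.
  move=> ZZ; rewrite PhiE /Phi_partial /series/= adjoint_sum; apply: eq_bigr => k _.
  rewrite adjoint_sum; apply: eq_bigr => w _.
  by rewrite adjointZ conjR !adjointM adjointK ZZ mulrA.
have n1 : rnorm (1 : 'B(K)) <= 1.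
  by apply: rnorm_op_le => // x; rewrite mul1r op_oneE.
pose D k := iter k (fun Z => Z - Phi a Y Z) 1.
have Dk k : (k <= m)%N -> (D k)^~* = D k /\ rnorm (D k - 1) <= k%:R / m%:R.
  elim: k => [_|k IH km]; first by rewrite adjoint1 subrr rnorm0 mul0r.
  have [Da Dn] := IH (ltnW km); rewrite /D iterS -/(D k); split.
    by rewrite adjointB Da PhiA.
  have DN : rnorm (D k) <= 2.
    rewrite -[D k](subrK 1) (le_trans (ler_rnormD _ _))//.
    have : k%:R / m%:R <= 1 :> R by rewrite ler_pdivrMr// mul1r ler_nat ltnW.
    by move: Dn n1; lra.
  rewrite addrAC (le_trans (ler_rnormB _ _))// -natr1 mulrDl lerD//.
  have -> : 1 / m%:R = (2 * m%:R)^-1 * 2 :> R by field; rewrite gt_eqF.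
  by rewrite (le_trans (PhiN _))// ler_wpM2l// invr_ge0 mulr_ge0// ltW.
split=> // k /andP[_ km]; have [Da Dn] := Dk k km.
apply: psd_selfadjoint => // x.
rewrite -[iter _ _ _]/(D k) -[D k](subrK 1) op_addE op_oneE innerDl inner_rnorm.
have -> : complex.Re (inner ((D k - 1) x) x + (rnorm x ^+ 2)%:C) =
  complex.Re (inner ((D k - 1) x) x) + rnorm x ^+ 2 by case: (inner _ _).
have h1 : k%:R / m%:R <= 1 :> R by rewrite ler_pdivrMr// mul1r ler_nat.
have h2 : rnorm (inner ((D k - 1) x) x) <= rnorm x ^+ 2.
  rewrite (le_trans (CauchySchwarz _ _))// expr2 ler_wpM2r ?rnorm_ge0//.
  rewrite (le_trans (rnorm_app _ _))// -[leRHS]mul1r ler_wpM2r ?rnorm_ge0//.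
  exact: le_trans Dn h1.
have := le_trans (Re_le_rnorm _) h2; rewrite ler_norml => /andP[h3 _].
by rewrite -lerBlDr sub0r.
Qed.

End SmallNilpotent.

Lemma rank_one_exists (R : realType) (H : hilbertType R) (u v : H) :
  exists f : 'B(H), forall x, f x = inner x v *: u.
Proof.
apply: (@mk_op _ _ _ (rnorm v * rnorm u)) => [c x y|x].
  by rewrite innerDl innerZl scalerDl scalerA.
rewrite rnormZ mulrAC ler_wpM2r ?rnorm_ge0// mulrC.
exact: CauchySchwarz.
Qed.

(* Compressing the left creation operators to the suffixes of [w]: [X_u] moves
   the vacuum [g (size w)] to [g 0] exactly when [u = w]. *)
Lemma path_tuple (R : realType) (n : nat) (H : hilbertType R) (w : seq 'I_n) (g : nat -> H) :
  orthonormal_upto (size w).+1 g ->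
  exists X : 'I_n -> 'B(H),
    [/\ forall u, (size w < size u)%N -> word_op X u = 0,
        forall i, (X i)^~* (g (size w)) = 0 &
        forall u, inner (word_op X u (g (size w))) (g 0%N) = (u == w)%:R].
Proof.
move=> on; set N := size w.
have /choice[f fE] (l : nat) : exists f : 'B(H), forall x, f x = inner x (g l.+1) *: g l.
  exact: rank_one_exists.
pose X (i : 'I_n) := \sum_(l < N | tnth (in_tuple w) l == i) f l.
have XE i x : X i x = \sum_(l < N | tnth (in_tuple w) l == i) inner x (g l.+1) *: g l.
  by rewrite /X sum_opE; under eq_bigr do rewrite fE.
have Xg i k : (k <= N)%N -> X i (g k) =
    \sum_(l < N | tnth (in_tuple w) l == i) (k == l.+1)%:R *: g l.
  move=> kN; rewrite XE; apply: eq_bigr => l _.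
  by rewrite on// ltnS ?ltn_ord.
exists X; split.
- have nil u k : (k <= N)%N -> (k < size u)%N -> word_op X u (g k) = 0.
    elim/last_ind: u k => [//|u i IH] k kN; rewrite size_rcons ltnS => ku.
    rewrite -cats1 word_op_cat word_op_cons word_op_nil mulr1 op_mulE.
    rewrite Xg// op_sum big1// => l _.
    rewrite opZ; case: eqP => [kl|_]; last by rewrite scale0r.
    by rewrite IH ?scaler0// ?(ltnW (ltn_ord l))// -ltnS -kl.
  move=> u; case/lastP: u => [//|u i]; rewrite size_rcons ltnS => Nu.
  apply: op_ext => x; rewrite -cats1 word_op_cat word_op_cons word_op_nil mulr1 op_mulE XE.
  rewrite op_sum big1// => l _; rewrite opZ nil ?scaler0// ?(ltnW (ltn_ord l))//.
  exact: leq_trans (ltn_ord l) Nu.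
- move=> i; apply: inner_ext => y; rewrite inner0l adjointPl XE inner_sumr big1// => l _.
  by rewrite innerZr on ?ltnS// ?(ltnW (ltn_ord l))// gtn_eqF ?mulr0.
(* X_u moves the vacuum g N to the g l for which u is the suffix of w starting at position l, and
   kills it when u is not a suffix. *)
have path u : word_op X u (g N) = \sum_(l < N.+1) (drop l w == u)%:R *: g l.
  elim: u => [|i u IH].
    rewrite word_op_nil op_oneE big_ord_recr/= drop_size eqxx scale1r big1 ?add0r// => l _.
    by rewrite -size_eq0 size_drop subn_eq0 leqNgt ltn_ord scale0r.
  rewrite word_op_cons op_mulE IH op_sum.
  under eq_bigr => k _ do rewrite opZ Xg -1?ltnS// scaler_sumr.
  rewrite exchange_big/= [RHS]big_ord_recr/= drop_size scale0r addr0 big_mkcond/=.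
  apply: eq_bigr => l _; rewrite (drop_nth i) -/N// eqseq_cons.
  rewrite (tnth_nth i)/=; case: eqP => [_|_]; last by rewrite scale0r.
  have lN : (l.+1 < N.+1)%N by rewrite ltnS.
  rewrite (bigD1 (Ordinal lN))//= eqxx scale1r big1 ?addr0// => k kl.
  rewrite (_ : (k == l.+1 :> nat) = false) ?scale0r ?scaler0//.
  by apply: contraNF kl => /eqP kl; apply/eqP/val_inj.
move=> u; rewrite path inner_suml big_ord_recl/= drop0 innerZl on// eqxx mulr1.
rewrite big1 ?addr0 1?eq_sym// => l _.
have lN : (bump 0 l < (size w).+1)%N by rewrite /bump/= add1n ltnS; exact: ltn_ord.
by rewrite innerZl on// mulr0.
Qed.

Section Uniqueness.
Variables (R : realType) (n m : nat) (a : seq 'I_n -> R).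
Hypotheses (m1 : (1 <= m)%N) (ha : positive_regular a).
Variables (E H : hilbertType R) (T : forall K : hilbertType R, hilbert_tensor E K).
Hypothesis Hinf : infinite_dimensional H.

Lemma separating_point (w : seq 'I_n) : exists (X : 'I_n -> 'B(H)) (v h : H),
  [/\ ncdom_rad m a X, forall i, (X i)^~* v = 0,
      forall u, u != w -> inner (word_op X u v) h = 0 &
      inner (word_op X w v) h != 0].
Proof.
have [g on] := infinite_orthonormal Hinf (size w).+1.
have [X [Xnil Xv Xh]] := path_tuple on.
have [c c0 Xdom] := small_nilpotent_ncdom m1 ha Xnil.
(* The extra factor 1/2 moves a point of the domain into its radial part. *)
exists (scale_tuple 2^-1 (scale_tuple c X)), (g (size w)), (g 0%N); split.
- exists 2^-1; split; last by exists (scale_tuple c X).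
  by rewrite invr_ge0 ler0n/= invf_lt1// ltr1n.
- by move=> i; rewrite /scale_tuple !adjointZ !op_scaleE Xv !scaler0.
- by move=> u uw; rewrite !word_op_scale !op_scaleE !innerZl Xh (negbTE uw) !mulr0.
rewrite !word_op_scale !op_scaleE !innerZl Xh eqxx mulr1 -real_complexM.
rewrite (inj_eq (@complexI R) _ 0) mulf_neq0// expf_neq0//.
by rewrite gt_eqF.
Qed.

Lemma ph_coefs_unique (G : ('I_n -> 'B(H)) -> 'B(T H)) AB AB' :
  ph_coefs m a G AB -> ph_coefs m a G AB' -> AB = AB'.
Proof.
move=> [B0 hAB] [B0' hAB'].
have D (X : 'I_n -> 'B(H)) : ncdom_rad m a X ->
    ph_cvg T (coefB AB AB') X /\ ph_sum T (coefB AB AB') X = 0.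
  move=> Xd; have [c e] := hAB X Xd; have [c' e'] := hAB' X Xd.
  by have [cD ->] := ph_cvgB c c'; rewrite -e -e' subrr.
have A_eq w : AB.1 w = AB'.1 w.
  have [X [v [h [/D[cX sX] Xv Xh Xw]]]] := separating_point w.
  apply: op_ext => x; apply: inner_ext => y.
  have := vacuum_holo_coef Xv Xh x y cX; rewrite sX op_zeroE inner0l => /esym/eqP.
  have -> : (coefB AB AB').1 w x = AB.1 w x - AB'.1 w x by [].
  by rewrite mulf_eq0 (negbTE Xw) orbF innerBl subr_eq0 => /eqP.
have B_eq w : AB.2 w = AB'.2 w.
  have [->|w0] := eqVneq w [::]; first by rewrite B0 B0'.
  have [X [v [h [/D[cX sX] Xv Xh Xw]]]] := separating_point w.
  apply: op_ext => x; apply: inner_ext => y.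
  have := vacuum_antiholo_coef Xv Xh x y w0 cX; rewrite sX op_zeroE inner0l => /esym/eqP.
  have -> : (coefB AB AB').2 w x = AB.2 w x - AB'.2 w x by [].
  rewrite mulf_eq0 [inner h _]inner_conj conjC_eq0 (negbTE Xw) orbF innerBl subr_eq0.
  by move/eqP.
rewrite [AB]surjective_pairing [AB']surjective_pairing.
by congr (_, _); apply/funext.
Qed.

End Uniqueness.

(** * Cauchy estimates and limits *)

Lemma cvg_sum_seq (R : realType) (I : Type) (s : seq I) (f : I -> nat -> R) (l : I -> R) :
  (forall i, (f i k : R^o) @[k --> \oo] --> l i) ->
  (\sum_(i <- s) f i k : R^o) @[k --> \oo] --> \sum_(i <- s) l i.
Proof.
move=> fl; elim: s => [|i s IH].
  by rewrite big_nil; under eq_fun do rewrite big_nil; exact: cvg_cst.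
rewrite big_cons; under eq_fun do rewrite big_cons.
exact: (cvgD (fl i) IH).
Qed.

Section CauchyEstimates.
Variables (R : realType) (n m : nat) (a : seq 'I_n -> R).
Hypotheses (m1 : (1 <= m)%N) (ha : positive_regular a).
Variables (E K : hilbertType R) (T : forall K : hilbertType R, hilbert_tensor E K).
Variables (e : seq 'I_n -> K) (W : 'I_n -> 'B(K)).
Hypotheses (he : orthonormal_basis e) (hW : is_universal_model m a e W).

Let b := bcoef m a.
Let b_gt0 w : 0 < b w. Proof. exact: bcoef_gt0. Qed.

(** For f w = A_w x this is the component of degree k of G(rW)(x (x) e_{g_0}). *)
Let column r k (f : seq 'I_n -> E) : T K :=
  \sum_(w : k.-tuple 'I_n) (r ^+ k / Num.sqrt (b w))%:C *: tens (T K) (f w) (e w).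

Let column_coef2 r k w : (r ^+ k / Num.sqrt (b w)) ^+ 2 = (r ^+ k) ^+ 2 / b w.
Proof. by rewrite expr_div_n sqr_sqrtr// ltW. Qed.

Let rnorm2_column r k f : rnorm (column r k f) ^+ 2 =
  \sum_(w : k.-tuple 'I_n) rnorm (f w) ^+ 2 / b w * (r ^+ k) ^+ 2.
Proof.
apply: (@complexI R); rewrite -inner_rnorm inner_suml real_complex_sum.
apply: eq_bigr => w _; rewrite inner_sumr (bigD1 w)//= big1 ?addr0; last first.
  move=> u uw; rewrite innerZl innerZr inner_tens (onb_inner he).
  rewrite (_ : (_ == _) = false) ?mulr0//; apply: contraNF uw => /eqP uw.
  by apply/eqP/val_inj.
rewrite innerZl innerZr inner_tens (onb_inner he) eqxx mulr1 conjR inner_rnorm.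
rewrite -!real_complexM mulrA -expr2 column_coef2.
by congr (_%:C); ring.
Qed.

Let scaled_vacuum r i : (scale_tuple r W i)^~* (e [::]) = 0.
Proof.
by rewrite /scale_tuple adjointZ op_scaleE (vacuum_model m1 ha he hW) scaler0.
Qed.

Let scaled_word r u : word_op (scale_tuple r W) u (e [::]) =
  (r ^+ size u / Num.sqrt (b u))%:C *: e u.
Proof.
rewrite word_op_scale op_scaleE (word_model m1 ha hW) cats0 scalerA -real_complexM.
by rewrite -[bcoef m a [::]]/1 sqrtrM// sqrtr1 mul1r sqrtrV// ltW.
Qed.

Let scaled_word_inner r w u : u != w -> inner (word_op (scale_tuple r W) u (e [::])) (e w) = 0.
Proof.
by move=> uw; rewrite scaled_word innerZl (onb_inner he) (negbTE uw) mulr0.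
Qed.

Let norm_from_inner (S z M x : R) : 0 <= z -> 0 <= M -> 0 <= x ->
  S = z ^+ 2 -> S <= M * x * z -> S <= M ^+ 2 * x ^+ 2.
Proof.
move=> z0 M0 x0 -> h; rewrite -exprMn ler_pXn2r ?nnegrE ?mulr_ge0//.
have [->|zn] := eqVneq z 0; first by rewrite mulr_ge0.
by move: h; rewrite expr2 ler_pM2r// lt_def zn.
Qed.

(** Pairing G(rW)(x (x) e_{g_0}) with its own component z of degree k gives |z|^2; Cauchy-Schwarz
    and division by |z| leave |z| <= |G(rW)| |x|. *)
Lemma holo_cauchy_estimate AB r : ph_cvg T AB (scale_tuple r W) ->
  cauchy_estimate m a AB.1 r (rnorm (ph_sum T AB (scale_tuple r W))).
Proof.
move=> cX k x; set G := ph_sum T AB _.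
pose z := column r k (fun w => AB.1 w x).
apply: (@norm_from_inner _ (rnorm z)); rewrite ?rnorm_ge0 ?rnorm2_column//.
have Gz : inner (G (tens (T K) x (e [::]))) z = (rnorm z ^+ 2)%:C.
  rewrite rnorm2_column inner_sumr real_complex_sum; apply: eq_bigr => w _.
  rewrite innerZr conjR (vacuum_holo_coef (scaled_vacuum r) (@scaled_word_inner r w) _ _ cX).
  rewrite scaled_word innerZl (onb_inner he) eqxx mulr1 size_tuple inner_rnorm.
  rewrite -!real_complexM mulrCA -expr2 column_coef2.
  by congr (_%:C); ring.
rewrite -(rnorm2_column r k (fun w => AB.1 w x)) -/z.
have := CauchySchwarz (G (tens (T K) x (e [::]))) z.
rewrite Gz rnormR ger0_norm ?sqr_ge0// => h; apply: le_trans h _.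
rewrite ler_wpM2r ?rnorm_ge0// (le_trans (rnorm_app _ _))//.
by rewrite rnorm_tens (onb_rnorm he) mulr1.
Qed.

(** Here the vacuum stands on the right, where the antiholomorphic coefficients show up. The empty
    word is covered by the normalization of [AB.2]. *)
Lemma antiholo_cauchy_estimate AB r : AB.2 [::] = 0 -> ph_cvg T AB (scale_tuple r W) ->
  cauchy_estimate m a (fun w => (AB.2 w)^~*) r (rnorm (ph_sum T AB (scale_tuple r W))).
Proof.
move=> B0 cX k y; set G := ph_sum T AB _.
pose z := column r k (fun w => (AB.2 w)^~* y).
apply: (@norm_from_inner _ (rnorm z)); rewrite ?rnorm_ge0 ?rnorm2_column//.
have Gz : inner (G z) (tens (T K) y (e [::])) = (rnorm z ^+ 2)%:C.
  rewrite rnorm2_column op_sum inner_suml real_complex_sum; apply: eq_bigr => w _.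
  rewrite opZ innerZl; have [w0|w0] := eqVneq (tval w) [::].
    rewrite w0 B0 adjoint0 op_zeroE tens0l op0 inner0l mulr0 rnorm0.
    by rewrite expr0n/= !mul0r.
  rewrite (vacuum_antiholo_coef (scaled_vacuum r) (@scaled_word_inner r w) _ _ w0 cX).
  rewrite scaled_word innerZr conjR (onb_inner he) eqxx mulr1 size_tuple.
  rewrite adjointP inner_rnorm.
  rewrite -!real_complexM mulrCA -expr2 column_coef2.
  by congr (_%:C); ring.
rewrite -(rnorm2_column r k (fun w => (AB.2 w)^~* y)) -/z.
have := CauchySchwarz (G z) (tens (T K) y (e [::])).
rewrite Gz rnormR ger0_norm ?sqr_ge0// => h; apply: le_trans h _.
rewrite rnorm_tens (onb_rnorm he) mulr1 mulrAC ler_wpM2r ?rnorm_ge0//.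
exact: rnorm_app.
Qed.

End CauchyEstimates.

Section CoefficientLimits.
Variables (R : realType) (n m : nat) (a : seq 'I_n -> R) (E : hilbertType R).
Hypotheses (m1 : (1 <= m)%N) (ha : positive_regular a).
Implicit Types (A : seq 'I_n -> 'B(E)) (r M : R).

Let b_gt0 w : 0 < bcoef m a w. Proof. exact: bcoef_gt0. Qed.

(** From (p + q)^2 <= 2 p^2 + 2 q^2; the factor 2 in the conclusion is a convenient, not a sharp,
    constant. *)
Lemma cauchy_estimateB A A' r M M' : 0 <= M -> 0 <= M' ->
  cauchy_estimate m a A r M -> cauchy_estimate m a A' r M' ->
  cauchy_estimate m a (fun w => A w - A' w) r (2 * (M + M')).
Proof.
move=> M0 M'0 hA hA' k x.
apply: (@le_trans _ _ (2 * (M ^+ 2 * rnorm x ^+ 2 + M' ^+ 2 * rnorm x ^+ 2))); last first.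
  by have := sqr_ge0 (rnorm x); have := mulr_ge0 M0 M'0; nra.
rewrite (le_trans _ (ler_wpM2l _ (lerD (hA k x) (hA' k x))))// -big_split/= mulr_sumr.
apply: ler_sum => w _; rewrite -!mulrDl mulrA ler_wpM2r ?sqr_ge0//.
rewrite mulrA ler_wpM2r ?invr_ge0 ?(ltW (b_gt0 _))//.
have : rnorm (A w x - A' w x) ^+ 2 <= (rnorm (A w x) + rnorm (A' w x)) ^+ 2.
  by rewrite ler_pXn2r ?nnegrE ?addr_ge0 ?rnorm_ge0 ?ler_rnormB.
move=> h; apply: (le_trans h).
by have := sqr_ge0 (rnorm (A w x) - rnorm (A' w x)); nra.
Qed.

Lemma rnorm_coef_le A r M w : 0 < r -> 0 <= M -> cauchy_estimate m a A r M ->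
  rnorm (A w) <= M * Num.sqrt (bcoef m a w) / r ^+ size w.
Proof.
move=> r0 M0 hA; have rk0 : 0 < r ^+ size w by rewrite exprn_gt0.
apply: rnorm_op_le => [|x]; first by rewrite !mulr_ge0 ?invr_ge0 ?sqrtr_ge0// ltW.
rewrite -(@ler_pXn2r _ 2) ?nnegrE ?mulr_ge0 ?invr_ge0 ?sqrtr_ge0 ?rnorm_ge0 ?(ltW rk0)//.
have := hA (size w) x; rewrite (bigD1 (in_tuple w))//= => h.
have {h} : rnorm (A w x) ^+ 2 / bcoef m a w * (r ^+ size w) ^+ 2 <= M ^+ 2 * rnorm x ^+ 2.
  apply: le_trans h; rewrite lerDl sumr_ge0// => u _.
  by apply: mulr_ge0; [apply: divr_ge0; [exact: sqr_ge0|exact: ltW]|exact: sqr_ge0].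
rewrite -ler_pdivlMr ?exprn_gt0// ler_pdivrMr// => h; apply: (le_trans h).
rewrite !exprMn exprVn sqr_sqrtr ?(ltW (b_gt0 _))// le_eqVlt; apply/orP; left; apply/eqP.
by ring.
Qed.

Lemma coef_limit (A : nat -> seq 'I_n -> 'B(E)) :
  (forall r eps, 0 < r < 1 -> 0 < eps -> exists N, forall k l, (N <= k)%N -> (N <= l)%N ->
    cauchy_estimate m a (fun w => A k w - A l w) r eps) ->
  exists L : seq 'I_n -> 'B(E), (forall w, (fun k => A k w) @ \oo --> L w) /\
    forall r eps, 0 < r < 1 -> 0 < eps -> exists N, forall k, (N <= k)%N ->
      cauchy_estimate m a (fun w => A k w - L w) r eps.
Proof.
move=> hA.
have cA w : cvgn (fun k => A k w).
  apply: cauchy_op_cvg => eps e0.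
  (* Any radius in (0, 1) would give the convergence of a single coefficient; 1/2 is taken. *)
  pose q : R := Num.sqrt (bcoef m a w) / 2^-1 ^+ size w.
  have q0 : 0 < q by rewrite divr_gt0 ?sqrtr_gt0 ?exprn_gt0.
  have h2 : 0 < (2^-1 : R) < 1 by rewrite invr_gt0 ltr0n invf_lt1// ltr1n.
  have d0 : 0 < eps / (2 * q) by rewrite divr_gt0// mulr_gt0.
  have [N HN] := hA _ _ h2 d0; exists N => k l Nk Nl.
  have := @rnorm_coef_le _ _ _ w (proj1 (andP h2)) (ltW d0) (HN k l Nk Nl).
  rewrite -mulrA -/q => h; apply: (le_lt_trans h).
  rewrite (_ : _ * q = eps / 2); last by field; rewrite gt_eqF.
  by rewrite ltr_pdivrMr// ltr_pMr// ltr1n.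
exists (fun w => limn (fun k => A k w)); split=> [w|r eps r01 e0]; first exact: cA.
have [N HN] := hA _ _ r01 e0; exists N => k Nk j x.
pose S l := \sum_(w : j.-tuple 'I_n)
  rnorm ((A k w - A l w) x) ^+ 2 / bcoef m a w * (r ^+ j) ^+ 2.
have Sc : (S l : R^o) @[l --> \oo] --> \sum_(w : j.-tuple 'I_n)
    rnorm ((A k w - limn (fun k => A k w)) x) ^+ 2 / bcoef m a w * (r ^+ j) ^+ 2.
  apply: (cvg_sum_seq (f := fun (w : j.-tuple 'I_n) l =>
    rnorm ((A k w - A l w) x) ^+ 2 / bcoef m a w * (r ^+ j) ^+ 2)) => w.
  have h : (fun l => (A k w - A l w) x) @ \oo --> (A k w - limn (fun k => A k w)) x.
    by apply: cvg_app; apply: cvgB; [exact: cvg_cst|exact: cA].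
  have h1 := cvg_rnorm h.
  have h2 : ((bcoef m a w)^-1 : R^o) @[l --> \oo] --> (bcoef m a w)^-1 by exact: cvg_cst.
  have h3 : ((r ^+ j) ^+ 2 : R^o) @[l --> \oo] --> (r ^+ j) ^+ 2 by exact: cvg_cst.
  exact: (cvgM (cvgM (cvgM h1 h1) h2) h3).
(* For fixed degree j and vector x the estimate is a closed condition on a finite sum, so it passes
   to the limit in l. *)
apply: (@closed_cvg _ _ \oo _ S [set t : R^o | t <= eps ^+ 2 * rnorm x ^+ 2]).
- exact: closed_le.
- by exists N => // l /= Nl; exact: HN.
- exact: Sc.
Qed.

End CoefficientLimits.

(** * Free pluriharmonic functions and their coefficients *)

Section FreePluriharmonic.
Variables (R : realType) (n m : nat) (a : seq 'I_n -> R).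
Variables (E : hilbertType R) (T : forall K : hilbertType R, hilbert_tensor E K).
Implicit Types (A C : seq 'I_n -> 'B(E)).

Section Series.
Variables (K : hilbertType R) (X : 'I_n -> 'B(K)).

Lemma holo_term0 A : holo_term T A X 0 = tens_op (T K) (A [::]) 1.
Proof.
rewrite /holo_term.
rewrite (big_tuple0 xpredT (fun w => tens_op (T K) (A w) (word_op X w))).
by rewrite word_op_nil.
Qed.

Lemma series_shift_cvg (V : normedModType R[i]) (u : nat -> V) : cvgn (series u) ->
  series (fun k => u k.+1) @ \oo --> limn (series u) - u 0%N.
Proof.
move=> cu.
have -> : series (fun k => u k.+1) = (fun N => series u N.+1 - u 0%N).
  apply/funext => N; rewrite /series/= [in RHS]big_nat_recl//.
  by rewrite [RHS]addrC addKr.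
apply: cvgB; last exact: cvg_cst.
by have := cu; rewrite -(cvg_shiftS (series u)).
Qed.

(** The subtracted term is the one of degree 0, which the antiholomorphic series leaves out. *)
Lemma antiholo_series_lim A : cvgn (series (holo_term T A X)) ->
  series (fun k => antiholo_term T (fun w => (A w)^~*) X k.+1) @ \oo -->
  (holo_eval T A X)^~* - (holo_term T A X 0)^~*.
Proof.
move=> cA; rewrite -adjointB.
have -> : series (fun k => antiholo_term T (fun w => (A w)^~*) X k.+1) =
    (fun N => (series (fun k => holo_term T A X k.+1) N)^~*).
  apply/funext => N; rewrite /series/= adjoint_sum; apply: eq_bigr => k _.
  by rewrite antiholo_termE; under eq_fun do rewrite adjointK.
exact: cvg_adjoint (series_shift_cvg cA).
Qed.

Lemma holo_eval_lin A C c :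
  cvgn (series (holo_term T A X)) -> cvgn (series (holo_term T C X)) ->
  cvgn (series (holo_term T (fun w => c *: A w + C w) X)) /\
  holo_eval T (fun w => c *: A w + C w) X = c *: holo_eval T A X + holo_eval T C X.
Proof.
move=> cA cC; have h : series (holo_term T (fun w => c *: A w + C w) X) @ \oo -->
    c *: holo_eval T A X + holo_eval T C X.
  have -> : holo_term T (fun w => c *: A w + C w) X =
      fun k => c *: holo_term T A X k + holo_term T C X k.
    by apply/funext => k; exact: holo_term_lin.
  exact: series_lin.
by split; [apply/cvg_ex; eexists; exact: h|exact: cvg_lim].
Qed.

End Series.

Lemma free_holomorphic_lin A C c : free_holomorphic m a T A -> free_holomorphic m a T C ->
  free_holomorphic m a T (fun w => c *: A w + C w).
Proof.
move=> hA hC K X Xd; exact: (holo_eval_lin c (hA _ _ Xd) (hC _ _ Xd)).1.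
Qed.

Lemma holo_series0 (K : hilbertType R) (X : 'I_n -> 'B(K)) :
  series (holo_term T (fun=> 0) X) = fun=> 0.
Proof.
apply/funext => N; rewrite /series/= big1// => k _; apply: big1 => w _.
exact: tens_op0l.
Qed.

Lemma free_holomorphic0 : free_holomorphic m a T (fun=> 0).
Proof. by move=> K X _; rewrite holo_series0; exact: is_cvg_cst. Qed.

Lemma holo_eval0 (K : hilbertType R) (X : 'I_n -> 'B(K)) : holo_eval T (fun=> 0) X = 0.
Proof. by rewrite /holo_eval holo_series0; exact: lim_cst. Qed.

Definition ph_free_cvg (AB : (seq 'I_n -> 'B(E)) * (seq 'I_n -> 'B(E))) :=
  forall (K : hilbertType R) (X : 'I_n -> 'B(K)), ncdom_rad m a X -> ph_cvg T AB X.

(* The coefficients of [Re F]; the constant term is made entirely analytic. *)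
Definition re_coefs A : (seq 'I_n -> 'B(E)) * (seq 'I_n -> 'B(E)) :=
  ((fun w => (2^-1 : R[i]) *: A w + if w == [::] then (2^-1 : R[i]) *: (A w)^~* else 0),
   (fun w => if w == [::] then 0 else (2^-1 : R[i]) *: (A w)^~*)).

Lemma re_coefsP A (K : hilbertType R) (X : 'I_n -> 'B(K)) :
  cvgn (series (holo_term T A X)) ->
  ph_cvg T (re_coefs A) X /\
  ph_sum T (re_coefs A) X = (2^-1 : R[i]) *: (holo_eval T A X + (holo_eval T A X)^~*).
Proof.
(* C carries the adjoint half of the constant term, which has no place in the antiholomorphic series
   and is added to the holomorphic one. *)
move=> cA; pose C w : 'B(E) := if w == [::] then (2^-1 : R[i]) *: (A w)^~* else 0.
have hC : series (holo_term T C X) @ \oo --> (2^-1 : R[i]) *: (holo_term T A X 0)^~*.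
  have -> : (2^-1 : R[i]) *: (holo_term T A X 0)^~* = holo_term T C X 0.
    by rewrite !holo_term0 tens_op_adjoint adjoint1 /C eqxx tens_opZl.
  have C0 k : holo_term T C X k.+1 = 0.
    apply: big1 => w _; rewrite /C -size_eq0 size_tuple /=.
    by rewrite tens_op0l.
  apply/cvg_rnormP => eps e0; exists 1%N => -[//|N] _.
  rewrite /series/= big_nat_recl// big1 ?addr0 ?subrr ?rnorm0//.
have cC : cvgn (series (holo_term T C X)) by apply/cvg_ex; eexists; exact: hC.
have [c1 e1] := holo_eval_lin (2^-1) cA cC.
have hB : series (fun k => antiholo_term T (re_coefs A).2 X k.+1) @ \oo -->
    (2^-1 : R[i]) *: ((holo_eval T A X)^~* - (holo_term T A X 0)^~*).
  have -> : series (fun k => antiholo_term T (re_coefs A).2 X k.+1) =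
      (fun N => (2^-1 : R[i]) *: 
        series (fun k => antiholo_term T (fun w => (A w)^~*) X k.+1) N).
    apply/funext => N; rewrite /series/= scaler_sumr; apply: eq_bigr => k _.
    rewrite /antiholo_term scaler_sumr; apply: eq_bigr => w _.
    by rewrite -size_eq0 size_tuple /= tens_opZl.
  by apply: cvgZr; exact: antiholo_series_lim.
split; first by split=> //; apply/cvg_ex; eexists; exact: hB.
rewrite /ph_sum (cvg_lim _ hB)// -/(holo_eval T (re_coefs A).1 X) e1.
rewrite [holo_eval T C X](cvg_lim _ hC)// -[X in X + _]/(_ *: _).
by rewrite scalerBr scalerDr addrCA subrK addrC.
Qed.

Variable H : hilbertType R.
Implicit Types (G : ('I_n -> 'B(H)) -> 'B(T H)).

(** Linear combinations of [re_coefs]. Convergence is recorded over every Hilbert space because the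
    coefficients are later evaluated at rW on F2, whereas the identity with G concerns H. *)
Lemma pluriharmonic_coefs G : pluriharmonic m a G ->
  exists AB : (seq 'I_n -> 'B(E)) * (seq 'I_n -> 'B(E)),
  [/\ AB.2 [::] = 0, ph_free_cvg AB & forall X, ncdom_rad m a X -> G X = ph_sum T AB X].
Proof.
move=> [_ [N [c [S [sS GS]]]]].
have /choice[F FP] (j : 'I_N) : exists A, free_holomorphic m a T A /\
    forall X, ncdom_rad m a X -> S j X = ph_sum T (re_coefs A) X.
  have [_ [A hA SA]] := sS j; exists A; split=> // X Xd.
  by rewrite SA// (re_coefsP (hA _ _ Xd)).2.
have [AB [B0 cAB GAB]] : exists AB, [/\ AB.2 [::] = 0, ph_free_cvg AB &
    forall X, ncdom_rad m a X -> \sum_(j < N) c j *: S j X = ph_sum T AB X].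
  have : forall s : seq 'I_N, exists AB, [/\ AB.2 [::] = 0, ph_free_cvg AB &
    forall X, ncdom_rad m a X -> \sum_(j <- s) c j *: S j X = ph_sum T AB X].
    elim=> [|j s [AB [B0 cAB GAB]]].
      exists (re_coefs (fun=> 0)); split; first by [].
        by move=> K X Xd; exact: (re_coefsP (free_holomorphic0 Xd)).1.
      move=> X Xd; rewrite big_nil (re_coefsP (free_holomorphic0 Xd)).2.
      by rewrite holo_eval0 adjoint0 addr0 scaler0.
    have [hF SF] := FP j; exists (coef_lin (c j) (re_coefs (F j)) AB); split.
    - by rewrite /coef_lin /re_coefs /= B0 scaler0 addr0.
    - move=> K X Xd; apply: (proj1 (ph_cvg_lin _ _ (cAB _ _ Xd))).
      exact: (re_coefsP (hF _ _ Xd)).1.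
    move=> X Xd; rewrite big_cons GAB// SF//.
    by rewrite (ph_cvg_lin _ (re_coefsP (hF _ _ Xd)).1 (cAB _ _ Xd)).2.
  exact.
by exists AB; split=> // X Xd; rewrite GS// GAB.
Qed.

Let alg : set 'B(T H) := [set V | exists (N : nat) (A : 'I_N -> 'B(E)) (X : 'I_N -> 'B(H)),
    V = \sum_(j < N) tens_op (T H) (A j) (X j)].

Let alg_lin c U V : alg U -> alg V -> alg (c *: U + V).
Proof.
move=> [N [A [X ->]]] [M [B [Y ->]]].
exists (N + M)%N, (fun j => match fintype.split j with inl i => c *: A i | inr i => B i end).
exists (fun j => match fintype.split j with inl i => X i | inr i => Y i end).
rewrite big_split_ord/= scaler_sumr; congr (_ + _); apply: eq_bigr => j _.
  by rewrite (unsplitK (inl j)) tens_opZl.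
by rewrite (unsplitK (inr j)).
Qed.

Let alg_adjoint U : alg U -> alg U^~*.
Proof.
move=> [N [A [X ->]]]; exists N, (fun j => (A j)^~*), (fun j => (X j)^~*).
by rewrite adjoint_sum; under eq_bigr do rewrite tens_op_adjoint.
Qed.

Lemma min_tensor_lin c (U V : 'B(T H)) :
  min_tensor U -> min_tensor V -> min_tensor (c *: U + V).
Proof.
move=> /closure_rnormP hU /closure_rnormP hV; apply/closure_rnormP => eps e0.
have c1 : 0 < rnorm c + 1 by rewrite ltr_wpDl ?rnorm_ge0.
have d0 : 0 < eps / (rnorm c + 1) by rewrite divr_gt0.
have [U' aU' UU'] := hU _ d0; have [V' aV' VV'] := hV _ d0.
exists (c *: U' + V'); first exact: alg_lin.
rewrite opprD addrACA -scalerBr (le_lt_trans (ler_rnormD _ _))// rnormZ.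
rewrite -[ltRHS](@divfK _ (rnorm c + 1)) ?gt_eqF// mulrDr mulr1 ler_ltD//.
by rewrite mulrC ler_wpM2r ?rnorm_ge0// ltW.
Qed.

Lemma min_tensor_adjoint (U : 'B(T H)) : min_tensor U -> min_tensor U^~*.
Proof.
move=> /closure_rnormP hU; apply/closure_rnormP => eps /hU[V aV UV].
by exists V^~*; [exact: alg_adjoint|rewrite -adjointB rnorm_adjoint].
Qed.

Lemma min_tensor_lim (u : nat -> 'B(T H)) (l : 'B(T H)) :
  u @ \oo --> l -> (forall k, alg (u k)) -> min_tensor l.
Proof.
move=> /cvg_rnormP ul au; apply/closure_rnormP => eps /ul[N HN].
by exists (u N); [exact: au|exact: HN].
Qed.

Lemma holo_eval_min_tensor A (X : 'I_n -> 'B(H)) :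
  cvgn (series (holo_term T A X)) -> min_tensor (holo_eval T A X).
Proof.
move=> cA; apply: (min_tensor_lim cA) => N.
have alg0 : alg 0 by exists 0%N, (fun=> 0), (fun=> 0); rewrite big_ord0.
have algD U V : alg U -> alg V -> alg (U + V).
  by move=> aU aV; rewrite -[U]scale1r; exact: alg_lin.
rewrite /series/=; apply: (big_ind alg) => // k _; apply: (big_ind alg) => // w _.
by exists 1%N, (fun=> A w), (fun=> word_op X w); rewrite big_ord1.
Qed.

Lemma sa_pluriharmonic_re A : free_holomorphic m a T A ->
  sa_pluriharmonic m a (fun X : 'I_n -> 'B(H) =>
    (2^-1 : R[i]) *: (holo_eval T A X + (holo_eval T A X)^~*)).
Proof.
move=> hA; split; last by exists A.
move=> X Xd; have h := holo_eval_min_tensor (hA _ _ Xd); have h' := min_tensor_adjoint h.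
have z : min_tensor (0 : 'B(T H)).
  by have := @min_tensor_lin (-1) _ _ h h; rewrite scaleN1r addNr.
have := @min_tensor_lin (2^-1) _ _ h (@min_tensor_lin (2^-1) _ _ h' z).
by rewrite addr0 -scalerDr.
Qed.

Lemma pluriharmonic_ph_sum AB : AB.2 [::] = 0 ->
  free_holomorphic m a T AB.1 -> free_holomorphic m a T (fun w => (AB.2 w)^~*) ->
  pluriharmonic m a (fun X : 'I_n -> 'B(H) => ph_sum T AB X).
Proof.
move=> B0 hA; set C := fun w => (AB.2 w)^~* => hC.
have sumE (X : 'I_n -> 'B(H)) : ncdom_rad m a X ->
    ph_sum T AB X = holo_eval T AB.1 X + (holo_eval T C X)^~*.
  move=> Xd; rewrite addrC /ph_sum; congr (_ + _); apply: cvg_lim => //.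
  have CC : (fun w => (C w)^~*) = AB.2 by apply/funext => w; rewrite /C adjointK.
  have := antiholo_series_lim (hC _ _ Xd).
  by rewrite CC holo_term0 /C B0 adjoint0 tens_op0l adjoint0 subr0.
(* With P and Q the functions of coefficients [AB.1] and [C], the sum is P + Q^* = Re (P + Q) + i Re
   (- i P + i Q). [A1] and [A2] are the coefficients inside the two real parts. *)
pose A1 w := 1 *: AB.1 w + C w.
pose A2 w := (- 'i : R[i]) *: AB.1 w + ('i *: C w + 0).
have h0 := free_holomorphic0.
have h1 : free_holomorphic m a T A1 by exact: free_holomorphic_lin.
have h2 : free_holomorphic m a T A2.
  by apply: free_holomorphic_lin => //; exact: free_holomorphic_lin.
have hsum (X : 'I_n -> 'B(H)) : ncdom_rad m a X -> ph_sum T AB X =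
    \sum_(j < 2) (if j == ord0 then 1 else 'i : R[i]) *:
      ((2^-1 : R[i]) *: (holo_eval T (if j == ord0 then A1 else A2) X +
                        (holo_eval T (if j == ord0 then A1 else A2) X)^~*)).
  move=> Xd; rewrite big_ord_recl big_ord1/= scale1r sumE//.
  have [cA cC] := (hA _ _ Xd, hC _ _ Xd).
  rewrite (holo_eval_lin _ cA cC).2.
  have [cC' eC'] := holo_eval_lin 'i cC (h0 _ _ Xd).
  rewrite (holo_eval_lin _ cA cC').2 eC'.
  rewrite holo_eval0.
  set P := holo_eval T AB.1 X; set Q := holo_eval T C X.
  rewrite !adjointD !adjointZ adjoint0 !addr0 rmorphN/= conjCi conjC1 opprK !scale1r.
  have hh (V : 'B(T H)) : (2^-1 : R[i]) *: V + (2^-1 : R[i]) *: V = V.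
    by rewrite -scalerDl -div1r -splitr scale1r.
  have i1 : 'i * 2^-1 * 'i = - 2^-1 :> R[i].
    by rewrite mulrAC -expr2 sqrCi mulN1r.
  rewrite !scaleNr !scalerDr !scalerN !scalerA i1 !scaleNr !opprK.
  rewrite addrACA [_ *: P + _ + _]addrACA subrr addr0.
  by rewrite [_ *: P^~* + _ + _]addrACA subrr add0r !hh.
split.
  move=> X Xd; rewrite sumE// -[holo_eval T AB.1 X]scale1r; apply: min_tensor_lin.
    by apply: holo_eval_min_tensor; exact: hA.
  by apply: min_tensor_adjoint; apply: holo_eval_min_tensor; exact: hC.
exists 2%N, (fun j : 'I_2 => if j == ord0 then 1 else 'i : R[i]).
exists (fun (j : 'I_2) (X : 'I_n -> 'B(H)) => (2^-1 : R[i]) *: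
  (holo_eval T (if j == ord0 then A1 else A2) X +
   (holo_eval T (if j == ord0 then A1 else A2) X)^~*)).
split=> // j; apply: sa_pluriharmonic_re.
by case: eqP.
Qed.

End FreePluriharmonic.

(** * Passage to the limit *)

Section Limit.
Variables (R : realType) (n m : nat) (a : seq 'I_n -> R).
Hypotheses (m1 : (1 <= m)%N) (ha : positive_regular a).
Variables (E : hilbertType R) (T : forall K : hilbertType R, hilbert_tensor E K).
Implicit Types (AB : (seq 'I_n -> 'B(E)) * (seq 'I_n -> 'B(E))).

Lemma scaled_ncdom_rad (K : hilbertType R) (X : 'I_n -> 'B(K)) t :
  0 <= t < 1 -> scaled_ncdom m a t X -> ncdom_rad m a X.
Proof. by move=> t01 Xd; exists t. Qed.

Lemma midpoint_in (t : R) : 0 <= t < 1 ->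
  [/\ 0 < (1 + t) / 2 < 1 & 0 <= t < (1 + t) / 2].
Proof.
move=> /andP[t0 t1]; split; apply/andP; split=> //.
- by rewrite divr_gt0// ltr_wpDr.
- by rewrite ltr_pdivrMr// mul1r; lra.
- by rewrite ltr_pdivlMr//; lra.
Qed.

Lemma cauchy_free_holomorphic A :
  (forall r, 0 < r < 1 -> exists2 M, 0 < M & cauchy_estimate m a A r M) ->
  free_holomorphic m a T A.
Proof.
move=> hA K X [t [t01 Xd]]; have [r01 tr] := midpoint_in t01.
have [M M0 hM] := hA _ r01; have /andP[r0 _] := r01.
exact: (holo_series_cvg m1 ha T r0 tr M0 hM Xd).1.
Qed.

(** The index N is chosen before the space K: one statement yields both the uniform convergence on
    rD over H and the convergence at rW over F2. *)
Lemma ph_sum_close (ABk : nat -> (seq 'I_n -> 'B(E)) * (seq 'I_n -> 'B(E))) AB :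
  (forall k, ph_free_cvg m a T (ABk k)) -> ph_free_cvg m a T AB ->
  (forall r eps, 0 < r < 1 -> 0 < eps -> exists N, forall k, (N <= k)%N ->
    cauchy_estimate m a (coefB (ABk k) AB).1 r eps /\
    cauchy_estimate m a (fun w => ((coefB (ABk k) AB).2 w)^~*) r eps) ->
  forall t eps, 0 <= t < 1 -> 0 < eps -> exists N, forall k, (N <= k)%N ->
    forall (K : hilbertType R) (X : 'I_n -> 'B(K)), scaled_ncdom m a t X ->
      rnorm (ph_sum T (ABk k) X - ph_sum T AB X) <= eps.
Proof.
move=> ck c hest t eps t01 e0; have [r01 tr] := midpoint_in t01.
set r := (1 + t) / 2 in r01 tr; have /andP[r0 _] := r01.
have q0 : 0 < (1 - t / r) ^+ m.+1.
  by rewrite exprn_gt0// subr_gt0 ltr_pdivrMr// mul1r; case/andP: tr.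
(* Chosen so that the bound 2 M / (1 - t/r)^(m+1) of [ph_sum_cvg] becomes eps. *)
have d0 : 0 < eps / 2 * (1 - t / r) ^+ m.+1 by rewrite mulr_gt0// divr_gt0.
have [N HN] := hest _ _ r01 d0; exists N => k Nk K X Xd.
have [hA hB] := HN k Nk; have Xr := scaled_ncdom_rad t01 Xd.
have [_ <-] := ph_cvgB (ck k K X Xr) (c K X Xr).
apply: (le_trans (ph_sum_cvg m1 ha T r0 tr d0 hA hB Xd).2).
by rewrite mulfK ?gt_eqF// mulrC divfK.
Qed.

End Limit.

Theorem theorem3p8 (R : realType) (n m : nat) (hn : (1 <= n)%N) (hm : (1 <= m)%N)
  (a : seq 'I_n -> R) (ha : positive_regular a)
  (E : hilbertType R) (hE : separable_space E)
  (H : hilbertType R) (hH : separable_space H)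
  (hHinf : infinite_dimensional H)
  (T : forall K : hilbertType R, hilbert_tensor E K)
  (F2 : hilbertType R) (e : seq 'I_n -> F2) (he : orthonormal_basis e)
  (W : 'I_n -> 'B(F2)) (hW : is_universal_model m a e W)
  (F : nat -> ('I_n -> 'B(H)) -> 'B(T H))
  (hF : forall k, pluriharmonic m a (F k))
  (hcvg : forall r : R, 0 <= r < 1 ->
    cvgn (fun k => ph_eval m a (F k) (scale_tuple r W))) :
  exists G : ('I_n -> 'B(H)) -> 'B(T H),
    [/\ pluriharmonic m a G,
        forall r : R, 0 <= r < 1 ->
          (fun k => ph_eval m a (F k) (scale_tuple r W)) @ \oo -->
            ph_eval m a G (scale_tuple r W) &
        forall r : R, 0 <= r < 1 ->
          forall eps : R, 0 < eps ->
            \forall k \near \oo, forall X : 'I_n -> 'B(H),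
              scaled_ncdom m a r X -> `|F k X - G X| <= eps%:C].
Proof.
have Wd := model_ncdom hm ha he hW.
have rWd r : scaled_ncdom m a r (scale_tuple r W) by exists W.
(* Uniqueness on H identifies the coefficients picked by [get] in [ph_eval] with any known ones;
   this is how infinite dimension of H enters. *)
have evalE (G : ('I_n -> 'B(H)) -> 'B(T H)) AB (K : hilbertType R) (X : 'I_n -> 'B(K)) :
    ph_coefs m a G AB -> ph_eval m a G X = ph_sum T AB X.
  move=> hAB; rewrite /ph_eval.
  have := @getPex _ (ph_coefs m a G) (ex_intro _ AB hAB).
  by move=> /(ph_coefs_unique hm ha hHinf)/(_ hAB) ->.
have /choice[ABk ABkP] k := pluriharmonic_coefs (hF k).
have Fk_eval k (K : hilbertType R) (X : 'I_n -> 'B(K)) :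
    ph_eval m a (F k) X = ph_sum T (ABk k) X.
  apply: evalE; have [B0 c FE] := ABkP k; split=> // X' Xd.
  by split; [exact: c|exact: FE].
have ck k : ph_free_cvg m a T (ABk k) by case: (ABkP k).
have W_cauchy r eps : 0 < r < 1 -> 0 < eps -> exists N, forall k l, (N <= k)%N -> (N <= l)%N ->
    cauchy_estimate m a (coefB (ABk k) (ABk l)).1 r eps /\
    cauchy_estimate m a (fun w => ((coefB (ABk k) (ABk l)).2 w)^~*) r eps.
  move=> /andP[r0 r1] e0; have r01 : 0 <= r < 1 by rewrite ltW.
  have e2 : 0 < eps / 2 by rewrite divr_gt0.
  have /cvg_rnormP/(_ _ e2)[N HN] := hcvg r r01.
  exists N => k l Nk Nl; have Wr := scaled_ncdom_rad r01 (rWd r).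
  have [cD sD] := ph_cvgB (ck k _ _ Wr) (ck l _ _ Wr).
  have sle : rnorm (ph_sum T (coefB (ABk k) (ABk l)) (scale_tuple r W)) <= eps.
    pose L := limn (fun k => ph_eval m a (F k) (scale_tuple r W)).
    rewrite sD -!Fk_eval (le_trans (ler_rdist_add L _ _))//.
    by rewrite [leRHS]splitr lerD// ltW ?HN// rdistC HN.
  have B0 : (coefB (ABk k) (ABk l)).2 [::] = 0.
    by rewrite /coefB/=; have [-> _ _] := ABkP k; have [-> _ _] := ABkP l; rewrite subrr.
  split; apply: (cauchy_estimate_le (rnorm_ge0 _) sle).
    exact: (holo_cauchy_estimate hm ha he hW cD).
  exact: (antiholo_cauchy_estimate hm ha he hW B0 cD).
have [|A [cA estA]] := coef_limit hm ha (A := fun k => (ABk k).1).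
  move=> r eps r01 e0; have [N HN] := W_cauchy r eps r01 e0.
  by exists N => k l Nk Nl; have [] := HN k l Nk Nl.
(* The antiholomorphic coefficients are replaced by their adjoints, the form in which they obey
   Cauchy estimates. *)
have [|C [cC estC]] := coef_limit hm ha (A := fun k w => ((ABk k).2 w)^~*).
  move=> r eps r01 e0; have [N HN] := W_cauchy r eps r01 e0.
  exists N => k l Nk Nl; have [_] := HN k l Nk Nl.
  rewrite (_ : (fun w => _) = fun w => ((ABk k).2 w)^~* - ((ABk l).2 w)^~*)//.
  by apply/funext => w; rewrite adjointB.
have C0 : C [::] = 0.
  have h : (fun k => ((ABk k).2 [::])^~*) @ \oo --> C [::] := cC [::].
  apply: (cvgn_eventually_const (N := 0) h) => k _.
  by have [-> _ _] := ABkP k; rewrite adjoint0.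
pose AB : (seq 'I_n -> 'B(E)) * (seq 'I_n -> 'B(E)) := (A, fun w => (C w)^~*).
have est r eps : 0 < r < 1 -> 0 < eps -> exists N, forall k, (N <= k)%N ->
    cauchy_estimate m a (coefB (ABk k) AB).1 r eps /\
    cauchy_estimate m a (fun w => ((coefB (ABk k) AB).2 w)^~*) r eps.
  move=> r01 e0; have [N1 HN1] := estA r eps r01 e0; have [N2 HN2] := estC r eps r01 e0.
  exists (maxn N1 N2) => k; rewrite geq_max => /andP[/HN1 h1 /HN2 h2]; split=> //.
  rewrite (_ : (fun w => _) = fun w => ((ABk k).2 w)^~* - C w)//.
  by apply/funext => w; rewrite /coefB/= adjointB adjointK.
(* The limit coefficients are those of one F_N minus a difference whose estimate is at most 1, so
   they inherit a Cauchy estimate at every radius. *)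
have bound r : 0 < r < 1 -> exists2 M, 0 < M &
    cauchy_estimate m a A r M /\ cauchy_estimate m a C r M.
  move=> r01; have [N /(_ N (leqnn N))[h1 h2]] := est r 1 r01 ltr01.
  have r01' : 0 <= r < 1 by case/andP: r01 => r0 ->; rewrite ltW.
  have Wr := scaled_ncdom_rad r01' (rWd r).
  have g1 := holo_cauchy_estimate hm ha he hW (ck N _ _ Wr).
  have B0 : (ABk N).2 [::] = 0 by case: (ABkP N).
  have g2 := antiholo_cauchy_estimate hm ha he hW B0 (ck N _ _ Wr).
  set M := rnorm _ in g1 g2.
  exists (2 * (M + 1)); first by rewrite mulr_gt0// ltr_wpDl ?rnorm_ge0.
  split.
    have := cauchy_estimateB hm ha (rnorm_ge0 _) ler01 g1 h1.
    rewrite (_ : (fun w => _) = A)//.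
    by apply/funext => w; rewrite /coefB/= opprB addrC subrK.
  have := cauchy_estimateB hm ha (rnorm_ge0 _) ler01 g2 h2.
  rewrite (_ : (fun w => _) = C)//.
  by apply/funext => w; rewrite /coefB/= adjointB adjointK opprB addrC subrK.
have hA : free_holomorphic m a T A.
  apply: cauchy_free_holomorphic => // r /bound[M M0 [h _]]; by exists M.
have CE : (fun w => (AB.2 w)^~*) = C by apply/funext => w; rewrite adjointK.
have hC : free_holomorphic m a T (fun w => (AB.2 w)^~*).
  rewrite CE; apply: cauchy_free_holomorphic => // r /bound[M M0 [_ h]]; by exists M.
have c : ph_free_cvg m a T AB.
  move=> K X [t [t01 Xd]]; have [r01 tr] := midpoint_in t01; have /andP[r0 _] := r01.
  have [M M0 [h1 h2]] := bound _ r01; rewrite -CE in h2.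
  have h1' : cauchy_estimate m a AB.1 ((1 + t) / 2) M := h1.
  exact: (ph_sum_cvg hm ha T r0 tr M0 h1' h2 Xd).1.
have AB0 : AB.2 [::] = 0 by rewrite /AB/= C0 adjoint0.
have close := ph_sum_close hm ha ck c est.
exists (fun X => ph_sum T AB X); split.
- exact: pluriharmonic_ph_sum.
- move=> r r01; rewrite (evalE _ AB); last by split=> // X Xd; split=> //; exact: c.
  (* The point rW belongs to rD over F2, so this is an instance of [close]; eps / 2 turns its large
     inequality into a strict one. *)
  apply/cvg_rnormP => eps e0; have e2 : 0 < eps / 2 by rewrite divr_gt0.
  have [N HN] := close r _ r01 e2; exists N => k Nk.
  rewrite Fk_eval rdistC (le_lt_trans (HN k Nk _ _ (rWd r)))//.
  by rewrite ltr_pdivrMr// ltr_pMr// ltr1n.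
move=> r r01 eps e0; have [N HN] := close r eps r01 e0.
exists N => // k Nk X Xd; rewrite normE lecR.
have [_ _ FE] := ABkP k; rewrite FE; first exact: HN.
exact: scaled_ncdom_rad Xd.
Qed.
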